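(* Let $F\in D(G_\gamma)$ with $0\le\gamma<+\infty$, let $f:\mathbb N^*\to\mathbb R_+$ and $s>0$ be fixed, and let $k=k(n)$ be integers with $1\le k<n$, $k\to\infty$, $k/n\to0$ as $n\to\infty$. Let $E_1,E_2,\dots$ be independent standard exponential random variables. All limits are as $n\to\infty$, and $\to_{\mathbb P}$ denotes convergence in probability. The quantities $T_n(f,s)$, $a_n(f,s)$, $\sigma_n(f,s)$, $B_n(f,s)$, $p_n(\lambda)$, $b_n(\lambda)$ and the function $a(\cdot)$ are defined in the context. **(A) Case $0<\gamma<+\infty$.** For $\lambda>1$ put $\Delta_{n,j}(\lambda)=p_n(\lambda)+\frac{E_j}{j}b_n(\lambda)$ and $$R_n(\lambda)=\sum_{j=1}^k f(j)\,s\left\{\frac{\gamma}{j}E_j+\Delta_{n,j}(\lambda)\right\}^{s-1}\Delta_{n,j}(\lambda).$$ (A1) If $\sum_{j\ge1}f(j)^2j^{-2s}<\infty$, $a_n(f,s)\to\infty$, and $a_n^{-1}(f,s)R_n(\lambda)\to_{\mathbb P}0$ for every $\lambda>1$, then $\left(T_n(f,s)/a_n(f,s)\right)^{1/s}\to_{\mathbb P}\gamma$. (A2) If $\sum_{j\ge1}f(j)^2j^{-2s}=+\infty$, $B_n(f,s)\to0$, $a_n^{-1}(f,s)\sigma_n(f,s)\to0$, and $\sigma_n^{-1}(f,s)R_n(\lambda)\to_{\mathbb P}0$ for every $\lambda>1$, then $\left(T_n(f,s)/a_n(f,s)\right)^{1/s}\to_{\mathbb P}\gamma$. **(B) Case $\gamma=0$.**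 Assume that $b_n(\lambda)\log k\to0$ for some $\lambda>1$. For $\lambda>1$ put $\Delta^0_{n,j}(\lambda)=p_n(\lambda)+\frac{E_j}{j}\max\{p_n(\lambda),\,b_n(\lambda)\log k\}$ and $$R^0_n(\lambda)=\sum_{j=1}^k f(j)\,s\left\{\frac{E_j}{j}+\Delta^0_{n,j}(\lambda)\right\}^{s-1}\Delta^0_{n,j}(\lambda).$$ (B1) If $\sum_{j\ge1}f(j)^2j^{-2s}<\infty$, $a_n(f,s)\to+\infty$, and $a_n^{-1}(f,s)R^0_n(\lambda)\to_{\mathbb P}0$ for every $\lambda>1$, then $$\frac{1}{a(k/n)}\left(\frac{T_n(f,s)}{a_n(f,s)}\right)^{1/s}\to_{\mathbb P}1.$$ (B2) If $\sum_{j\ge1}f(j)^2j^{-2s}=+\infty$, $B_n(f,s)\to0$, $a_n^{-1}(f,s)\sigma_n(f,s)\to0$, and $\sigma_n^{-1}(f,s)R^0_n(\lambda)\to_{\mathbb P}0$ for every $\lambda>1$, then $$\frac{1}{a(k/n)}\left(\frac{T_n(f,s)}{a_n(f,s)}\right)^{1/s}\to_{\mathbb P}1.$$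
   Context: $X_1,X_2,\dots$ are i.i.d. real random variables with $X_i>1$ and distribution function $F$; $X_{1,n}\le\dots\le X_{n,n}$ are the order statistics of $X_1,\dots,X_n$. $F\in D(G_\gamma)$ means that there are real sequences $\alpha_n>0$, $\beta_n$ with $F^n(\alpha_nx+\beta_n)\to G_\gamma(x)$ at continuity points, up to affine change of variable in the limit, where $G_\gamma(x)=\exp(-(1+\gamma x)^{-1/\gamma})$ for $1+\gamma x\ge0$ (and $G_0(x)=\exp(-e^{-x})$). Definitions: $$T_n(f,s)=\sum_{j=1}^k f(j)\left(\log X_{n-j+1,n}-\log X_{n-j,n}\right)^s,\qquad a_n(f,s)=\Gamma(s+1)\sum_{j=1}^k f(j)j^{-s},$$ $$\sigma_n^2(f,s)=\sum_{j=1}^k f^2(j)j^{-2s},\qquad B_n(f,s)=\max_{1\le j\le k} f(j)j^{-s}/\sigma_n(f,s).$$ Representations. Let $G(x)=F(e^x)$ be the distribution function of $\log X_1$ and $G^{-1}$ its generalized inverse, so $G^{-1}(1-u)=\log F^{-1}(1-u)$. With $F$ one associates a fixed pair of functions $(p,b)$ on $(0,1)$ with $p(u)\to0$, $b(u)\to0$ as $u\to0$, and a constant $c>0$, such that: - if $\gamma>0$ (Karamata representation): $G^{-1}(1-u)=\log c+\log(1+p(u))-\gamma\log u+\int_u^1 b(t)t^{-1}dt$, $0<u<1$; - if $\gamma=0$ (de Haan representation): $G^{-1}(1-u)=d-a(u)+\int_u^1 a(t)t^{-1}dt$, $0<u<1$, for a constant $d$, where $a(u)=c(1+p(u))\exp\left(\int_u^1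 b(t)t^{-1}dt\right)$. The existence of such representations is a known fact. For $\lambda>1$, $$p_n(\lambda)=\sup\{|p(t)|:0<t\le\lambda k/n\},\qquad b_n(\lambda)=\sup\{|b(t)|:0<t\le\lambda k/n\}$$ (for $n$ large enough that $\lambda k/n<1$). *)

(* Defs.v *)
From HB Require Import structures.
From mathcomp Require Import all_boot all_order all_algebra.
From mathcomp Require Import all_classical all_reals all_analysis.

Set Implicit Arguments.
Unset Strict Implicit.
Unset Printing Implicit Defensive.

Import Order.TTheory GRing.Theory Num.Theory.
Import numFieldNormedType.Exports.

Local Open Scope classical_set_scope.
Local Open Scope ring_scope.

Definition mutually_independent d (T : measurableType d) (R : realType)
    (P : probability T R) (X : nat -> {RV P >-> R}) : Prop :=
  forall (J : seq nat) (B : nat -> set R),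
    uniq J -> (forall i, measurable (B i)) ->
    P (\bigcap_(i in [set` J]) (X i @^-1` B i)) =
    (\prod_(i <- J) P (X i @^-1` B i))%E.

Definition cvg_in_probability d (T : measurableType d) (R : realType)
    (P : probability T R) (Y : nat -> T -> R) (l : R) : Prop :=
  forall e : R, 0 < e ->
    P [set w | e < `|Y n w - l|] @[n --> \oo] --> 0%E.

Section definitions.
Context {R : realType}.
Local Notation mu := (@lebesgue_measure R).

(* For gamma > 0 the inner formula is used only where 1 + gamma x > 0, because
   0 `^ r = 0 for r < 0 would give the value 1 instead of 0 at the endpoint. *)
Definition gev (gamma x : R) : R :=
  if gamma == 0 then expR (- expR (- x))
  else if 0 < 1 + gamma * x then
    expR (- ((1 + gamma * x) `^ (- gamma^-1)))
  else if 0 < gamma then 0 else 1.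

Definition domain_of_attraction (F : R -> R) (gamma : R) : Prop :=
  exists (alpha beta : nat -> R) (A B : R),
    [/\ 0 < A, (forall n, 0 < alpha n) &
    forall x : R, {for x, continuous (fun y : R => gev gamma (A * y + B))} ->
      (F (alpha n * x + beta n)) ^+ n @[n --> \oo] --> gev gamma (A * x + B)].

Definition gen_inverse (H : R -> R) (v : R) : R := inf [set x | v <= H x].

(* Here and in [dehaan_representation] the integrability conditions, and the
   condition -1 < p u, only say that the terms of the formula are defined
   ([Rintegral] and [ln] are total). The generalized inverse is that of
   x |-> F (e^x). *)
Definition karamata_representation (F : R -> R) (gamma c : R) (p b : R -> R)
    : Prop :=
  forall u, 0 < u < 1 ->
    [/\ -1 < p u,
        mu.-integrable `]u, 1[ (fun t => (b t / t)%:E) &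
        gen_inverse (fun x => F (expR x)) (1 - u) =
          ln c + ln (1 + p u) - gamma * ln u
          + Rintegral mu `]u, 1[ (fun t => b t / t)].

(* This is the function a of de Haan's representation. *)
Definition dehaan_aux (c : R) (p b : R -> R) (u : R) : R :=
  c * (1 + p u) * expR (Rintegral mu `]u, 1[ (fun t => b t / t)).

Definition dehaan_representation (F : R -> R) (c d : R) (p b : R -> R)
    : Prop :=
  forall u, 0 < u < 1 ->
    [/\ mu.-integrable `]u, 1[ (fun t => (b t / t)%:E),
        mu.-integrable `]u, 1[ (fun t => (dehaan_aux c p b t / t)%:E) &
        gen_inverse (fun x => F (expR x)) (1 - u) =
          d - dehaan_aux c p b u
          + Rintegral mu `]u, 1[ (fun t => dehaan_aux c p b t / t)].

Definition Gamma_fun (x : R) : R :=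
  Rintegral mu `]0, +oo[ (fun t => t `^ (x - 1) * expR (- t)).

(* The samples are indexed from 0, as are sorted sequences: [X i] stands for
   X_(i+1), and [order_stat X j n] is the j-th smallest of X_1, .., X_n,
   for 1 <= j <= n. *)
Definition order_stat (T : Type) (X : nat -> T -> R) (j n : nat) (w : T) : R :=
  nth 0 (sort <=%O [seq X i w | i <- iota 0 n]) j.-1.

Definition T_stat (T : Type) (X : nat -> T -> R) (f : nat -> R) (s : R)
    (k n : nat) (w : T) : R :=
  \sum_(1 <= j < k.+1)
    f j * (ln (order_stat X (n - j).+1 n w)
           - ln (order_stat X (n - j) n w)) `^ s.

Definition a_norm (f : nat -> R) (s : R) (k : nat) : R :=
  Gamma_fun (s + 1) * \sum_(1 <= j < k.+1) f j * j%:R `^ (- s).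

Definition sigma (f : nat -> R) (s : R) (k : nat) : R :=
  Num.sqrt (\sum_(1 <= j < k.+1) f j ^+ 2 * j%:R `^ (- (2 * s))).

Definition B_max (f : nat -> R) (s : R) (k : nat) : R :=
  \big[Order.max/0]_(1 <= j < k.+1) (f j * j%:R `^ (- s) / sigma f s k).

(* [local_sup p lambda k n] is p_n(lambda); it has its intended value as soon
   as lambda k / n < 1 and p is bounded on ]0, lambda k / n]. *)
Definition local_sup (g : R -> R) (lambda : R) (k n : nat) : R :=
  sup [set `|g t| | t in [set t | 0 < t <= lambda * k%:R / n%:R]].

(* In the next four definitions the exponential variables are also indexed
   from 0: [E j.-1] stands for E_j. *)
Definition Delta (p b : R -> R) (lambda : R) (k n j : nat) (e : R) : R :=
  local_sup p lambda k n + e / j%:R * local_sup b lambda k n.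

Definition Rem (T : Type) (E : nat -> T -> R) (f : nat -> R) (s gamma : R)
    (p b : R -> R) (lambda : R) (k n : nat) (w : T) : R :=
  \sum_(1 <= j < k.+1)
    let D := Delta p b lambda k n j (E j.-1 w) in
    f j * s * (gamma / j%:R * E j.-1 w + D) `^ (s - 1) * D.

Definition Delta0 (p b : R -> R) (lambda : R) (k n j : nat) (e : R) : R :=
  local_sup p lambda k n
  + e / j%:R * Order.max (local_sup p lambda k n)
                         (local_sup b lambda k n * ln k%:R).

Definition Rem0 (T : Type) (E : nat -> T -> R) (f : nat -> R) (s : R)
    (p b : R -> R) (lambda : R) (k n : nat) (w : T) : R :=
  \sum_(1 <= j < k.+1)
    let D := Delta0 p b lambda k n j (E j.-1 w) in
    f j * s * (E j.-1 w / j%:R + D) `^ (s - 1) * D.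

End definitions.

(* Main.v *)
(** By the quantile transform and the Renyi representation, the logarithms of
    the descending order statistics of a sample of size n are jointly
    distributed as the values of z |-> G^-1 (1 - e^-z) at the points
    Z_j = E_j / j + ... + E_n / n. The representation itself comes by induction
    on n from a race between a fresh exponential variable and the first gap
    E_n / n of the points already placed.

    On the event that Z_(k+1) >= ln (n / (lambda k)), whose probability tends
    to 1, the Karamata or de Haan formula shows that the j-th spacing, divided
    in the second case by a(k/n), differs from gamma E_j / j (gamma being
    replaced by 1) by at most a constant times Delta_(n,j). De Haan's formula
    needs moreover Z_1 <= ln (n k), so that |ln u - ln (k/n)| remains of order
    ln k at the points u = e^-Z_j in play.
    A perturbation inequality for x ^ s bounds the effect on T_n by a multiple
    of the remainder R_n. By Chebyshev's inequality the unperturbed sum of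
    f(j) (E_j / j) ^ s, divided by a_n, tends to 1, since
    sigma_n / a_n -> 0. *)
Require Import Defs.
From HB Require Import structures.
From mathcomp Require Import all_boot all_order all_algebra.
From mathcomp Require Import all_classical all_reals all_analysis.
From mathcomp Require Import measurable_realfun ring lra.
Set Implicit Arguments.
Unset Strict Implicit.
Unset Printing Implicit Defensive.
Import Order.TTheory GRing.Theory Num.Theory.
Import numFieldNormedType.Exports.
Local Open Scope classical_set_scope.
Local Open Scope ring_scope.

(** * Random lists and independent samples *)

(** The X_i and the E_j live on unrelated probability spaces, while the remainder is a function of
    the very E_j whose partial sums give the Z_j. No coupling is built: the limit being a constant,
    only the law of T_n for each fixed n matters, so the event about T_n is moved to the space of
    the E_j, where spacings and remainder are compared pointwise. Laws of lists are compared through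
    integrals of nonnegative functionals defined on lists of every length, because the inductions on
    n prepend a variable or insert a point. The error bound must have the exact shape of Delta: p_n
    may stand alone, but everything else must carry the factor E_j / j. For de Haan's formula a
    uniform estimate of a(u) / a(k/n) - 1 is therefore good enough under the integral sign, but not
    for the difference of the terms a(u) outside it, which is bounded through the increments of the
    two factors of a. *)

Section measure_uniqueness.
Context {R : realType}.

Lemma measure_rays_unique (m1 m2 : {measure set R -> \bar R}) :
  (forall x : R, m1 `]x, +oo[%classic = m2 `]x, +oo[%classic) ->
  (forall x : R, m1 `]x, +oo[%classic < +oo)%E ->
  forall A, measurable A -> m1 A = m2 A.
Proof.
move=> m12 moo A mA.
apply: (@measure_unique _ _ _ (@measurable_realfun.RGenOInfty.G R)
  (fun k => `](- k%:R)%R, +oo[%classic) (measurable_realfun.RGenOInfty.measurableE R) _ _ _ m1 m2 _ _ _ mA) => //.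
- move=> _ _ [x ->] [y ->]; exists (Order.max x y).
  apply/seteqP; split=> z /=; rewrite !in_itv/= !andbT gt_max.
    by move=> [-> ->].
  by move=> /andP[].
- by move=> k; exists (- k%:R).
- apply/seteqP; split => // x _; exists (Num.truncn `|x|).+1 => //=.
  rewrite in_itv/= andbT ltrNl (le_lt_trans (ler_norm _))// normrN.
  exact: truncnS_gt.
- by move=> _ [x ->].
Qed.

Lemma measure_tuple_unique n (m1 m2 : {measure set (n.-tuple R) -> \bar R}) :
  (forall B : 'I_n -> set R, (forall i, measurable (B i)) ->
    m1 [set t | forall i, B i (tnth t i)] =
    m2 [set t | forall i, B i (tnth t i)]) ->
  (m1 setT < +oo)%E ->
  forall A, measurable A -> m1 A = m2 A.
Proof.
move=> m12 moo A mA.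
pose G := [set A : set (n.-tuple R) | exists2 B : 'I_n -> set R,
  (forall i, measurable (B i)) & A = [set t | forall i, B i (tnth t i)]].
have mG : G `<=` measurable.
  move=> _ [B mB ->].
  rewrite (_ : [set _ | _] = \bigcap_(i in [set: 'I_n])
     ((@tnth n R ^~ i) @^-1` B i)); last first.
    by apply/seteqP; split => t /= h i; [move=> _|]; exact: h.
  apply: fin_bigcap_measurable => // i _.
  rewrite -[X in measurable X]setTI.
  exact: measurable_tnth.
apply: (@measure_unique _ _ _ G (fun=> setT) _ _ _ _ m1 m2 _ _ _ mA) => //.
- apply/seteqP; split; last first.
    by apply: smallest_sub => //; exact: sigma_algebra_measurable.
  apply: sub_sigma_algebra2 => C /=.
  rewrite -bigcup_seq/= => -[i _ [B mB <-]].
  exists (fun j => if j == i then B else setT); first by move=> j; case: ifP.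
  apply/seteqP; split => t /=.
    by move=> [_ Bt] j; case: eqP => // ->.
  by move=> /(_ i); rewrite eqxx.
- move=> _ _ [B1 mB1 ->] [B2 mB2 ->].
  exists (fun i => B1 i `&` B2 i); first by move=> i; exact: measurableI.
  apply/seteqP; split => t /=; first by move=> [h1 h2] i; split.
  by move=> h; split => i; have [] := h i.
- by move=> _; exists (fun=> setT) => //; apply/seteqP.
- by apply/seteqP; split => // x _; exists 0%N.
- by move=> _ [B mB ->]; exact: m12.
Qed.

End measure_uniqueness.

Section measurable_lists.
Context {R : realType}.

(** Measurability of a random list is taken coordinatewise at a fixed length; the default 0 of [nth]
    makes the coordinates past the end harmless constants. *)
Definition measurable_list d (T : measurableType d) (n : nat)
    (F : T -> seq R) :=
  (forall w, size (F w) = n) /\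
  forall i, measurable_fun setT (fun w => nth 0 (F w) i).

(** One function for lists of all lengths, so that an induction on the sample size can apply its
    hypothesis to [h \o cons x] or [h \o insert z] without casts between tuple types. *)
Definition measurable_functional (h : seq R -> \bar R) :=
  forall n, measurable_fun [set: n.-tuple R] (h \o @tval n R).

Lemma measurable_list_tuple n :
  measurable_list n (fun t : n.-tuple R => t : seq R).
Proof.
split=> [w|i]; first by rewrite size_tuple.
have [ni|ni] := leqP n i.
  rewrite (_ : (fun _ => _) = cst 0); first exact: measurable_cst.
  by apply/funext => t; rewrite nth_default ?size_tuple.
rewrite (_ : (fun _ => _) = @tnth n R ^~ (Ordinal ni)).
  exact: measurable_tnth.
by apply/funext => t; rewrite (tnth_nth 0).
Qed.

Section operations.
Context d (T : measurableType d).
Implicit Types F : T -> seq R.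

Definition tuple_of_list n F (w : T) : n.-tuple R :=
  [tuple nth 0 (F w) i | i < n].

Lemma tuple_of_listE n F w : size (F w) = n -> tuple_of_list n F w = F w :> seq R.
Proof.
move=> sF; apply: (@eq_from_nth _ 0) => [|i]; first by rewrite size_tuple.
by rewrite size_tuple => ni; rewrite -[i]/(nat_of_ord (Ordinal ni)) -tnth_nth tnth_mktuple.
Qed.

Lemma measurable_tuple_of_list n F : measurable_list n F ->
  measurable_fun setT (tuple_of_list n F).
Proof.
move=> [sF mF]; apply/measurable_fun_tnthP => i.
rewrite (_ : _ \o _ = fun w => nth 0 (F w) i); first exact: mF.
by apply/funext => w /=; rewrite tnth_mktuple.
Qed.

Lemma measurable_functional_comp n h F :
  measurable_functional h -> measurable_list n F ->
  measurable_fun setT (h \o F).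
Proof.
move=> mh mF.
rewrite (_ : h \o F = (h \o @tval n R) \o tuple_of_list n F).
  by apply: measurableT_comp (mh n) _; exact: measurable_tuple_of_list.
by apply/funext => w /=; rewrite tuple_of_listE//; case: mF.
Qed.

Lemma measurable_list_nil : measurable_list 0 (fun _ : T => [::]).
Proof.
by split=> // i; under eq_fun do rewrite nth_nil; exact: measurable_cst.
Qed.

Lemma measurable_list_cons n (x : T -> R) F :
  measurable_fun setT x -> measurable_list n F ->
  measurable_list n.+1 (fun w => x w :: F w).
Proof.
by move=> mx [sF mF]; split=> [w|[|i]] //=; rewrite sF.
Qed.

Lemma measurable_list_behead n F : measurable_list n.+1 F ->
  measurable_list n (fun w => behead (F w)).
Proof.
move=> [sF mF]; split=> [w|i]; first by rewrite size_behead sF.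
by under eq_fun do rewrite nth_behead; exact: mF.
Qed.

Lemma measurable_list_eta n F : measurable_list n.+1 F ->
  F = (fun w => nth 0 (F w) 0 :: behead (F w)).
Proof.
by move=> [sF _]; apply/funext => w; have := sF w; case: (F w).
Qed.

Lemma measurable_list0 F : measurable_list 0 F -> F = (fun=> [::]).
Proof. by move=> [sF _]; apply/funext => w; apply: size0nil. Qed.

Lemma measurable_list_if n (b : T -> bool) F G :
  measurable_fun setT b -> measurable_list n F -> measurable_list n G ->
  measurable_list n (fun w => if b w then F w else G w).
Proof.
move=> mb [sF mF] [sG mG]; split=> [w|i]; first by case: ifP; rewrite ?sF ?sG.
rewrite (_ : (fun _ => _) =
  fun w => if b w then nth 0 (F w) i else nth 0 (G w) i).
  exact: measurable_fun_ifT.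
by apply/funext => w; case: ifP.
Qed.

Lemma measurable_list_map n F (q : R -> R) :
  measurable_fun setT q -> measurable_list n F ->
  measurable_list n (fun w => map q (F w)).
Proof.
move=> mq; elim: n F => [F mF|n IH F mF].
  by rewrite (measurable_list0 mF); exact: measurable_list_nil.
rewrite (measurable_list_eta mF) /=; apply: measurable_list_cons.
  by apply: measurableT_comp => //; case: mF.
exact/IH/measurable_list_behead.
Qed.

End operations.
End measurable_lists.

Section samples.
Context {R : realType} d (T : measurableType d).

(** The last variable comes first: enlarging the sample is a [cons], and the head is the variable
    that Renyi's formula divides by the length of the list. *)
Fixpoint sample (X : nat -> T -> R) (n : nat) (w : T) : seq R :=
  if n is m.+1 then X m w :: sample X m w else [::].

Lemma size_sample X n w : size (sample X n w) = n.
Proof. by elim: n => //= n ->. Qed.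

Lemma nth_sample X n w i : (i < n)%N -> nth 0 (sample X n w) i = X (n - i.+1)%N w.
Proof.
elim: n i => [|n IH] [|i] //=; first by rewrite subn1.
by rewrite ltnS subSS => /IH.
Qed.

Lemma measurable_sample X n : (forall i, measurable_fun setT (X i)) ->
  measurable_list n (sample X n).
Proof.
move=> mX; elim: n => [|n IH]; first exact: measurable_list_nil.
exact: measurable_list_cons.
Qed.

End samples.

Section independent_samples.
Context {R : realType} d (T : measurableType d) (P : probability T R).
Variables (X : nat -> {RV P >-> R}) (nu : probability R R).
Hypothesis X_indep : mutually_independent X.
Hypothesis X_law : forall i A, measurable A -> P (X i @^-1` A) = nu A.

Let mX i : measurable_fun setT (X i). Proof. by []. Qed.
Let msample n : measurable_list n (sample X n). Proof. exact: measurable_sample. Qed.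
Let S n : T -> n.-tuple R := tuple_of_list n (sample X n).
Let mS n : measurable_fun setT (S n).
Proof. exact: measurable_tuple_of_list. Qed.

Let mpre d' (T' : measurableType d') (Y : T -> T') (A : set T') :
  measurable_fun setT Y -> measurable A -> measurable (Y @^-1` A).
Proof. by move=> mY mA; rewrite -[X in measurable X]setTI; exact: mY. Qed.

(** Both sides are finite measures in [C] that agree on boxes by mutual independence, and boxes
    determine a finite measure on tuples. *)
Lemma sample_independent n (A : set R) (C : set (n.-tuple R)) :
  measurable A -> measurable C ->
  P (X n @^-1` A `&` S n @^-1` C) = (nu A * P (S n @^-1` C))%E.
Proof.
move=> mA mC.
have mXA : measurable (X n @^-1` A) by exact: mpre.
pose m1_ : {measure set (n.-tuple R) -> \bar R} :=
  pushforward (mrestr P mXA) (S n).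
pose m1 := m1_ (@mS n).
have nuA0 : 0 <= fine (nu A) by rewrite fine_ge0.
pose m2 : {measure set (n.-tuple R) -> \bar R} :=
  mscale (NngNum nuA0) (distribution P (mfun_Sub (mem_set (@mS n)))).
have : m1 C = m2 C.
  apply: measure_tuple_unique => //; last first.
    rewrite /m1 /m1_ /= /pushforward /mrestr/=.
    by rewrite preimage_setT setTI ltey_eq fin_num_measure.
  move=> B mB.
  (* Position [i] of the list holds the variable of index [n - i.+1], a reversal that is its own
     inverse. *)
  pose B' (j : nat) := if insub (n - j.+1)%N is Some i then B i else setT.
  have mB' j : measurable (B' j) by rewrite /B'; case: insub.
  pose B'' j := if j == n then A else B' j.
  have mB'' j : measurable (B'' j) by rewrite /B''; case: ifP.
  have SE : S n @^-1` [set t | forall i, B i (tnth t i)] =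
            \bigcap_(j in [set` iota 0 n]) (X j @^-1` B' j).
    apply/seteqP; split=> [w /= h j /=|w /= h i].
      rewrite mem_iota add0n => /= jn.
      rewrite /B' insubT => [|ji]; first by rewrite -subSn// subSS leq_subr.
      have := h (Sub (n - j.+1)%N ji).
      rewrite tnth_mktuple nth_sample//= -subSn// subSS.
      by rewrite subKn// ltnW.
    have jn : (n - i.+1 < n)%N by rewrite ltn_subrL/= (leq_ltn_trans _ (ltn_ord i)).
    have := h (n - i.+1)%N; rewrite /= mem_iota add0n => /(_ jn).
    rewrite /B' tnth_mktuple nth_sample// -subSn// subSS subKn; last exact: ltnW.
    by rewrite insubT// => ni; congr (B _ _); exact: val_inj.
  have PA : P (\bigcap_(j in [set` n :: iota 0 n]) (X j @^-1` B'' j)) =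
     (nu A * \prod_(j <- iota 0 n) P (X j @^-1` B' j))%E.
    rewrite X_indep//; last by rewrite /= iota_uniq mem_iota add0n ltnn.
    rewrite big_cons {1}/B'' eqxx X_law//; congr (_ * _)%E.
    apply: eq_big_seq => j; rewrite mem_iota add0n => /= jn.
    by rewrite /B'' ltn_eqF.
  have QA : P (\bigcap_(j in [set` iota 0 n]) (X j @^-1` B' j)) =
     (\prod_(j <- iota 0 n) P (X j @^-1` B' j))%E.
    by rewrite X_indep//; exact: iota_uniq.
  rewrite /m1 /m1_ /m2 /= /pushforward /mrestr /mscale /distribution /pushforward /=.
  rewrite -[distribution _ _ _]/(P (S n @^-1` _)) fineK ?fin_num_measure// SE QA -PA; congr (P _).
  apply/seteqP; split=> w /=.
    move=> [h XA] j /=; rewrite inE /B'' => /orP[/eqP ->|jn]; first by rewrite eqxx.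
    have := jn; rewrite mem_iota add0n => /= /ltn_eqF ->; exact: h.
  move=> h; split=> [j /= jn|].
    have := h j; rewrite /= inE jn orbT => /(_ isT).
    by move: jn; rewrite mem_iota add0n /B'' => /= /ltn_eqF ->.
  by have := h n; rewrite /= inE eqxx => /(_ isT); rewrite /B'' eqxx.
rewrite /m1 /m1_ /m2 /= /pushforward /mrestr /mscale /distribution /pushforward /=.
by rewrite -[distribution _ _ _]/(P (S n @^-1` _)) fineK ?fin_num_measure// setIC.
Qed.

(** The pair formed by the new variable and the old sample has a product law, so Tonelli applies.
    The inductions on the sample size use independence in this form. *)
Lemma integral_sampleS n (h : seq R -> \bar R) :
  measurable_functional h -> (forall l, 0 <= h l)%E ->
  (\int[P]_w h (sample X n.+1 w) =
   \int[nu]_x \int[P]_w h (x :: sample X n w))%E.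
Proof.
move=> mh h0.
pose Sn : {mfun T >-> n.-tuple R} := mfun_Sub (mem_set (@mS n)).
have mXS : measurable_fun setT (fun w => (X n w, S n w)).
  by apply: measurable_fun_pair; [exact: mX|exact: mS].
pose XS : {mfun T >-> (R * n.-tuple R)%type} := mfun_Sub (mem_set mXS).
pose g (z : R * n.-tuple R) := h (z.1 :: z.2).
have mg : measurable_fun setT g.
  apply: (@measurable_functional_comp _ _ _ n.+1 h (fun z : R * n.-tuple R => z.1 :: z.2 : seq R)) => //.
  apply: measurable_list_cons => //.
  have [sz mz] := @measurable_list_tuple R n.
  by split=> [w|i]; [exact: sz|apply: measurableT_comp (mz i) _].
transitivity (\int[distribution P XS]_z g z)%E.
  rewrite (@ge0_integral_distribution _ _ _ _ _ P XS g mg (fun=> h0 _)).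
  by apply: eq_integral => w _; rewrite /g /= tuple_of_listE// size_sample.
transitivity (\int[nu \x distribution P Sn]_z g z)%E.
  apply: eq_measure_integral => A mA _; apply/esym.
  apply: product_measure_unique => // {mA} {}A B mA mB.
  rewrite /distribution /pushforward /=; exact: sample_independent.
rewrite fubini_tonelli1//; last by move=> ?; exact: h0.
apply: eq_integral => x _; rewrite /fubini_F (@ge0_integral_distribution _ _ _ _ _ P Sn (fun t => g (x, t))).
- by apply: eq_integral => w _ /=; rewrite /g /= tuple_of_listE// size_sample.
- by apply: measurableT_comp mg _; exact: measurable_fun_pair.
- by move=> y; exact: h0.
Qed.

End independent_samples.

(** * Densities and the exponential law *)

Section density.
Local Open Scope ereal_scope.
Context d (T : measurableType d) {R : realType}.
Variables (mu nu : {measure set T -> \bar R}) (g : T -> R).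
Hypothesis mg : measurable_fun setT g.
Hypothesis g0 : forall x, (0 <= g x)%R.
Hypothesis nuE : forall A, measurable A -> nu A = \int[mu]_(x in A) (g x)%:E.

Let integral_density_indic A : measurable A ->
  \int[nu]_x (\1_A x)%:E = \int[mu]_x ((\1_A x)%:E * (g x)%:E).
Proof.
move=> mA; rewrite integral_indic// setIT nuE// integral_mkcond.
apply: eq_integral => x _; rewrite patchE indicE.
by case: ifP => _; rewrite ?mul1e ?mul0e.
Qed.

Import HBNNSimple.

Let integral_density_nnsfun (f : {nnsfun T >-> R}) :
  \int[nu]_x (f x)%:E = \int[mu]_x ((f x)%:E * (g x)%:E).
Proof.
under [LHS]eq_integral do rewrite fimfunE -fsumEFin//.
rewrite [LHS]ge0_integral_fsum//; last 2 first.
  - by move=> r; exact/measurable_EFinP/measurableT_comp.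
  - by move=> n x _; rewrite EFinM nnfun_muleindic_ge0.
under [RHS]eq_integral.
  move=> x xD; rewrite fimfunE -fsumEFin// muleC ge0_mule_fsumr; last first.
    by move=> r; rewrite EFinM nnfun_muleindic_ge0.
  over.
have mgf r : measurable_fun setT (fun x => (g x)%:E * (r * \1_(f @^-1` [set r]) x)%:E).
  apply: emeasurable_funM; first exact/measurable_EFinP.
  exact/measurable_EFinP/measurableT_comp.
rewrite [RHS]ge0_integral_fsum//; last first.
  by move=> n x _; rewrite EFinM mule_ge0 ?lee_fin// -lee_fin EFinM nnfun_muleindic_ge0.
apply: eq_fsbigr => r rf.
have r0 : (0 <= r)%R by move: rf; rewrite inE => -[x _ <-].
under eq_integral do rewrite EFinM.
rewrite ge0_integralZl//; last exact/measurable_EFinP.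
rewrite integral_density_indic// -ge0_integralZl//; last 2 first.
- by apply: emeasurable_funM; exact/measurable_EFinP.
- by move=> x _; rewrite -EFinM lee_fin mulr_ge0.
by apply: eq_integral => x _; rewrite [in RHS]EFinM [RHS]muleCA (muleC (g x)%:E).
Qed.

(** Extends the hypothesis from indicators to simple functions, then by monotone convergence. It
    serves for restricted measures, whose density is an indicator, and for the exponential law. *)
Lemma ge0_integral_density (f : T -> \bar R) :
  measurable_fun setT f -> (forall x, 0 <= f x) ->
  \int[nu]_x f x = \int[mu]_x (f x * (g x)%:E).
Proof.
move=> mf f0.
pose f_ := nnsfun_approx measurableT mf.
transitivity (lim (\int[nu]_x (f_ n x)%:E @[n --> \oo])).
  rewrite -monotone_convergence//=.
  - apply: eq_integral => ? /[!inE] xD; apply/esym/cvg_lim => //=.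
    exact: cvg_nnsfun_approx.
  - by move=> n; exact/measurable_EFinP/measurable_funTS.
  - by move=> n ? _; rewrite lee_fin.
  - by move=> ? _ ? ? mn; rewrite lee_fin; exact/lefP/nd_nnsfun_approx.
rewrite [RHS](_ : _ = lim (\int[mu]_x ((f_ n x)%:E * (g x)%:E) @[n --> \oo])).
  by apply: congr_lim; apply/funext => n /=; exact: integral_density_nnsfun.
rewrite -monotone_convergence//=.
- apply: eq_integral => x _; apply/esym/cvg_lim => //.
  by apply: cvgeZr => //; exact: cvg_nnsfun_approx.
- by move=> n; apply: emeasurable_funM; apply/measurable_EFinP => //; exact: measurable_funTS.
- by move=> n x _; rewrite -EFinM lee_fin mulr_ge0.
- move=> x _ ? ? mn; rewrite -!EFinM lee_fin ler_wpM2r//.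
  exact/lefP/nd_nnsfun_approx.
Qed.

End density.

Lemma ge0_integral_mrestr d (T : measurableType d) (R : realType)
    (mu : {measure set T -> \bar R}) (D : set T) (mD : measurable D)
    (f : T -> \bar R) :
  measurable_fun setT f -> (forall x, 0 <= f x)%E ->
  (\int[mrestr mu mD]_x f x = \int[mu]_x if x \in D then f x else 0)%E.
Proof.
move=> mf f0; rewrite [LHS](@ge0_integral_density _ _ _ mu _ (\1_D))//.
  apply: eq_integral => x _; rewrite indicE.
  by case: ifP; rewrite ?mule1 ?mule0.
by move=> A mA; rewrite integral_indic// setIC.
Qed.

Section exponential_law.
Context {R : realType}.
Local Notation leb := (@lebesgue_measure R).

(* [exponential_prob] as a measure on [R] with its default measurable
   structure: the library's instance lives on [measurableTypeR R], a
   structure with another display. *)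
Definition exponential_law (r : R) : set R -> \bar R := exponential_prob r.

Section rate.
Variable r : R.
Hypothesis r_gt0 : 0 < r.

Let lib_measure : {measure set (measurableTypeR R) -> \bar R}.
Proof. refine (exponential_prob r : {measure set _ -> \bar _}); exact: r_gt0. Defined.

Let exponential_law0 : exponential_law r set0 = 0%E.
Proof. by rewrite /exponential_law /exponential_prob integral_set0. Qed.

Let exponential_law_ge0 A : (0 <= exponential_law r A)%E.
Proof.
by apply: integral_ge0 => x _; rewrite lee_fin exponential_pdf_ge0// ltW.
Qed.

Let exponential_law_sigma_additive : semi_sigma_additive (exponential_law r).
Proof. exact: (@measure_semi_sigma_additive _ _ _ lib_measure). Qed.

HB.instance Definition _ := isMeasure.Build _ R R
  (exponential_law r) exponential_law0 exponential_law_ge0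
  exponential_law_sigma_additive.

Let exponential_law_setT : exponential_law r setT = 1%E.
Proof. exact: integral_exponential_pdf. Qed.

HB.instance Definition _ := @Measure_isProbability.Build _ R R
  (exponential_law r) exponential_law_setT.

Definition exponential_measure : probability R R.
Proof. refine (exponential_law r : probability _ _); exact: r_gt0. Defined.

Lemma exponential_measureE A : exponential_measure A = exponential_prob r A.
Proof. by []. Qed.

Lemma exponential_law_ray (t : R) : 0 <= t ->
  exponential_measure `]t, +oo[%classic = (expR (- r * t))%:E.
Proof.
move=> t0.
have cE : continuous (fun x : R => - expR (- r * x)).
  move=> x; apply: cvgN; apply: continuous_comp; last exact: continuous_expR.
  by apply: cvgM; [exact: cvg_cst|exact: cvg_id].
rewrite /exponential_measure /= /exponential_law /exponential_prob integral_itv_obnd_cbnd; last first.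
  apply/measurable_EFinP/measurable_funTS; exact: measurable_exponential_pdf.
rewrite (@ge0_continuous_FTC2y _ _ (fun x => - expR (- r * x)) _ 0)//.
- by rewrite EFinN oppeK add0e.
- by move=> x _; apply: exponential_pdf_ge0; exact: ltW.
- apply: (@continuous_subspaceW R^o _ _ [set` `[0, +oo[%R]).
    by apply: subset_itvr; rewrite bnd_simp.
  exact: within_continuous_exponential_pdf.
- rewrite -oppr0; apply: cvgN.
  rewrite (_ : (fun x => expR (- r * x)) =
               (fun z => expR (- z)) \o (fun z => r * z)); last first.
    by apply: eq_fun => x; rewrite mulNr.
  apply: (@cvg_comp _ _ _ _ _ _ (pinfty_nbhs R)); last exact: cvgr_expR.
  exact: gt0_cvgMry.
- by apply/cvg_at_right_filter; exact: cE.
- move=> x; rewrite in_itv/= andbT => tx; apply: derive1_exponential_pdf.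
  by rewrite in_itv/= andbT (le_lt_trans t0).
Qed.

Lemma exponential_law_ray_lt0 (t : R) : t <= 0 ->
  exponential_measure `]t, +oo[%classic = 1%E.
Proof.
move=> t0; apply/eqP; rewrite eq_le probability_le1//=.
have <- : exponential_law r `]0, +oo[%classic = 1%E.
  by rewrite exponential_law_ray// mulr0 expR0.
by apply: le_measure; rewrite ?inE//; apply: subset_itvr; rewrite bnd_simp.
Qed.

Lemma integral_exponential_law (f : R -> \bar R) :
  measurable_fun setT f -> (forall x, 0 <= f x)%E ->
  (\int[exponential_measure]_x f x =
   \int[leb]_x (f x * (exponential_pdf r x)%:E))%E.
Proof.
move=> mf f0.
have mid : measurable_fun [set: R] (fun x : R => x : measurableTypeR R) by [].
pose nu_ : {measure set (measurableTypeR R) -> \bar R} :=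
  pushforward exponential_measure (fun x : R => x : measurableTypeR R).
transitivity (\int[nu_ mid]_x f x)%E.
  by rewrite /nu_ ge0_integral_pushforward//; move=> ? _; exact: f0.
apply: ge0_integral_density => //.
- exact: measurable_exponential_pdf.
- by move=> x; rewrite exponential_pdf_ge0// ltW.
Qed.

End rate.

Local Notation std := (@exponential_measure 1 ltr01).

(** The law does not charge the nonpositive half-line, where shifts by a negative amount or powers
    of a negative number would spoil the formulas. *)
Lemma eq_integral_std_exponential (f g : R -> \bar R) :
  measurable_fun setT f -> measurable_fun setT g ->
  (forall x, 0 < x -> f x = g x) -> (\int[std]_x f x = \int[std]_x g x)%E.
Proof.
move=> mf mg fg; apply: ae_eq_integral => //.
exists (~` `]0, +oo[%classic); split; first exact: measurableC.
  have /= := @probability_setC _ _ _ std `]0, +oo[%classic.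
  by rewrite exponential_law_ray// mulr0 expR0 subee// => ->.
move=> x /= nfg /=; rewrite in_itv/= andbT => x0; apply: nfg => _; exact: fg.
Qed.

Let pushforward_std (phi : R -> R) : measurable_fun setT phi -> {measure set R -> \bar R}.
Proof. by refine (fun mphi => (pushforward std phi : {measure set _ -> \bar _})). Defined.

Lemma integral_exponential_scale (r : R) (r0 : 0 < r) (g : R -> \bar R) :
  measurable_fun setT g -> (forall x, 0 <= g x)%E ->
  (\int[exponential_measure r0]_x g x = \int[std]_x g (x / r)%R)%E.
Proof.
move=> mg g0.
have mphi : measurable_fun [set: R] (fun x : R => x / r) by exact: mulrr_measurable.
transitivity (\int[pushforward_std mphi]_x g x)%E; last first.
  by rewrite /pushforward_std ge0_integral_pushforward//; move=> ? _; exact: g0.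
apply: eq_measure_integral => A mA _.
apply: (measure_rays_unique _ _ mA) => {A mA} t; last first.
  by rewrite ltey_eq fin_num_measure.
have -> : pushforward_std mphi `]t, +oo[%classic = std `](t * r), +oo[%classic.
  rewrite /= /pushforward; congr (exponential_law _ _); apply/seteqP; split=> x /=;
    by rewrite !in_itv/= !andbT ltr_pdivlMr.
have [t0|t0] := leP 0 t.
  have tr0 : 0 <= t * r by rewrite mulr_ge0// ltW.
  rewrite [LHS](exponential_law_ray r0 t0) [RHS](exponential_law_ray ltr01 tr0).
  by congr ((expR _)%:E); ring.
have tr0 : t * r <= 0 by rewrite nmulr_rle0// ltW.
by rewrite [LHS](exponential_law_ray_lt0 r0 (ltW t0)) [RHS](exponential_law_ray_lt0 ltr01 tr0).
Qed.

(** The weight e^(-cx) turns the density e^(-x) into (1 + c)^-1 times the density of rate 1 + c,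
    which is that of x / (1 + c). *)
Lemma integral_exponential_tilt (c : R) (g : R -> \bar R) : 0 < 1 + c ->
  measurable_fun setT g -> (forall x, 0 <= g x)%E ->
  (\int[std]_x ((expR (- (c * x))%R)%:E * g x) =
   (1 + c)^-1%:E * \int[std]_x g (x / (1 + c))%R)%E.
Proof.
move=> c0 mg g0.
rewrite -(integral_exponential_scale c0)// !integral_exponential_law//; last 2 first.
- apply: emeasurable_funM => //; apply/measurable_EFinP.
  apply: measurableT_comp => //; apply: measurableT_comp => //.
- by move=> x; rewrite mule_ge0.
rewrite -ge0_integralZl//; last 3 first.
- apply: emeasurable_funM => //; apply/measurable_EFinP.
  exact: measurable_exponential_pdf.
- by move=> x _; rewrite mule_ge0// lee_fin exponential_pdf_ge0// ltW.
- by rewrite lee_fin invr_ge0 ltW.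
apply: eq_integral => x _; have [x0|x0] := ltP x 0.
  by rewrite !lt0_exponential_pdf// !mule0.
rewrite !exponential_pdfE//= muleAC [RHS]muleCA muleC; congr (_ * _)%E.
rewrite -!EFinM; congr EFin.
by rewrite mul1r [RHS]mulrA mulVf ?gt_eqF// mul1r -expRD; congr expR; ring.
Qed.

(** Memorylessness: past [a] the variable starts afresh, and the survival probability comes out as a
    factor. *)
Lemma integral_exponential_shift (a : R) (g : R -> \bar R) : 0 <= a ->
  measurable_fun setT g -> (forall x, 0 <= g x)%E ->
  (\int[std]_x (if (a < x)%R then g (x - a)%R else 0) =
   (expR (- a))%:E * \int[std]_x g x)%E.
Proof.
move=> a0 mg g0.
have mphi : measurable_fun [set: R] (fun x : R => x - a) by exact: measurable_funB.
pose m2 : {measure set R -> \bar R} := mscale (NngNum (expR_ge0 (- a))) std.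
have mD : measurable (`]a, +oo[%classic : set R) by [].
pose m1_ : {measure set R -> \bar R} := pushforward (mrestr std mD) (fun x : R => x - a).
pose m1 := m1_ mphi.
(* The restriction to points beyond [a] cuts off the rays with t < 0, whence the maximum. *)
have m1E t : m1 `]t, +oo[%classic = (expR (- (a + Num.max t 0)))%:E.
  have -> : m1 `]t, +oo[%classic = std `](a + Num.max t 0), +oo[%classic.
    rewrite /m1 /m1_ /= /pushforward /mrestr; congr (exponential_law _ _).
    apply/seteqP; split=> x /=; rewrite !in_itv/= !andbT.
      by move=> [ta ax]; rewrite -ltrBrDl gt_max ta subr_gt0.
    by rewrite -ltrBrDl gt_max subr_gt0 => /andP[].
  rewrite exponential_law_ray ?mulN1r//.
  by rewrite addr_ge0// le_max lexx orbT.
have m12 A : measurable A -> m1 A = m2 A.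
  move=> mA; apply: (measure_rays_unique _ _ mA) => {A mA} t; rewrite m1E ?ltry//.
  apply/esym; transitivity ((expR (- a))%:E * std `]t, +oo[%classic)%E; first by [].
  have [t0|t0] := leP t 0.
    by rewrite exponential_law_ray_lt0// mule1 addr0.
  by rewrite exponential_law_ray ?ltW// -EFinM -expRD; congr ((expR _)%:E); ring.
transitivity (\int[m1]_x g x)%E; last first.
  rewrite (eq_measure_integral m2); last by move=> A mA _; exact: m12.
  by rewrite /m2 ge0_integral_mscale.
rewrite [RHS](ge0_integral_pushforward mphi (mrestr std mD) measurableT mg (fun y _ => g0 y)).
rewrite preimage_setT ge0_integral_mrestr.
- by apply: eq_integral => x _; rewrite mem_setE in_itv/= andbT.
- by apply: measurableT_comp mg _; exact: measurable_funB.
- by move=> x; exact: g0.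
Qed.

End exponential_law.

Global Opaque exponential_measure.

(** * Renyi representation of exponential order statistics *)

Section list_operations.
Context {R : realType}.

(** On a sample of size n, listed last variable first, these are E_n / n, E_(n-1) / (n-1), ..., E_1:
    in law, the gaps from the origin upwards between ordered exponential points. *)
Fixpoint scaled_gaps (l : seq R) : seq R :=
  if l is x :: t then x / (size t).+1%:R :: scaled_gaps t else [::].

(* [l] lists the successive gaps of a set of points on the half-line, starting
   from the origin; the result lists the gaps after insertion of the point [z]. *)
Fixpoint insert_gap (z : R) (l : seq R) : seq R :=
  if l is g :: t then
    if z < g then z :: (g - z) :: t else g :: insert_gap (z - g) t
  else [:: z].

Fixpoint insert (z : R) (l : seq R) : seq R :=
  if l is x :: t then if z < x then z :: x :: t else x :: insert z t
  else [:: z].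

Fixpoint cumul (a : R) (l : seq R) : seq R :=
  if l is x :: t then (a + x) :: cumul (a + x) t else [::].

(** The race argument works on gaps, since the Renyi gaps are independent, whereas sorting works on
    points. A point landing in a gap splits it; a point landing beyond it loses the length of the
    gap. *)
Lemma cumul_insert_gap a z l :
  cumul a (insert_gap z l) = insert (a + z) (cumul a l).
Proof.
elim: l a z => [|g l IH] a z //=; rewrite ltrD2l; case: ifP => zg /=.
  by rewrite -[a + z + _]addrA subrKC.
by rewrite IH -[a + g + _]addrA subrKC.
Qed.

Lemma perm_insert z l : perm_eq (insert z l) (z :: l).
Proof.
elim: l => //= x l IH; case: ifP => // _.
rewrite -[z :: x :: l]/([:: z] ++ [:: x] ++ l) perm_sym perm_catCA /=.
by rewrite perm_cons perm_sym.
Qed.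

Lemma path_insert a z l : a <= z -> path <=%O a l -> path <=%O a (insert z l).
Proof.
elim: l a => [|x l IH] a az /=; first by rewrite az.
move=> /andP[ax pl]; case: ifP => zx /=; first by rewrite az ltW.
by rewrite ax IH// leNgt zx.
Qed.

Lemma sorted_insert z l : sorted <=%O l -> sorted <=%O (insert z l).
Proof.
case: l => //= x l pl; case: ifP => zx /=; first by rewrite ltW.
by apply: path_insert => //; rewrite leNgt zx.
Qed.

(** Makes [sort] a recursion by insertion, which both its measurability and the Renyi induction
    follow. It holds because a sorted permutation is unique. *)
Lemma sort_cons z l : sort <=%O (z :: l) = insert z (sort <=%O l).
Proof.
apply: (@sorted_eq _ <=%O) => //.
- exact: le_trans.
- exact: le_anti.
- exact/sort_sorted/le_total.
- exact/sorted_insert/sort_sorted/le_total.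
rewrite perm_sort perm_sym (perm_trans (perm_insert _ _))// perm_cons.
by rewrite perm_sort.
Qed.

Lemma size_scaled_gaps l : size (scaled_gaps l) = size l.
Proof. by elim: l => //= x l ->. Qed.

Lemma size_cumul a l : size (cumul a l) = size l.
Proof. by elim: l a => //= x l IH a; rewrite IH. Qed.

Section measurability.
Context d (T : measurableType d).
Implicit Types F : T -> seq R.

Lemma measurable_list_comp d' (T' : measurableType d') (g : T' -> T) n F :
  measurable_fun setT g -> measurable_list n F -> measurable_list n (F \o g).
Proof.
move=> mg [sF mF]; split=> [w|i] /=; first exact: sF.
exact: measurableT_comp (mF i) mg.
Qed.

Lemma measurable_list_insert_gap n (z : T -> R) F :
  measurable_fun setT z -> measurable_list n F ->
  measurable_list n.+1 (fun w => insert_gap (z w) (F w)).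
Proof.
elim: n z F => [|n IH] z F mz mF.
  by rewrite (measurable_list0 mF); apply: measurable_list_cons => //; exact: measurable_list_nil.
have [_ /(_ 0%N) mF0] := mF.
have mFb := measurable_list_behead mF.
rewrite (measurable_list_eta mF) /=.
apply: measurable_list_if; first exact: measurable_fun_ltr.
  apply: measurable_list_cons => //; apply: measurable_list_cons => //.
  exact: measurable_funB.
apply: measurable_list_cons => //; apply: IH => //.
exact: measurable_funB.
Qed.

Lemma measurable_list_insert n (z : T -> R) F :
  measurable_fun setT z -> measurable_list n F ->
  measurable_list n.+1 (fun w => insert (z w) (F w)).
Proof.
elim: n z F => [|n IH] z F mz mF.
  by rewrite (measurable_list0 mF); apply: measurable_list_cons => //; exact: measurable_list_nil.
have [_ /(_ 0%N) mF0] := mF.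
have mFb := measurable_list_behead mF.
rewrite (measurable_list_eta mF) /=.
apply: measurable_list_if; first exact: measurable_fun_ltr.
  by apply: measurable_list_cons => //; exact: measurable_list_cons.
by apply: measurable_list_cons => //; exact: IH.
Qed.

Lemma measurable_list_sort n F : measurable_list n F ->
  measurable_list n (fun w => sort <=%O (F w)).
Proof.
elim: n F => [|n IH] F mF.
  by rewrite (measurable_list0 mF); exact: measurable_list_nil.
have [_ /(_ 0%N) mF0] := mF.
rewrite (measurable_list_eta mF); under eq_fun do rewrite sort_cons.
by apply: measurable_list_insert => //; exact/IH/measurable_list_behead.
Qed.

Lemma measurable_list_scaled_gaps n F : measurable_list n F ->
  measurable_list n (fun w => scaled_gaps (F w)).
Proof.
elim: n F => [|n IH] F mF.
  by rewrite (measurable_list0 mF); exact: measurable_list_nil.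
have [sF /(_ 0%N) mF0] := mF.
rewrite (measurable_list_eta mF) /=; under eq_fun do rewrite size_behead sF.
apply: measurable_list_cons; last exact/IH/measurable_list_behead.
exact: measurable_funM.
Qed.

Lemma measurable_list_cumul n (a : T -> R) F : measurable_fun setT a ->
  measurable_list n F -> measurable_list n (fun w => cumul (a w) (F w)).
Proof.
elim: n a F => [|n IH] a F ma mF.
  by rewrite (measurable_list0 mF); exact: measurable_list_nil.
have [_ /(_ 0%N) mF0] := mF.
rewrite (measurable_list_eta mF) /=.
apply: measurable_list_cons; first exact: measurable_funD.
apply: IH; [exact: measurable_funD|exact: measurable_list_behead].
Qed.

End measurability.

Lemma measurable_functional_list (h : seq R -> \bar R) (Phi : seq R -> seq R) (r : nat -> nat) :
  measurable_functional h ->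
  (forall n, measurable_list (r n) (fun t : n.-tuple R => Phi t)) ->
  measurable_functional (h \o Phi).
Proof. by move=> mh mPhi n; exact: measurable_functional_comp (mPhi n). Qed.

End list_operations.

Section races.
Context {R : realType}.
Local Notation std := (@exponential_measure R 1 ltr01).
Local Open Scope ereal_scope.

Lemma std_exponential_set1 (a : R) : std [set a] = 0.
Proof. by rewrite exponential_measureE /exponential_prob integral_set1. Qed.

(** Differs from the shift formula only at the null point [a]; the race needs the complement of a
    strict inequality. *)
Lemma integral_exponential_shift_le (a : R) (g : R -> \bar R) : (0 <= a)%R ->
  measurable_fun setT g -> (forall x, 0 <= g x) ->
  \int[std]_x (if (x < a)%R then 0 else g (x - a)%R) =
  (expR (- a)%R)%:E * \int[std]_x g x.
Proof.
move=> a0 mg g0; rewrite -integral_exponential_shift//.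
have mga : measurable_fun [set: R] (fun x => g (x - a)%R).
  by apply: measurableT_comp mg _; exact: measurable_funB.
apply: ae_eq_integral => //.
- by apply: measurable_fun_ifT => //; exact: measurable_fun_ltr.
- by apply: measurable_fun_ifT => //; exact: measurable_fun_ltr.
exists [set a]; split => //; first exact: std_exponential_set1.
move=> x /= nxa; apply: contrapT => xa; apply: nxa => _.
by case: ltgtP => // /xa.
Qed.

Variables (m : nat) (phi : R * R -> \bar R).
Hypotheses (m0 : (0 < m)%N) (mphi : measurable_fun setT phi)
  (phi0 : forall p, 0 <= phi p).

Let mr0 : (0 < m%:R :> R)%R. Proof. by rewrite ltr0n. Qed.

Let mpair d (T : measurableType d) (u v : T -> R) : measurable_fun setT u ->
  measurable_fun setT v -> measurable_fun setT (fun x => phi (u x, v x)).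
Proof. by move=> mu mv; apply: measurableT_comp mphi _; exact: measurable_fun_pair. Qed.

Let mdiv d (T : measurableType d) (u : T -> R) (c : R) : measurable_fun setT u ->
  measurable_fun setT (fun x => u x / c)%R.
Proof. by move=> mu; exact: measurable_funM. Qed.

(** For fixed z the event is x > m z: memorylessness makes x / m - z a fresh copy of x / m, at the
    cost e^(-mz). Tilting by this weight gives the probability 1 / (1 + m) that z wins and replaces
    z by z / (1 + m). *)
Lemma integral_race_lt :
  \int[std]_z \int[std]_x (if (z < x / m%:R)%R then phi (z, x / m%:R - z)%R else 0)
  = (1 + m%:R)^-1%:E *
    \int[std]_z \int[std]_x phi (z / (1 + m%:R), x / m%:R)%R.
Proof.
pose G z := \int[std]_x phi (z, x / m%:R)%R.
have mG : measurable_fun setT G.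
  apply: (@measurable_fun_fubini_tonelli_F _ _ _ _ _ std
    (fun p : R * R => phi (p.1, p.2 / m%:R)%R)) => //.
  by apply: mpair => //; exact: mdiv.
have G0 z : 0 <= G z by exact: integral_ge0.
rewrite -(@integral_exponential_tilt R m%:R G) ?addr_gt0//.
apply: eq_integral_std_exponential.
- pose psi (p : R * R) :=
    if (p.1 < p.2 / m%:R)%R then phi (p.1, p.2 / m%:R - p.1)%R else 0.
  apply: (@measurable_fun_fubini_tonelli_F _ _ _ _ _ std psi).
    apply: measurable_fun_ifT => //.
      by apply: measurable_fun_ltr => //; exact: mdiv.
    by apply: mpair => //; apply: measurable_funB => //; exact: mdiv.
  by move=> p; rewrite /psi; case: ifP.
- apply: emeasurable_funM => //; apply/measurable_EFinP.
  apply: measurableT_comp => //; apply: measurableT_comp => //.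
move=> z z0; rewrite /G -integral_exponential_shift//; last 2 first.
- by rewrite mulr_ge0 ?ltW.
- by apply: mpair => //; exact: mdiv.
apply: eq_integral => x _; rewrite ltr_pdivlMr// [(z * _)%R]mulrC.
by case: ifP => // _; congr (phi (_, _)); field; rewrite gt_eqF.
Qed.

(** In the other outcome z is integrated first: its excess over x / m is a fresh exponential, at the
    cost e^(-x/m). Tilting with c = 1 / m turns x / m into x / (1 + m), so the winning time has the
    same law in both outcomes. *)
Lemma integral_race_ge :
  \int[std]_z \int[std]_x (if (z < x / m%:R)%R then 0 else phi (x / m%:R, z - x / m%:R)%R)
  = (m%:R / (1 + m%:R))%:E *
    \int[std]_x \int[std]_z phi (x / (1 + m%:R), z)%R.
Proof.
pose psi (p : R * R) :=
  if (p.1 < p.2 / m%:R)%R then 0 else phi (p.2 / m%:R, p.1 - p.2 / m%:R)%R.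
have mpsi : measurable_fun setT psi.
  apply: measurable_fun_ifT => //.
    by apply: measurable_fun_ltr => //; exact: mdiv.
  apply: mpair => //; first exact: mdiv.
  by apply: measurable_funB => //; exact: mdiv.
have psi0 p : 0 <= psi p by rewrite /psi; case: ifP.
transitivity (\int[std]_x \int[std]_z psi (z, x)).
  exact: (@fubini_tonelli _ _ _ _ _ std std psi).
pose G x := \int[std]_z phi (x / m%:R, z)%R.
have mG : measurable_fun setT G.
  apply: (@measurable_fun_fubini_tonelli_F _ _ _ _ _ std
    (fun p : R * R => phi (p.1 / m%:R, p.2)%R)) => //.
  by apply: mpair => //; exact: mdiv.
have G0 z : 0 <= G z by exact: integral_ge0.
have mV0 : (0 < 1 + m%:R^-1 :> R)%R by rewrite addr_gt0 ?invr_gt0.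
transitivity (\int[std]_x ((expR (- (m%:R^-1 * x))%R)%:E * G x)).
  apply: eq_integral_std_exponential.
  - exact: (@measurable_fun_fubini_tonelli_G _ _ _ _ _ std psi).
  - apply: emeasurable_funM => //; apply/measurable_EFinP.
    apply: measurableT_comp => //; apply: measurableT_comp => //.
  move=> x x0; rewrite /G [(_^-1 * x)%R]mulrC -integral_exponential_shift_le//.
  - by rewrite divr_ge0 ?ltW.
  - by apply: mpair.
rewrite (integral_exponential_tilt mV0 mG G0).
have -> : ((1 + m%:R^-1)^-1 = m%:R / (1 + m%:R) :> R)%R.
  by field; rewrite !gt_eqF// addr_gt0.
congr (_ * _)%E; apply: eq_integral => x _; rewrite /G.
apply: eq_integral => z _; congr (phi (_, _)).
by field; rewrite !gt_eqF// addr_gt0.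
Qed.

End races.

Section renyi.
Context {R : realType} d (T : measurableType d) (Q : probability T R).
Variable E : nat -> {RV Q >-> R}.
Hypothesis E_indep : mutually_independent E.
Local Notation std := (@exponential_measure R 1 ltr01).
Hypothesis E_law : forall i A, measurable A -> Q (E i @^-1` A) = std A.
Local Open Scope ereal_scope.

Let mE n : measurable_list n (sample E n). Proof. exact: measurable_sample. Qed.

Let integral_E n (h : seq R -> \bar R) :
  measurable_functional h -> (forall l, 0 <= h l) ->
  \int[Q]_w h (sample E n.+1 w) = \int[std]_x \int[Q]_w h (x :: sample E n w).
Proof. exact: integral_sampleS. Qed.

Let mcons (h : seq R -> \bar R) (x : R) : measurable_functional h ->
  measurable_functional (fun l => h (x :: l)).
Proof.
move=> mh; apply: (@measurable_functional_list _ h (cons x) S) => // n.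
by apply: measurable_list_cons => //; exact: measurable_list_tuple.
Qed.

Let mscaled (h : seq R -> \bar R) : measurable_functional h -> measurable_functional (h \o scaled_gaps).
Proof.
move=> mh; apply: (@measurable_functional_list _ h _ id) => // n.
exact/measurable_list_scaled_gaps/measurable_list_tuple.
Qed.

Let mins (h : seq R -> \bar R) z : measurable_functional h -> measurable_functional (h \o insert_gap z).
Proof.
move=> mh; apply: (@measurable_functional_list _ h _ S) => // n.
by apply: measurable_list_insert_gap => //; exact: measurable_list_tuple.
Qed.

Let mparam d' (T' : measurableType d') n (h : seq R -> \bar R) (F : T' * T -> seq R) :
  measurable_functional h -> (forall l, 0 <= h l) -> measurable_list n F ->
  measurable_fun setT (fun x => \int[Q]_w h (F (x, w))).
Proof.
move=> mh h0 mF.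
apply: (@measurable_fun_fubini_tonelli_F _ _ _ _ _ Q (h \o F)) => //.
  exact: measurable_functional_comp mF.
by move=> p; exact: h0.
Qed.

(** The fresh point races against the first gap. Whichever wins, the first new gap is distributed as
    E / (n + 1), and the remaining gaps as those of a sample of size n: by memorylessness if z wins,
    by induction if the old gap wins. The two winning probabilities add up to 1. *)
Lemma insert_gap_scaled_gaps n (h : seq R -> \bar R) :
  measurable_functional h -> (forall l, 0 <= h l) ->
  \int[std]_z \int[Q]_w h (insert_gap z (scaled_gaps (sample E n w))) =
  \int[Q]_w h (scaled_gaps (sample E n.+1 w)).
Proof.
elim: n h => [|m IH] h mh h0.
  rewrite [RHS](integral_E 0 (mscaled mh) (fun l => h0 _)).
  by apply: eq_integral => z _; apply: eq_integral => w _ /=; rewrite divr1.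
pose phi (p : R * R) := \int[Q]_w h [:: p.1, p.2 & scaled_gaps (sample E m w)].
pose psi (p : R * R) := \int[Q]_w h (p.1 :: insert_gap p.2 (scaled_gaps (sample E m w))).
have mS : measurable_list m (fun pw : R * R * T => scaled_gaps (sample E m pw.2)).
  exact: (measurable_list_comp measurable_snd (measurable_list_scaled_gaps (mE m))).
have mp1 : measurable_fun setT (fun pw : R * R * T => pw.1.1).
  exact: measurableT_comp measurable_fst measurable_fst.
have mp2 : measurable_fun setT (fun pw : R * R * T => pw.1.2).
  exact: measurableT_comp measurable_snd measurable_fst.
have mphi : measurable_fun setT phi.
  apply: (@mparam _ _ m.+2 h (fun pw : R * R * T => [:: pw.1.1, pw.1.2 & scaled_gaps (sample E m pw.2)])) => //.
  by apply: measurable_list_cons => //; exact: measurable_list_cons.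
have mpsi : measurable_fun setT psi.
  apply: (@mparam _ _ m.+2 h (fun pw : R * R * T =>
    pw.1.1 :: insert_gap pw.1.2 (scaled_gaps (sample E m pw.2)))) => //.
  by apply: measurable_list_cons => //; exact: measurable_list_insert_gap.
have phi0 p : 0 <= phi p by exact: integral_ge0.
have psi0 p : 0 <= psi p by exact: integral_ge0.
have phiE a : \int[std]_x phi (a, x / m.+1%:R)%R =
    \int[Q]_w h (a :: scaled_gaps (sample E m.+1 w)).
  rewrite [RHS](integral_E m (mscaled (mcons a mh)) (fun l => h0 _)).
  by apply: eq_integral => x _; apply: eq_integral => w _; rewrite /phi /= size_sample.
(* Here the old gap has won and [z] still has to be inserted among the others: the induction
   hypothesis is applied to the functional that prepends [a]. *)
have psiE a : \int[std]_z psi (a, z) =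
    \int[Q]_w h (a :: scaled_gaps (sample E m.+1 w)).
  by rewrite -[RHS](IH _ (mcons a mh) (fun l => h0 _)).
pose A (p : R * R) :=
  if (p.1 < p.2 / m.+1%:R)%R then phi (p.1, p.2 / m.+1%:R - p.1)%R else 0.
pose B (p : R * R) :=
  if (p.1 < p.2 / m.+1%:R)%R then 0 else psi (p.2 / m.+1%:R, p.1 - p.2 / m.+1%:R)%R.
have mb : measurable_fun setT (fun p : R * R => p.1 < p.2 / m.+1%:R)%R.
  by apply: measurable_fun_ltr => //; exact: measurable_funM.
have mA : measurable_fun setT A.
  apply: measurable_fun_ifT => //; apply: measurableT_comp mphi _.
  by apply: measurable_fun_pair => //; apply: measurable_funB => //; exact: measurable_funM.
have mB : measurable_fun setT B.
  apply: measurable_fun_ifT => //; apply: measurableT_comp mpsi _.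
  apply: measurable_fun_pair => //; first exact: measurable_funM.
  by apply: measurable_funB => //; exact: measurable_funM.
have A0 p : 0 <= A p by rewrite /A; case: ifP.
have B0 p : 0 <= B p by rewrite /B; case: ifP.
transitivity (\int[std]_z (\int[std]_x A (z, x) + \int[std]_x B (z, x))).
  apply: eq_integral => z _.
  rewrite [LHS](integral_E m (mscaled (mins z mh)) (fun l => h0 _)).
  rewrite -ge0_integralD//; last 2 first.
  - exact: measurableT_comp mA (measurable_pair1 z).
  - exact: measurableT_comp mB (measurable_pair1 z).
  apply: eq_integral => x _; rewrite /A /B /=.
  case: ifP => zx; rewrite ?adde0 ?add0e /phi /psi; apply: eq_integral => w _ /=;
    by rewrite size_sample zx.
rewrite ge0_integralD//; last 4 first.
- by move=> z _; exact: integral_ge0.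
- exact: (@measurable_fun_fubini_tonelli_F _ _ _ _ _ std A).
- by move=> z _; exact: integral_ge0.
- exact: (@measurable_fun_fubini_tonelli_F _ _ _ _ _ std B).
rewrite (integral_race_lt (ltn0Sn m) mphi phi0) (integral_race_ge (ltn0Sn m) mpsi psi0).
under eq_integral do rewrite phiE.
under [in X in _ + X]eq_integral do rewrite psiE.
set I := \int[std]_x _.
have I0 : 0 <= I by apply: integral_ge0 => x _; exact: integral_ge0.
have m1 : (0 < 1 + m.+1%:R :> R)%R by rewrite addr_gt0// ltr0n.
rewrite -ge0_muleDl ?lee_fin ?invr_ge0 ?divr_ge0 ?(ltW m1)//.
rewrite -EFinD -[X in (X + _)%R]mul1r -mulrDl divff ?gt_eqF// mul1e /I.
rewrite [RHS](integral_E m.+1 (mscaled mh) (fun l => h0 _)).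
apply: eq_integral => x _; apply: eq_integral => w _ /=.
by rewrite size_sample -[m.+2]addn1 natrD addrC.
Qed.

(** For a fixed newest variable z, sorting inserts z into the sorted rest. The induction hypothesis
    for [h \o insert z] replaces that rest by sums of gaps, and insertion among the sums is
    insertion among the gaps. *)
Lemma renyi_representation n (h : seq R -> \bar R) :
  measurable_functional h -> (forall l, 0 <= h l) ->
  \int[Q]_w h (sort <=%O (sample E n w)) =
  \int[Q]_w h (cumul 0 (scaled_gaps (sample E n w))).
Proof.
elim: n h => [|n IH] h mh h0; first by apply: eq_integral.
have mcum : measurable_functional (h \o cumul 0%R).
  apply: (@measurable_functional_list _ h _ id) => // k.
  by apply: measurable_list_cumul => //; exact: measurable_list_tuple.
have msort : measurable_functional (h \o sort <=%O).
  apply: (@measurable_functional_list _ h _ id) => // k.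
  exact/measurable_list_sort/measurable_list_tuple.
rewrite [LHS](integral_E n msort (fun l => h0 _)).
rewrite -[RHS](insert_gap_scaled_gaps n mcum (fun l => h0 _)).
apply: eq_integral => z _; under [RHS]eq_integral do rewrite /= cumul_insert_gap add0r.
transitivity (\int[Q]_w h (insert z (sort <=%O (sample E n w)))).
  by apply: eq_integral => w _; rewrite -sort_cons.
apply: (IH (h \o insert z)) => [|l]; last exact: h0.
apply: (@measurable_functional_list _ h _ S) => // k.
by apply: measurable_list_insert => //; exact: measurable_list_tuple.
Qed.

End renyi.

(** * Quantile transform *)

Section quantile.
Context {R : realType}.
Variable F : R -> R.
Hypothesis F_mono : {homo F : x y / x <= y}.
Hypothesis F_right : right_continuous F.
Hypothesis F_le1 : forall x, x <= 1 -> F x = 0.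
Hypothesis F_cvg1 : F x @[x --> +oo] --> (1 : R).

Let G x := F (expR x).

Let F_ge0 x : 0 <= F x.
Proof.
have [x1|x1] := leP x 1; first by rewrite F_le1.
by rewrite -(F_le1 (lexx 1)) F_mono// ltW.
Qed.

Let G_le0 x : x <= 0 -> G x = 0.
Proof. by move=> x0; rewrite /G F_le1// -expR0 ler_expR. Qed.

Let G_mono : {homo G : x y / x <= y}.
Proof. by move=> x y xy; rewrite /G F_mono// ler_expR. Qed.

Let lb0 v : 0 < v -> lbound [set x | v <= G x] 0.
Proof.
move=> v0 x /= vG; rewrite leNgt; apply/negP => x0.
by move: vG; rewrite (G_le0 (ltW x0)) leNgt v0.
Qed.

Let nonempty v : v < 1 -> [set x | v <= G x] !=set0.
Proof.
move=> v1.
have /cvgrPdist_lt/(_ (1 - v)) := F_cvg1; rewrite subr_gt0 => /(_ v1)[M [_ hM]].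
pose x := Num.max M 0 + 1.
have x0 : 0 < x by rewrite ltr_wpDl// le_max lexx orbT.
exists (ln x) => /=; rewrite /G lnK ?posrE//.
have /hM : M < x by rewrite (le_lt_trans (_ : _ <= Num.max M 0))// ?le_max ?lexx// ltrDl.
move=> /(le_lt_trans (ler_norm _)); rewrite ltrD2l => /ltW.
by rewrite lerN2.
Qed.

(** Right continuity makes the infimum attained, which gives the forward implication; the converse
    is the definition of an infimum. *)
Lemma gen_inverse_galois v x : 0 < v < 1 ->
  (gen_inverse G v <= x) = (v <= G x).
Proof.
move=> /andP[v0 v1]; have hinf : has_inf [set x | v <= G x].
  by split; [exact: nonempty|exists 0; exact: lb0].
apply/idP/idP => [ix|vG]; last by apply: ge_inf => //; exists 0; exact: lb0.
rewrite leNgt; apply/negP => Gv.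
have /cvgrPdist_lt/(_ (v - G x)) := @F_right (expR x).
rewrite subr_gt0 => /(_ Gv)[e /= e0 he].
(* Right continuity keeps F below [v] between expR x and expR x + e, yet the infimum, being at most
   [x], is approached by points of the set in that range. *)
have [y /= vy yx] : exists2 y, v <= G y & y < ln (expR x + e).
  have e1 : 0 < ln (expR x + e) - x.
    by rewrite subr_gt0 -[ltLHS]expRK ltr_ln ?posrE ?addr_gt0 ?expR_gt0// ltrDl.
  have [y vy yi] := inf_adherent e1 hinf.
  by exists y => //; rewrite (lt_le_trans yi)// -lerBrDr opprB addrCA subrr addr0.
have yx0 : x < y.
  by rewrite ltNge; apply/negP => /G_mono; rewrite leNgt (lt_le_trans Gv).
have ye : expR y < expR x + e.
  by rewrite -[ltRHS]lnK ?posrE ?addr_gt0 ?expR_gt0// ltr_expR.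
have : `|F (expR x) - F (expR y)| < v - G x.
  apply: he; last by rewrite ltr_expR.
  rewrite /ball_/= distrC gtr0_norm ?subr_gt0 ?ltr_expR//.
  by rewrite ltrBlDl.
rewrite distrC => /(le_lt_trans (ler_norm _)); rewrite ltrD2r => /lt_le_trans/(_ vy).
by rewrite ltxx.
Qed.

Let gen_inverse_ge0 v : v < 1 -> 0 <= gen_inverse G v.
Proof.
move=> v1; have [v0|v0] := ltP 0 v; first by apply: lb_le_inf; [exact: nonempty|exact: lb0].
rewrite /gen_inverse inf_out// => -[_ [z /(_ (z - 1))]].
by rewrite /= (le_trans v0 (F_ge0 _)) => /(_ isT); lra.
Qed.

(* For [z <= 0] the infimum in [gen_inverse] is that of a set with no lower
   bound, hence 0: the map is nondecreasing on the whole line. *)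
Definition quantile_map (z : R) := expR (gen_inverse G (1 - expR (- z))).

Let v_lt1 (z : R) : 1 - expR (- z) < 1.
Proof. by rewrite ltrBlDr ltrDl expR_gt0. Qed.

Let v_gt0 (z : R) : (0 < 1 - expR (- z)) = (0 < z).
Proof. by rewrite subr_gt0 -[ltRHS]expR0 ltr_expR oppr_lt0. Qed.

Let quantile_map_ge1 z : 1 <= quantile_map z.
Proof. by rewrite -expR0 ler_expR gen_inverse_ge0. Qed.

Let quantile_map_le0 z : z <= 0 -> quantile_map z = 1.
Proof.
move=> z0; rewrite /quantile_map /gen_inverse inf_out ?expR0// => -[_ [y /(_ (y - 1))]].
rewrite /= (le_trans _ (F_ge0 _)); last by rewrite leNgt v_gt0 -leNgt.
by move=> /(_ isT); lra.
Qed.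

Lemma quantile_map_mono : {homo quantile_map : x y / x <= y}.
Proof.
move=> x y xy; have [x0|x0] := leP x 0; first by rewrite quantile_map_le0.
rewrite ler_expR gen_inverse_galois; last by rewrite v_gt0 x0 v_lt1.
rewrite (@le_trans _ _ (1 - expR (- y)))//.
  by rewrite lerD2l lerN2 ler_expR lerN2.
by rewrite -gen_inverse_galois// v_gt0 v_lt1 (lt_le_trans x0).
Qed.

Lemma measurable_quantile_map : measurable_fun setT quantile_map.
Proof.
exact: measurable_realfun.nondecreasing_measurable measurableT quantile_map_mono.
Qed.

Local Notation std := (@exponential_measure R 1 ltr01).

(** For z > 0, the Galois connection rewrites [quantile_map z <= x] as 1 - e^(-z) <= F x, that is z
    <= - ln (1 - F x). *)
Lemma quantile_map_law (x : R) :
  (std (quantile_map @^-1` `]x, +oo[) = (1 - F x)%:E)%E.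
Proof.
have [x1|x1] := ltP x 1.
  rewrite F_le1 ?ltW// subr0 (_ : _ @^-1` _ = setT) ?probability_setT//.
  by apply/seteqP; split=> z //= _; rewrite in_itv/= andbT (lt_le_trans x1).
have x0 : 0 < x by rewrite (lt_le_trans _ x1).
have qE z : 0 < z -> (quantile_map z <= x) = (1 - expR (- z) <= F x).
  move=> z0; rewrite -[x in LHS]lnK ?posrE// ler_expR gen_inverse_galois ?v_gt0 ?v_lt1 ?z0//.
  by rewrite /G lnK.
have Fx1 : F x <= 1.
  rewrite leNgt; apply/negP => Fx.
  have /cvgrPdist_lt/(_ (F x - 1)) := F_cvg1; rewrite subr_gt0 => /(_ Fx)[M [_ hM]].
  have /hM : M < Num.max M x + 1 by rewrite (le_lt_trans (_ : _ <= Num.max M x))// ?le_max ?lexx// ltrDl.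
  rewrite distrC => /(le_lt_trans (ler_norm _)); rewrite ltrD2r ltNge F_mono//.
  by rewrite ler_wpDr// le_max lexx orbT.
(* At F x = 1 the threshold is infinite, but [ln 0] is 0 and the formula with a ray would give mass
   1. *)
have [F1|F1] := eqVneq (F x) 1.
  rewrite F1 subrr (_ : _ @^-1` _ = set0) ?measure0//.
  apply/seteqP; split=> z //=; rewrite in_itv/= andbT ltNge => /negP; apply.
  have [z0|z0] := leP z 0; first by rewrite quantile_map_le0.
  by rewrite qE// F1 ltW.
have F1lt : 0 < 1 - F x by rewrite subr_gt0 lt_neqAle F1.
rewrite (_ : _ @^-1` _ = `]- ln (1 - F x), +oo[%classic); last first.
  have lnF : 0 <= - ln (1 - F x) by rewrite oppr_ge0 -ln1 ler_ln ?posrE// gerBl.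
  apply/seteqP; split=> z /=; rewrite !in_itv/= !andbT.
    move=> xz; have [z0|z0] := leP z 0; first by move: xz; rewrite quantile_map_le0// ltNge x1.
    move: xz; rewrite ltNge qE// -ltNge ltrBrDr addrC -ltrBrDr.
    by rewrite -[ltRHS]lnK ?posrE// ltr_expR ltrNl.
  move=> lz; have z0 := le_lt_trans lnF lz.
  rewrite ltNge qE// -ltNge ltrBrDr addrC -ltrBrDr.
  by rewrite -[ltRHS]lnK ?posrE// ltr_expR ltrNl.
rewrite exponential_law_ray ?mulN1r ?opprK ?lnK ?posrE//.
by rewrite oppr_ge0 -ln1 ler_ln ?posrE// gerBl.
Qed.

End quantile.

Lemma measurable_set_gt {R : realType} d (T : measurableType d) (g : T -> R) (e : R) :
  measurable_fun setT g -> measurable [set w | e < g w].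
Proof.
move=> mg; rewrite (_ : [set w | _] = setT `&` g @^-1` `]e, +oo[%classic); first exact: mg.
by apply/seteqP; split=> w /=; rewrite in_itv/= andbT// => -[].
Qed.

Section transfer.
Context {R : realType}.
Local Notation std := (@exponential_measure R 1 ltr01).

Lemma sort_map_homo (q : R -> R) (l : seq R) : {homo q : x y / x <= y} ->
  sort <=%O (map q l) = map q (sort <=%O l).
Proof.
move=> qm; apply: (@sorted_eq _ <=%O).
- exact: le_trans.
- exact: le_anti.
- exact/sort_sorted/le_total.
- by apply: (homo_sorted qm); exact/sort_sorted/le_total.
- by rewrite perm_sort perm_sym; apply: perm_map; rewrite perm_sort.
Qed.

Lemma order_stat_sample d (T : measurableType d) (X : nat -> T -> R) j n w :
  order_stat X j n w = nth 0 (sort <=%O (sample X n w)) j.-1.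
Proof.
congr (nth 0 _ _); apply/perm_sort_leP.
elim: n => [|n IH]//; rewrite -[in iota _ _]addn1 iotaD map_cat /= add0n cats1.
by rewrite perm_rcons perm_cons.
Qed.

Context d (T : measurableType d) (P : probability T R)
  d' (T' : measurableType d') (Q : probability T' R).
Variables (X : nat -> {RV P >-> R}) (E : nat -> {RV Q >-> R}) (F : R -> R).
Hypothesis X_indep : mutually_independent X.
Hypothesis X_cdf : forall i x, cdf (X i) x = (F x)%:E.
Hypothesis X_gt1 : forall i, {ae P, forall w, 1 < X i w}.
Hypothesis E_indep : mutually_independent E.
Hypothesis E_law : forall i A, measurable A -> Q (E i @^-1` A) = std A.

Let F_mono : {homo F : x y / x <= y}.
Proof.
by move=> x y xy; have := cdf_nondecreasing (X 0) xy; rewrite !X_cdf lee_fin.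
Qed.

Let F_right : right_continuous F.
Proof.
move=> x; have := @cdf_right_continuous _ _ _ _ (X 0) x.
rewrite (_ : cdf (X 0) = EFin \o F); last by apply/funext => y; exact: X_cdf.
by move/fine_cvg.
Qed.

Let F_cvg1 : F x @[x --> +oo] --> (1 : R).
Proof.
have := cvg_cdfy1 (X 0).
rewrite (_ : cdf (X 0) = EFin \o F); last by apply/funext => y; exact: X_cdf.
by move/fine_cvg.
Qed.

Let F_le1 x : x <= 1 -> F x = 0.
Proof.
move=> x1; apply/eqP; rewrite -eqe -(X_cdf 0); apply/eqP.
have [N [mN N0 hN]] := X_gt1 0.
rewrite -[cdf _ _]/(P (X 0 @^-1` `]-oo, x]%classic)).
apply: (subset_measure0 _ mN _ N0).
  by rewrite -[X in measurable X]setTI; exact: measurable_funPT.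
move=> w /= Xw; apply: hN => /= X1; move: Xw; rewrite in_itv/= leNgt.
by rewrite (le_lt_trans x1).
Qed.

Local Notation q := (quantile_map F).

Let mq : measurable_fun setT q. Proof. exact: measurable_quantile_map. Qed.

Lemma log_quantile_mono :
  {homo (fun z => gen_inverse (fun x => F (expR x)) (1 - expR (- z))) : x y / x <= y}.
Proof.
move=> x y /(quantile_map_mono F_mono F_right F_le1 F_cvg1).
by rewrite ler_expR.
Qed.

Let X_law i A : measurable A -> P (X i @^-1` A) = std (q @^-1` A).
Proof.
pose m_ : {measure set R -> \bar R} := pushforward std q.
move=> mA; apply: (@measure_rays_unique R (distribution P (X i)) (m_ mq)) mA => x.
  rewrite -[RHS]/(std (q @^-1` `]x, +oo[%classic)).
  rewrite (quantile_map_law F_mono F_right F_le1 F_cvg1).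
  have := cdf_ccdf_1 (X i) x; rewrite X_cdf /ccdf => FE.
  by rewrite EFinB -[X in (X - _)%E]FE addeAC subee// add0e.
by rewrite ltey_eq fin_num_measure.
Qed.

(** The two samples live on different spaces; their laws are matched one variable at a time, the law
    of X_1 being the image of the exponential law under [q]. *)
Let sample_law n (h : seq R -> \bar R) :
  measurable_functional h -> (forall l, 0 <= h l)%E ->
  (\int[P]_w h (sample X n w) = \int[Q]_w h (map q (sample E n w)))%E.
Proof.
have mmap k : measurable_list k (fun t : k.-tuple R => map q t).
  by apply: measurable_list_map => //; exact: measurable_list_tuple.
elim: n h => [|n IH] h mh h0.
  transitivity (h [::] * 1)%E.
    by rewrite -[in RHS](probability_setT P); exact: (integral_cst P measurableT (h [::])).
  by rewrite -[in LHS](probability_setT Q); apply/esym; exact: (integral_cst Q measurableT (h [::])).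
have mhq : measurable_functional (h \o map q).
  by apply: (@measurable_functional_list _ h _ id) => // k; exact: mmap.
have mcons x : measurable_functional (h \o cons x).
  apply: (@measurable_functional_list _ h (cons x) S) => // k.
  by apply: measurable_list_cons => //; exact: measurable_list_tuple.
pose K x := (\int[Q]_w h (x :: map q (sample E n w)))%E.
have mK : measurable_fun setT K.
  pose H (p : R * T') := h (p.1 :: map q (sample E n p.2)).
  apply: (@measurable_fun_fubini_tonelli_F _ _ _ _ _ Q H) => [|p]; last exact: h0.
  apply: (@measurable_functional_comp _ _ _ n.+1 h (fun p : R * T' => p.1 :: map q (sample E n p.2))) => //.
  apply: measurable_list_cons => //; apply: measurable_list_map => //.
  by apply: (measurable_list_comp measurable_snd); exact: measurable_sample.
have K0 x : (0 <= K x)%E by exact: integral_ge0.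
have X_law' i A : measurable A -> P (X i @^-1` A) = distribution P (X 0) A.
  by move=> mA; rewrite /distribution /pushforward !X_law.
rewrite (integral_sampleS X_indep X_law' n mh h0).
rewrite [RHS](integral_sampleS E_indep E_law n mhq (fun l => h0 _)).
transitivity (\int[distribution P (X 0)]_x K x)%E.
  by apply: eq_integral => x _; exact: (IH _ (mcons x) (fun l => h0 _)).
pose m_ : {measure set R -> \bar R} := pushforward std q.
transitivity (\int[m_ mq]_x K x)%E.
  by apply: eq_measure_integral => A mA _; exact: X_law.
by rewrite [LHS](ge0_integral_pushforward mq std measurableT mK (fun y _ => K0 y)) preimage_setT.
Qed.

(** The quantile map is nondecreasing, hence commutes with sorting, and Renyi's representation can
    be applied underneath it. *)
Lemma integral_order_statistics n (h : seq R -> \bar R) :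
  measurable_functional h -> (forall l, 0 <= h l)%E ->
  (\int[P]_w h (sort <=%O (sample X n w)) =
   \int[Q]_w h (map q (cumul 0%R (scaled_gaps (sample E n w)))))%E.
Proof.
move=> mh h0.
have msort : measurable_functional (h \o sort <=%O).
  apply: (@measurable_functional_list _ h _ id) => // k.
  exact/measurable_list_sort/measurable_list_tuple.
have mmap : measurable_functional (h \o map q).
  apply: (@measurable_functional_list _ h _ id) => // k.
  by apply: measurable_list_map => //; exact: measurable_list_tuple.
rewrite [LHS](sample_law n msort (fun l => h0 _)).
rewrite -[RHS](renyi_representation E_indep E_law n mmap (fun l => h0 _)).
apply: eq_integral => w _ /=.
by rewrite (sort_map_homo _ (quantile_map_mono F_mono F_right F_le1 F_cvg1)).
Qed.

Lemma probability_order_statistics n (psi : seq R -> R) (e : R) :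
  measurable_functional (EFin \o psi) ->
  P [set w | e < psi (sort <=%O (sample X n w))] =
  Q [set w | e < psi (map q (cumul 0 (scaled_gaps (sample E n w))))].
Proof.
move=> mpsi.
pose h l : \bar R := (if e < psi l then 1 else 0 : R)%:E.
have mh : measurable_functional h.
  move=> k; apply/measurable_EFinP; apply: measurable_fun_ifT => //.
  by apply: measurable_fun_ltr => //; apply/measurable_EFinP; exact: mpsi.
have h0 l : (0 <= h l)%E by rewrite /h lee_fin; case: ifP.
have hE d0 (T0 : measurableType d0) (M : probability T0 R) (L : T0 -> seq R) :
    measurable_list n L ->
    (\int[M]_w h (L w))%E = M [set w | e < psi (L w)].
  move=> mL; rewrite -[in RHS](setIT [set w | _]) -integral_indic//.
    apply: eq_integral => w _; rewrite /h indicE.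
    by case: ifPn => ew; [rewrite mem_set|rewrite memNset//; exact/negP].
  apply: measurable_set_gt.
  by apply/measurable_EFinP; exact: (measurable_functional_comp mpsi mL).
rewrite -hE; last exact/measurable_list_sort/measurable_sample.
rewrite -hE; first exact: integral_order_statistics.
apply: measurable_list_map; first exact: measurable_quantile_map.
apply: measurable_list_cumul => //.
exact/measurable_list_scaled_gaps/measurable_sample.
Qed.

End transfer.

(** * Second-moment bounds for weighted independent sums *)

Section weak_law.
Context {R : realType} d (T : measurableType d) (Q : probability T R).
Variables (E : nat -> {RV Q >-> R}) (nu : probability R R).
Hypothesis E_indep : mutually_independent E.
Hypothesis E_law : forall i A, measurable A -> Q (E i @^-1` A) = nu A.
Variables (g : R -> R) (v : R).
Hypothesis mg : measurable_fun setT g.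
Hypothesis g_int : nu.-integrable setT (EFin \o g).
Hypothesis g_mean : (\int[nu]_x (g x)%:E = 0)%E.
Hypothesis g_var : (\int[nu]_x (g x ^+ 2)%:E = v%:E)%E.

Let Y i w := g (E i w).

Let mY i : measurable_fun setT (Y i).
Proof. exact: measurableT_comp mg _. Qed.

Let ge0_integral_Y i (f : R -> \bar R) : measurable_fun setT f ->
  (forall x, 0 <= f x)%E -> (\int[Q]_w f (E i w) = \int[nu]_x f x)%E.
Proof.
move=> mf f0; rewrite -[LHS](@ge0_integral_distribution _ _ _ _ _ Q (E i) f mf f0).
by apply: eq_measure_integral => A mA _; exact: E_law.
Qed.

Let int_Y2 i : (\int[Q]_w (Y i w ^+ 2)%:E = v%:E)%E.
Proof.
rewrite (ge0_integral_Y i (f := fun x => (g x ^+ 2)%:E)) ?g_var//.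
  by apply/measurable_EFinP; exact: measurable_funX.
by move=> x; rewrite lee_fin sqr_ge0.
Qed.

Let integrable_Y2 i : Q.-integrable setT (fun w => (Y i w ^+ 2)%:E).
Proof.
apply/integrableP; split; first by apply/measurable_EFinP; exact: measurable_funX.
under eq_integral do rewrite gee0_abs ?lee_fin ?sqr_ge0//.
by rewrite int_Y2 ltry.
Qed.

Let integrable_YY i j : Q.-integrable setT (fun w => (Y i w * Y j w)%:E).
Proof.
apply: (@le_integrable _ _ _ _ _ measurableT _ (fun w => (Y i w ^+ 2)%:E + (Y j w ^+ 2)%:E)%E).
- by apply/measurable_EFinP; exact: measurable_funM.
- move=> w _; rewrite -EFinD !abse_EFin lee_fin [leRHS]ger0_norm ?addr_ge0 ?sqr_ge0//.
  by rewrite ler_norml; apply/andP; split; nra.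
- exact: integrableD.
Qed.

(** Rectangles determine the joint law, and on them independence is used for the two-element list
    [[:: i; j]]. *)
Let pair_law i j (A : set (R * R)) : i != j -> measurable A ->
  Q ((fun w => (E i w, E j w)) @^-1` A) = (nu \x nu)%E A.
Proof.
move=> ij mA.
have mE : measurable_fun setT (fun w => (E i w, E j w)) by exact: measurable_fun_pair.
pose EE : {mfun T >-> (R * R)%type} := mfun_Sub (mem_set mE).
apply/esym; apply: (@product_measure_unique _ _ _ _ _ nu nu (distribution Q EE)) => // {mA} {}A B mA mB.
rewrite -[LHS]/(Q ((fun w => (E i w, E j w)) @^-1` (A `*` B))).
pose C k := if k == i then A else B.
have mC k : measurable (C k) by rewrite /C; case: ifP.
have := @E_indep [:: i; j] C; rewrite /= inE ij => /(_ isT mC).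
rewrite !big_cons big_nil mule1 /C eqxx (negbTE (_ : j != i)); last by rewrite eq_sym.
rewrite !E_law// => <-; congr (Q _); apply/seteqP; split=> w /=.
  move=> [Aw Bw] k /=; rewrite !inE => /orP[/eqP ->|/eqP ->]; first by rewrite eqxx.
  by rewrite eq_sym (negbTE ij).
move=> h; split; first by have := h i; rewrite /= !inE eqxx => /(_ isT).
by have := h j; rewrite /= !inE eqxx orbT eq_sym (negbTE ij) => /(_ isT).
Qed.

(** Fubini under the product law: the inner integral is g x times the mean of g, hence 0. *)
Let int_YY i j : i != j -> (\int[Q]_w (Y i w * Y j w)%:E = 0)%E.
Proof.
move=> ij.
have mE : measurable_fun setT (fun w => (E i w, E j w)) by exact: measurable_fun_pair.
pose EE : {mfun T >-> (R * R)%type} := mfun_Sub (mem_set mE).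
pose f (p : R * R) := (g p.1 * g p.2)%:E.
have mf : measurable_fun setT f.
  by apply/measurable_EFinP; apply: measurable_funM; apply: measurableT_comp mg _.
have fint : (nu \x nu)%E.-integrable setT f.
  apply/integrableP; split => //.
  have /integrableP[_] := integrable_YY i j.
  congr (_ < _)%E; transitivity (\int[distribution Q EE]_p `|f p|)%E.
    by rewrite ge0_integral_distribution//; exact: measurableT_comp.
  by apply: eq_measure_integral => A mA _; exact: pair_law.
transitivity (\int[distribution Q EE]_p f p)%E.
  by rewrite integral_distribution//; exact: integrable_YY.
transitivity (\int[nu \x nu]_p f p)%E.
  by apply: eq_measure_integral => A mA _; exact: pair_law.
rewrite -integral12_prod_meas1//.
under eq_integral.
  move=> x _; rewrite /fubini_F /f /=; under eq_integral do rewrite EFinM.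
  rewrite integralZl// g_mean mule0; over.
by rewrite integral0.
Qed.

Lemma integral_sqr_sum (r : seq nat) (c : nat -> R) : uniq r ->
  (\int[Q]_w ((\sum_(i <- r) c i * g (E i w)) ^+ 2)%:E =
   (v * \sum_(i <- r) c i ^+ 2)%:E)%E.
Proof.
move=> ur.
have intZ i j : Q.-integrable setT (fun w => (c i * c j)%:E * (Y i w * Y j w)%:E)%E.
  by apply: integrableZl => //; exact: integrable_YY.
transitivity (\int[Q]_w \sum_(i <- r) \sum_(j <- r)
   ((c i * c j)%:E * (Y i w * Y j w)%:E))%E.
  apply: eq_integral => w _; rewrite expr2 mulr_suml -sumEFin.
  apply: eq_bigr => i _; rewrite mulr_sumr -sumEFin; apply: eq_bigr => j _.
  by rewrite -EFinM; congr EFin; rewrite /Y; ring.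
rewrite integral_sum//; last by move=> i; exact: integrable_sum.
rewrite mulr_sumr -sumEFin; apply: eq_big_seq => i ir.
rewrite integral_sum// (bigD1_seq i)//= big1 ?adde0.
  rewrite (integralZl _ (integrable_YY i i))//.
  by under eq_integral do rewrite -expr2; rewrite int_Y2 -EFinM; congr EFin; ring.
move=> j ji; rewrite (integralZl _ (integrable_YY i j))//.
by rewrite int_YY ?mule0// eq_sym.
Qed.

Lemma chebyshev_sum (r : seq nat) (c : nat -> R) (e : R) : uniq r -> 0 < e ->
  (Q [set w | (e < `|\sum_(i <- r) c i * g (E i w)|)%R] <=
   (v * (\sum_(i <- r) c i ^+ 2) / e ^+ 2)%:E)%E.
Proof.
move=> ur e0.
set S := fun w => \sum_(i <- r) c i * g (E i w).
have mS : measurable_fun setT S.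
  by apply: measurable_sum => i; apply: measurable_funM => //; exact: mY.
have mA : measurable [set w | e < `|S w|].
  by apply: measurable_set_gt; exact: measurableT_comp.
rewrite EFinM lee_pdivlMr ?exprn_gt0// -(integral_sqr_sum c ur) muleC.
have -> : Q [set w | e < `|S w|] = (\int[Q]_w (\1_[set w | e < `|S w|] w)%:E)%E.
  by rewrite integral_indic// setIT.
rewrite -ge0_integralZl//; last 2 first.
- exact/measurable_EFinP/measurable_indic.
- by rewrite lee_fin sqr_ge0.
apply: ge0_le_integral => //.
- by move=> w _; rewrite -EFinM lee_fin mulr_ge0// sqr_ge0.
- by apply/measurable_EFinP; apply: measurable_funM => //; exact: measurable_indic.
- by apply/measurable_EFinP; exact: measurable_funX.
- move=> w _; rewrite -EFinM lee_fin indicE.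
  case: (boolP (w \in _)) => wA.
    have eS : e < `|S w| by exact: (set_mem wA).
    rewrite mulr1 -[leRHS]real_normK ?num_real//.
    by rewrite ler_sqr ?nnegrE ?normr_ge0 ?(ltW e0)// (ltW eS).
  by rewrite mulr0 sqr_ge0.
Qed.

End weak_law.

(** * Moments of the exponential law *)

Section exponential_moments.
Context {R : realType}.
Local Notation std := (@exponential_measure R 1 ltr01).
Local Notation leb := (@lebesgue_measure R).

Let mpow (r : R) : measurable_fun setT (fun x : R => x `^ r).
Proof. exact: measurable_powR. Qed.

Let mpowE (r : R) : measurable_fun setT (fun x : R => (x `^ r)%:E).
Proof. by apply/measurable_EFinP. Qed.

(** Splitting ln x as ln (x / (2r)) + ln (2r) and bounding the first logarithm by its argument
    leaves e^(x/2), so half of the exponential decay remains for integrability. *)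
Lemma powR_le_expR (r x : R) : 0 < r -> 0 < x ->
  x `^ r <= expR (r * ln (2 * r)) * expR (x / 2).
Proof.
move=> r0 x0; rewrite /powR gt_eqF// -expRD ler_expR.
have r2 : 0 < 2 * r by rewrite mulr_gt0.
have -> : ln x = ln (x / (2 * r)) + ln (2 * r).
  by rewrite -lnM ?posrE ?divr_gt0// divfK// gt_eqF.
rewrite mulrDr addrC lerD2l (@le_trans _ _ (r * (x / (2 * r))))//.
  by rewrite ler_wpM2l ?ltW// ln_sublinear// divr_gt0.
by rewrite le_eqVlt; apply/orP; left; apply/eqP; field; rewrite gt_eqF.
Qed.

Lemma std_moment_fin (r : R) : 0 < r -> (\int[std]_x (x `^ r)%:E < +oo)%E.
Proof.
move=> r0; pose C := expR (r * ln (2 * r)).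
have mexp : measurable_fun setT (fun x : R => C * expR (x / 2)).
  apply: measurable_funM => //; apply: measurableT_comp => //.
  exact: measurable_funM.
have mf : measurable_fun setT (fun x : R => if 0 < x then (x `^ r)%:E else 0%:E).
  by apply: measurable_fun_ifT => //; exact: measurable_fun_ltr.
rewrite (eq_integral_std_exponential _ mf)//; last by move=> x ->.
apply: (@le_lt_trans _ _ (\int[std]_x (C * expR (x / 2))%:E)%E).
  apply: ge0_le_integral => //.
  - by move=> x _; case: ifP => // _; rewrite lee_fin powR_ge0.
  - exact/measurable_EFinP.
  - move=> x _; case: ifPn => x0; rewrite lee_fin; first exact: powR_le_expR.
    by rewrite mulr_ge0// expR_ge0.
under eq_integral do rewrite EFinM.
rewrite ge0_integralZl//; last 2 first.
- by apply/measurable_EFinP; apply: measurableT_comp => //; exact: measurable_funM.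
- by rewrite lee_fin expR_ge0.
rewrite lte_mul_pinfty ?lee_fin ?expR_ge0//.
have c0 : 0 < 1 + (- 2^-1) :> R by lra.
(* Tilting the constant 1 with c = -1/2 evaluates the integral of e^(x/2). *)
have := @integral_exponential_tilt R (- 2^-1) (cst 1%E) c0 (measurable_cst _) (fun=> lee01).
rewrite [X in (_ * X)%E](_ : _ = 1%E); last first.
  have := integral_cst std measurableT 1%E.
  by rewrite mul1e => I1; rewrite [LHS]I1; exact: probability_setT.
rewrite mule1 => h; rewrite (_ : (\int[std]_x _)%E = (1 - 2^-1)^-1%:E) ?ltry// -h.
by apply: eq_integral => x _; rewrite /cst mule1 mulNr opprK mulrC.
Qed.

Lemma std_moment (r : R) : 0 < r ->
  (\int[std]_x (x `^ r)%:E = (Gamma_fun (r + 1))%:E)%E.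
Proof.
move=> r0.
have powE0 x : (0 <= (x `^ r)%:E)%E by rewrite lee_fin powR_ge0.
have E : (\int[std]_x (x `^ r)%:E =
  \int[leb]_(t in `]0%R, +oo[) (t `^ (r + 1 - 1) * expR (- t))%:E)%E.
  rewrite (integral_exponential_law ltr01 (mpowE r) powE0) [RHS]integral_mkcond.
  apply: eq_integral => x _; rewrite patchE addrK mem_setE in_itv/= andbT.
  have [x0|x0|<-] := ltgtP 0 x.
  - by rewrite exponential_pdfE ?ltW//= mul1r mulN1r EFinM.
  - by rewrite lt0_exponential_pdf// mule0.
  - by rewrite powR0 ?mul0e// gt_eqF.
rewrite /Gamma_fun /Rintegral -E fineK// ge0_fin_numE ?std_moment_fin//.
by apply: integral_ge0.
Qed.

(** The mean is the integral of the survival function e^(-x), which is also the density. The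
    exponent 1 is kept so that the general moment formula yields Gamma(2) = 1. *)
Lemma std_mean : (\int[std]_x (x `^ 1)%:E = 1)%E.
Proof.
have mX : measurable_fun setT (fun x : R => Num.max x 0).
  exact: measurable_maxr.
rewrite (eq_integral_std_exponential _ (_ : measurable_fun _ (fun x : R => (Num.max x 0)%:E)))//; last 2 first.
- exact/measurable_EFinP.
- by move=> x x0; rewrite powRr1 ?ltW// max_l ?ltW.
pose X : {RV std >-> R} := mfun_Sub (mem_set mX).
have X0 x : 0 <= X x by rewrite /= le_max lexx orbT.
have := @ge0_expectation_ccdf _ _ _ std X X0.
rewrite unlock => ->.
rewrite -[RHS](integral_exponential_pdf (@ltr01 R)) integral_mkcond.
apply: eq_integral => x _; rewrite patchE mem_setE in_itv/= andbT.
case: ifPn => x0; last by rewrite lt0_exponential_pdf// ltNge.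
rewrite exponential_pdfE//= mul1r -(exponential_law_ray ltr01 x0).
rewrite /ccdf /distribution /pushforward; congr (std _).
apply/seteqP; split=> y /=; rewrite !in_itv/= !andbT lt_max.
  by rewrite (ltNge x 0) x0 orbF.
by move=> ->.
Qed.

Lemma Gamma_fun_gt0 (r : R) : 0 < r -> 0 < Gamma_fun (r + 1).
Proof.
move=> r0; rewrite -lte_fin -std_moment//.
apply: (@lt_le_trans _ _ (std `]1, +oo[%classic)).
  by rewrite exponential_law_ray// lte_fin expR_gt0.
rewrite -[X in std X](setIT `]1, +oo[%classic) -integral_indic//.
apply: ge0_le_integral => //.
  exact/measurable_EFinP/measurable_indic.
move=> x _; rewrite lee_fin indicE mem_setE in_itv/= andbT.
have [x1|x1] /= := ltP 1 x; last by rewrite powR_ge0.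
by rewrite /powR gt_eqF ?(lt_trans _ x1)// -expR0 ler_expR mulr_ge0 ?ln_ge0// ltW.
Qed.

(** Input of Chebyshev's inequality, with r = s for the weighted sum and r = 1 for the Z_j. Square
    integrability comes from (y - m)^2 <= 2 y^2 + 2 m^2 with y^2 = x^(2r). *)
Lemma centered_power_variance (r : R) : 0 < r -> exists v : R,
  [/\ std.-integrable setT (fun x => (x `^ r - Gamma_fun (r + 1))%:E),
      (\int[std]_x (x `^ r - Gamma_fun (r + 1))%:E = 0)%E &
      (\int[std]_x ((x `^ r - Gamma_fun (r + 1)) ^+ 2)%:E = v%:E)%E].
Proof.
move=> r0; set m := Gamma_fun (r + 1).
have ipow q : 0 < q -> std.-integrable setT (fun x => (x `^ q)%:E).
  move=> q0; apply/integrableP; split; first exact: mpowE.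
  under eq_integral do rewrite gee0_abs ?lee_fin ?powR_ge0//.
  exact: std_moment_fin.
have icst q : std.-integrable setT (fun=> q%:E).
  exact: finite_measure_integrable_cst.
have mY : measurable_fun setT (fun x : R => x `^ r - m) by exact: measurable_funB.
have i1 : std.-integrable setT (fun x => (x `^ r - m)%:E).
  by under eq_fun do rewrite EFinB; apply: integrableB => //; exact: ipow.
have i2 : std.-integrable setT (fun x => ((x `^ r - m) ^+ 2)%:E).
  apply: (@le_integrable _ _ _ _ _ measurableT _
    (fun x => 2%:E * (x `^ (r * 2))%:E + (2 * m ^+ 2)%:E)%E).
  - by apply/measurable_EFinP; exact: measurable_funX.
  - move=> x _; rewrite -EFinM -EFinD !abse_EFin lee_fin powRrM powR_mulrn ?powR_ge0//.
    rewrite ger0_norm ?sqr_ge0// (le_trans _ (ler_norm _))//.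
    have := sqr_ge0 (x `^ r + m); nra.
  - apply: integrableD => //; apply: integrableZl => //; apply: ipow.
    by rewrite mulr_gt0.
exists (fine (\int[std]_x ((x `^ r - m) ^+ 2)%:E)); split => //.
  under eq_integral do rewrite EFinB.
  rewrite integralB//; last exact: ipow.
  rewrite std_moment// -/m.
  have -> : (\int[std]_x m%:E = m%:E * std setT)%E by exact: integral_cst.
  by rewrite probability_setT mule1 subee.
rewrite fineK//; exact: integrable_fin_num.
Qed.

End exponential_moments.

(** * Perturbation of powers *)

Section power_perturbation.
Context {R : realType}.
Implicit Types (a b s t x y D C : R) (N : nat).

Lemma bernoulli_ge t N : 0 <= t <= 1 -> 1 - N%:R * (1 - t) <= t ^+ N.
Proof.
move=> /andP[t0 t1]; elim: N => [|N IH]; first by rewrite mul0r subr0 expr0.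
rewrite exprS (@le_trans _ _ (t * (1 - N%:R * (1 - t))))//; last by rewrite ler_wpM2l.
have N0 : 0 <= N%:R * (1 - t) ^+ 2 :> R by rewrite mulr_ge0 ?sqr_ge0.
rewrite -natr1; lra.
Qed.

(** A mean value inequality without derivatives: for t = a / b in [0, 1] and s <= N, Bernoulli gives
    1 - t^s <= 1 - t^N <= N (1 - t). *)
Lemma powR_subl_le s N a b : 0 < s -> s <= N%:R -> 0 <= a <= b -> 0 < b ->
  b `^ s - a `^ s <= N%:R * b `^ (s - 1) * (b - a).
Proof.
move=> s0 sN /andP[a0 ab] b0.
pose t := a / b.
have t01 : 0 <= t <= 1 by rewrite ler_pdivrMr// mul1r ab divr_ge0// ltW.
have aE : a = t * b by rewrite /t divfK// gt_eqF.
have tN : t ^+ N <= t `^ s.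
  have [->|tn0] := eqVneq t 0.
    rewrite powR0 ?gt_eqF//; case: N sN => [|N]; last by rewrite expr0n.
    by rewrite leNgt s0.
  rewrite -powR_mulrn; last by case/andP: t01.
  by apply: ger_powR => //; rewrite lt_def tn0; move: t01 => /andP[-> ->].
rewrite aE powRM; [|by case/andP: t01|exact: ltW].
rewrite -(mulr_powRB1 (ltW b0) s0).
have -> : b - t * b = (1 - t) * b by ring.
have B0 : 0 <= b * b `^ (s - 1) by rewrite mulr_ge0 ?powR_ge0 ?ltW.
have -> : b * b `^ (s - 1) - t `^ s * (b * b `^ (s - 1)) =
  (1 - t `^ s) * (b * b `^ (s - 1)) by ring.
have -> : N%:R * b `^ (s - 1) * ((1 - t) * b) =
  (N%:R * (1 - t)) * (b * b `^ (s - 1)) by ring.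
rewrite ler_wpM2r// lerBlDr -lerBlDl (le_trans _ tN)//.
exact: bernoulli_ge.
Qed.

Lemma powR_sub_le s N x y : 0 < s -> s <= N%:R -> 0 <= x -> 0 <= y ->
  0 < Num.max x y ->
  `|y `^ s - x `^ s| <= N%:R * Num.max x y `^ (s - 1) * `|y - x|.
Proof.
move=> s0 sN; wlog xy : x y / x <= y.
  move=> h x0 y0; have [xy|yx] := orP (le_total x y); first exact: h.
  by rewrite maxC distrC [X in _ * X]distrC; exact: h.
move=> x0 y0; rewrite (max_idPr xy) => y0'.
rewrite !ger0_norm ?subr_ge0//; last by rewrite ge0_ler_powR// ltW.
by apply: powR_subl_le => //; rewrite x0.
Qed.

Lemma ler_powR_neg r a b : r <= 0 -> 0 < a -> a <= b -> b `^ r <= a `^ r.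
Proof.
move=> r0 a0 ab; rewrite -[r]opprK ![_ `^ - - r]powRN lef_pV2 ?posrE ?powR_gt0//.
  by rewrite ge0_ler_powR ?oppr_ge0 ?nnegrE// ltW// (lt_le_trans a0).
exact: lt_le_trans a0 ab.
Qed.

(* When s < 1 and D > x the exponent s - 1 makes the mean-value bound useless,
   but then x ^ s and y ^ s are themselves of order (x + D) ^ s. *)
Lemma powR_perturbation s C : 0 < s -> 0 <= C -> exists2 K : R, 0 <= K &
  forall x y D, 0 <= x -> 0 <= y -> 0 <= D -> `|y - x| <= C * D ->
  `|y `^ s - x `^ s| <= K * ((x + D) `^ (s - 1) * D).
Proof.
move=> s0 C0; pose N := (Num.truncn s).+1.
have sN : s <= N%:R by rewrite ltW// truncnS_gt.
have C1 : 0 < 1 + C by rewrite ltr_pwDl.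
have bnd x y D : 0 <= x -> 0 <= D -> `|y - x| <= C * D ->
    Num.max x y <= (1 + C) * (x + D).
  move=> x0 D0; rewrite ler_norml => /andP[_ h]; rewrite ge_max.
  have := mulr_ge0 C0 x0; have := mulr_ge0 C0 D0; lra.
have triv x y : 0 <= x -> 0 <= y -> `|y - x| <= C * 0 -> y = x.
  by move=> _ _; rewrite mulr0 normr_le0 subr_eq0 => /eqP.
have [s1|s1] := leP 1 s.
  (* For s >= 1 the power s - 1 is nondecreasing, and max x y <= (1 + C) (x + D). *)
  exists (N%:R * (1 + C) `^ (s - 1) * C).
    by rewrite !mulr_ge0 ?powR_ge0.
  move=> x y D x0 y0 D0 xyD.
  have [M0|M0] := ltP 0 (Num.max x y); last first.
    have [x00 y00] : x = 0 /\ y = 0.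
      by move: M0; rewrite ge_max => /andP[xl yl]; split; apply/eqP; rewrite eq_le ?xl ?yl.
    by rewrite x00 y00 subrr normr0 !mulr_ge0 ?powR_ge0 ?add0r.
  rewrite (le_trans (powR_sub_le s0 sN x0 y0 M0))//.
  rewrite -!mulrA ler_wpM2l// [(1 + C) `^ _ * _]mulrC -!mulrA mulrCA [C * _]mulrC.
  rewrite (_ : _ * (_ * _ * _) = ((1 + C) `^ (s - 1) * (x + D) `^ (s - 1)) * (C * D)); last by ring.
  apply: ler_pM => //; rewrite ?powR_ge0//.
  rewrite -powRM ?addr_ge0//.
  apply: ge0_ler_powR; rewrite ?nnegrE ?subr_ge0// ?(ltW M0)//; last exact: bnd.
  by rewrite mulr_ge0 ?addr_ge0.
(* The first constant serves D <= x, where x + D <= 2 max x y and s - 1 is negative; the second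
   serves x < D, where both powers are at most ((1 + C) (x + D))^s and x + D <= 2 D. *)
exists (N%:R * 2 `^ (1 - s) * C + 2 * (1 + C) `^ s).
  by rewrite addr_ge0 ?mulr_ge0 ?powR_ge0.
move=> x y D x0 y0 D0 xyD.
have xDp : 0 <= (x + D) `^ (s - 1) * D by rewrite mulr_ge0 ?powR_ge0.
rewrite mulrDl.
have [xD|xD] := leP D x.
  have [x00|xn0] := eqVneq x 0.
    have D00 : D = 0 by apply/eqP; rewrite eq_le D0 -x00 xD.
    move: xyD; rewrite D00 => /(triv _ _ x0 y0) ->.
    by rewrite subrr normr0 !mulr0 addr0.
  have xp : 0 < x by rewrite lt_def xn0.
  have M0 : 0 < Num.max x y by rewrite lt_max xp.
  rewrite (le_trans (powR_sub_le s0 sN x0 y0 M0))// -[leLHS]addr0 lerD//; last first.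
    by rewrite mulr_ge0// mulr_ge0 ?powR_ge0.
  rewrite (_ : _ * C * _ = N%:R * (2 `^ (1 - s) * (x + D) `^ (s - 1)) * (C * D)); last by ring.
  apply: ler_pM => //; first by rewrite mulr_ge0 ?powR_ge0.
  have -> : 2 `^ (1 - s) = (2 `^ (s - 1))^-1 by rewrite -powRN opprB.
  rewrite ler_wpM2l// [leRHS]mulrC ler_pdivlMr ?powR_gt0//.
  rewrite -powRM ?(ltW M0)//.
  apply: ler_powR_neg; [by rewrite subr_le0 ltW|by rewrite ltr_pwDl|].
  have xM : x <= Num.max x y by rewrite le_max lexx.
  lra.
have Dp : 0 < D by exact: le_lt_trans xD.
have xDgt : 0 < x + D by rewrite ltr_wpDl.
have up : `|y `^ s - x `^ s| <= Num.max x y `^ s.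
  have := powR_ge0 x s; have := powR_ge0 y s => y1 x1.
  have xM : x `^ s <= Num.max x y `^ s.
    by rewrite ge0_ler_powR ?nnegrE ?le_max ?x0 ?lexx// ltW.
  have yM : y `^ s <= Num.max x y `^ s.
    by rewrite ge0_ler_powR ?nnegrE ?le_max ?x0 ?lexx ?orbT// ltW.
  by rewrite ler_norml; apply/andP; split; lra.
rewrite (le_trans up)// -[leLHS]add0r lerD//.
  by rewrite !mulr_ge0 ?powR_ge0.
rewrite (@le_trans _ _ (((1 + C) * (x + D)) `^ s))//.
  rewrite ge0_ler_powR ?nnegrE ?(ltW s0)//; last exact: bnd.
    by rewrite le_max x0.
  by rewrite mulr_ge0 ?(ltW C1)// ltW.
rewrite powRM ?(ltW C1) ?(ltW xDgt)// -(mulr_powRB1 (ltW xDgt) s0).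
rewrite (_ : 2 * _ * _ = (1 + C) `^ s * ((2 * D) * (x + D) `^ (s - 1))); last by ring.
rewrite ler_wpM2l ?powR_ge0// ler_wpM2r ?powR_ge0//; lra.
Qed.

End power_perturbation.

(** * Deterministic spacing estimates *)

Section integral_increment.
Context {R : realType}.
Local Notation leb := (@lebesgue_measure R).
Implicit Types (u t x z B P M : R) (g p b F : R -> R).

Lemma itv_oo_setU (u1 u2 : R) : u1 <= u2 -> u2 < 1 ->
  `]u1, 1[%classic = `]u1, u2] `|` `]u2, 1[ :> set R.
Proof.
move=> u12 u21; apply/seteqP; split=> x /=; rewrite !in_itv/=.
  by move=> /andP[ux x1]; have [xu|xu] := leP x u2; [left|right]; rewrite ?ux ?xu ?x1.
move=> [/andP[-> xu]|/andP[ux ->]]; first by rewrite (le_lt_trans xu).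
by rewrite (le_lt_trans u12).
Qed.

Let div_int u1 u2 : 0 < u1 -> u1 < u2 ->
  leb.-integrable `]u1, u2] (EFin \o (fun t => t^-1)) /\
  \int[leb]_(t in `]u1, u2]) t^-1 = ln u2 - ln u1.
Proof.
move=> u10 u12.
have cinv : {within `[u1, u2], continuous (fun t : R => t^-1)}.
  apply: continuous_in_subspaceT => x; rewrite inE/= in_itv/= => /andP[ux _].
  by apply: inv_continuous; rewrite gt_eqF// (lt_le_trans u10).
have minv : measurable_fun `]u1, u2] (fun t : R => (t^-1)%:E).
  apply/measurable_EFinP; apply: (@measurable_funS _ _ _ _ `[u1, u2]%classic) => //.
    by move=> x /=; rewrite !in_itv/= => /andP[/ltW -> ->].
  exact: subspace_continuous_measurable_fun.
have E : (\int[leb]_(t in `[u1, u2]) (t^-1)%:E = (ln u2)%:E - (ln u1)%:E)%E.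
  apply: continuous_FTC2 => //.
    split.
    - move=> x; rewrite in_itv/= => /andP[ux _].
      by have [] := is_derive1_ln (lt_trans u10 ux).
    - by apply/cvg_at_right_filter; exact: continuous_ln.
    - by apply/cvg_at_left_filter; apply: continuous_ln; exact: lt_trans u12.
  move=> x; rewrite in_itv/= => /andP[ux _].
  rewrite derive1E; have [_] := is_derive1_ln (lt_trans u10 ux); exact.
have E' : (\int[leb]_(t in `]u1, u2]) (t^-1)%:E = (ln u2 - ln u1)%:E)%E.
  by rewrite integral_itv_obnd_cbnd.
split; last by rewrite /Rintegral E'.
apply/integrableP; split => //.
under eq_integral.
  move=> x; rewrite inE/= in_itv/= => /andP[ux _].
  rewrite /= gtr0_norm ?invr_gt0 ?(lt_trans u10 ux)//; over.
by rewrite E' ltry.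
Qed.

(** Under dt / t the interval ]u1, u2] weighs ln u2 - ln u1, which is z1 - z2 at the points e^(-z1),
    e^(-z2). The reference value [g0] will be 0 for b and a(k/n) for de Haan's a. *)
Lemma Rintegral_increment g (g0 B u1 u2 : R) :
  0 < u1 -> u1 <= u2 -> u2 < 1 -> 0 <= B ->
  leb.-integrable `]u1, 1[ (fun t => (g t / t)%:E) ->
  (forall t, u1 < t <= u2 -> `|g t - g0| <= B) ->
  `|\int[leb]_(t in `]u1, 1[) (g t / t) - \int[leb]_(t in `]u2, 1[) (g t / t)
    - g0 * (ln u2 - ln u1)| <= B * (ln u2 - ln u1).
Proof.
move=> u10; rewrite le_eqVlt => /orP[/eqP <- _ _ _ _|u12 u21 B0 ig gB].
  by rewrite !subrr !mulr0 subrr normr0.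
have [iinv Einv] := div_int u10 u12.
have ig12 : leb.-integrable `]u1, u2] (fun t => (g t / t)%:E).
  apply: integrableS ig => //.
  by move=> x /=; rewrite !in_itv/= => /andP[-> xu]; rewrite (le_lt_trans xu).
rewrite (itv_oo_setU (ltW u12) u21) Rintegral_setU//; last 2 first.
- by rewrite -itv_oo_setU// ltW.
- apply/disj_setPS => x /=; rewrite !in_itv/= => -[/andP[_ xu] /andP[ux _]].
  by move: ux; rewrite ltNge xu.
rewrite addrK -Einv -!RintegralZl//.
have iM c : leb.-integrable `]u1, u2] (EFin \o (fun t => c * t^-1)).
  rewrite (_ : _ \o _ = (fun t => c%:E * (EFin \o (fun t => t^-1)%R) t)%E)//.
  exact: integrableZl.
rewrite -RintegralB//.
have iB : leb.-integrable `]u1, u2] (EFin \o (fun t => g t / t - g0 * t^-1)).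
  rewrite (_ : _ \o _ = ((fun t => (g t / t)%R%:E) \- (EFin \o (fun t => g0 * t^-1)%R))%E)//.
  by apply: integrableB => //; exact: iM.
rewrite (le_trans (le_normr_Rintegral _ iB))//.
apply: le_Rintegral => //; first exact: integrable_norm.
move=> t /=; rewrite in_itv/= => tu.
have t0 : 0 < t by move: tu => /andP[/(lt_trans u10)].
rewrite -mulrBl normrM [X in _ * X]gtr0_norm ?invr_gt0//.
by apply: ler_wpM2r; [rewrite invr_ge0 ltW|exact: gB].
Qed.

Lemma ln1D_le x : `|x| <= 1 / 2 -> `|ln (1 + x)| <= 2 * `|x|.
Proof.
rewrite ler_norml => /andP[x1 x2].
have x0 : 0 < 1 + x by lra.
have up : ln (1 + x) <= x by apply: le_ln1Dx; lra.
have lo : - ln (1 + x) <= - x / (1 + x).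
  have e : 1 + - x / (1 + x) = (1 + x)^-1 by field; rewrite gt_eqF.
  have := @le_ln1Dx R (- x / (1 + x)); rewrite e lnV ?posrE//; apply.
  by rewrite ltr_pdivlMr//; lra.
have lo' : - x / (1 + x) <= 2 * `|x|.
  rewrite ler_pdivrMr//; have := ler_norm (- x); rewrite normrN; have := normr_ge0 x; nra.
rewrite ler_norml; apply/andP; split; first lra.
by have := ler_norm x; have := normr_ge0 x; lra.
Qed.

Let expR1_le4 : expR 1 <= 4 :> R.
Proof.
(* Squaring e^(-1/2) >= 1/2 gives e^(-1) >= 1/4. *)
have h : 1 - 1 / 2 <= expR (- (1 / 2)) :> R by rewrite expR_ge1Dx.
have : expR 1 * (expR (- (1 / 2)) * expR (- (1 / 2))) = 1 :> R.
  by rewrite -!expRD -[RHS]expR0; congr expR; field.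
have y4 : 1 / 4 <= expR (- (1 / 2)) * expR (- (1 / 2)) :> R by nra.
by have := ler_wpM2l (expR_ge0 (1 : R)) y4 => + yE; rewrite yE; lra.
Qed.

Lemma expR_sub_le x y : x <= 1 -> y <= 1 -> `|expR x - expR y| <= 4 * `|x - y|.
Proof.
wlog yx : x y / y <= x.
  move=> h x1 y1; have [xy|yx] := orP (le_total x y); last exact: h.
  by rewrite distrC [X in _ * X]distrC; exact: h.
move=> x1 y1; rewrite !ger0_norm ?subr_ge0// ?ler_expR//.
have -> : expR y = expR x * expR (y - x) by rewrite -expRD; congr expR; ring.
have h := expR_ge1Dx (y - x).
have e3 : expR x <= 4 by rewrite (le_trans _ expR1_le4)// ler_expR.
have e0 := expR_gt0 x.
nra.
Qed.

End integral_increment.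

Section spacings.
Context {R : realType}.
Local Notation leb := (@lebesgue_measure R).
Variables (F : R -> R) (c : R) (p b : R -> R).
Local Notation L z := (gen_inverse (fun x => F (expR x)) (1 - expR (- z))).

Let expN_itv (z : R) : 0 < z -> 0 < expR (- z) < 1.
Proof. by move=> z0; rewrite expR_gt0 -expR0 ltr_expR oppr_lt0. Qed.

(** The terms - gamma ln u contribute gamma (z1 - z2) exactly. Each of the two terms ln (1 + p) is
    at most 2 P in absolute value, and the integral of b between the two points at most (z1 - z2)
    B. *)
Lemma karamata_spacing (gamma P B z1 z2 : R) :
  karamata_representation F gamma c p b ->
  0 < z2 -> z2 <= z1 -> P <= 1 / 2 -> 0 <= B ->
  (forall t, 0 < t <= expR (- z2) -> `|p t| <= P /\ `|b t| <= B) ->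
  `|(L z1 - L z2) - gamma * (z1 - z2)| <= 4 * (P + (z1 - z2) * B).
Proof.
move=> K z20 z21 P2 B0 pb; have z10 : 0 < z1 by exact: lt_le_trans z21.
have [_ i1 ->] := K _ (expN_itv z10).
have [_ _ ->] := K _ (expN_itv z20).
have [/andP[u10 u11] /andP[u20 u21]] := (expN_itv z10, expN_itv z20).
have u12 : expR (- z1) <= expR (- z2) by rewrite ler_expR lerN2.
have := @Rintegral_increment R b 0 B _ _ u10 u12 u21 B0 i1.
have -> : ln (expR (- z2)) - ln (expR (- z1)) = z1 - z2 by rewrite !expRK; ring.
have hb t : expR (- z1) < t <= expR (- z2) -> `|b t - 0| <= B.
  move=> /andP[ut tu]; rewrite subr0; apply: (pb _ _).2.
  by rewrite tu (lt_trans u10).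
move=> /(_ hb); rewrite mul0r subr0 !expRK.
set I1 := \int[leb]_(t in _) _; set I2 := \int[leb]_(t in _) _ => hI.
have hp u : 0 < u <= expR (- z2) -> `|ln (1 + p u)| <= 2 * P.
  move=> /pb[pu _]; rewrite (le_trans (ln1D_le (le_trans pu P2)))//.
  by rewrite ler_wpM2l.
have h1 := hp (expR (- z1)); rewrite u10 u12 in h1; have {}h1 := h1 isT.
have h2 := hp (expR (- z2)); rewrite u20 lexx in h2; have {}h2 := h2 isT.
have zB : 0 <= (z1 - z2) * B by rewrite mulr_ge0// subr_ge0.
move: hI h1 h2; rewrite !ler_norml => /andP[? ?] /andP[? ?] /andP[? ?].
by apply/andP; split; lra.
Qed.

(** Here kap is k / n, l is ln k, and M bounds P and B l. In units of a(kap), a(u) is the product of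
    rho u = (1 + p u) / (1 + p kap) and e u = exp (I u - I kap), both close to 1. The conditions on
    M keep P below 1/4 and the exponents below 1. *)
Lemma dehaan_spacing (d P B M lam kap l z1 z2 : R) : 0 < c ->
  dehaan_representation F c d p b -> 1 < lam -> 0 < kap -> lam * kap < 1 ->
  1 <= l -> 0 < z2 -> z2 <= z1 -> expR (- z2) <= lam * kap ->
  ln kap - 2 * l <= - z1 -> 0 <= B -> P <= M -> B * l <= M ->
  (ln lam + 2) * M <= 1 -> 4 * M <= 1 ->
  (forall t, 0 < t <= lam * kap -> `|p t| <= P /\ `|b t| <= B) ->
  0 < dehaan_aux c p b kap /\
  `|(L z1 - L z2) / dehaan_aux c p b kap - (z1 - z2)| <=
    (8 * (ln lam + 2) + 24) * (P + (z1 - z2) * M).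
Proof.
move=> c0 H lam1 kap0 lk1 l1 z20 z21 ulk zl B0 PM BM M1 M4 pb.
have z10 : 0 < z1 by exact: lt_le_trans z21.
have [_ ia1 ->] := H _ (expN_itv z10).
have [_ _ ->] := H _ (expN_itv z20).
have [/andP[u10 u11] /andP[u20 u21]] := (expN_itv z10, expN_itv z20).
have u12 : expR (- z1) <= expR (- z2) by rewrite ler_expR lerN2.
have lam0 : 0 < lam by rewrite (lt_trans _ lam1).
have klk : kap <= lam * kap by rewrite ler_peMl// ltW.
have lnlam : 0 < ln lam by rewrite ln_gt0.
have BM' : B <= M by rewrite (le_trans _ BM)// ler_peMr.
have M0 : 0 <= M by exact: le_trans BM'.
pose I u := \int[leb]_(t in `]u, 1[) (b t / t).
have incr u v : 0 < u -> u <= v -> v <= lam * kap ->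
    `|I u - I v| <= B * (ln v - ln u).
  move=> u0 uv vlk; have v1 : v < 1 by exact: le_lt_trans lk1.
  have u01 : 0 < u < 1 by rewrite u0 (le_lt_trans uv).
  have [ib _ _] := H _ u01.
  have := @Rintegral_increment R b 0 B _ _ u0 uv v1 B0 ib.
  rewrite mul0r subr0; apply=> t /andP[ut tv]; rewrite subr0.
  by apply: (pb _ _).2; rewrite (lt_trans u0)// (le_trans tv).
(* Below kap the logarithms of u and kap differ by at most 2 l; above it by at most ln lam, hence by
   at most l ln lam since l >= 1. *)
set C1 := ln lam + 2 in M1 *.
have IB u : 0 < u -> u <= lam * kap -> ln kap - 2 * l <= ln u ->
    `|I u - I kap| <= C1 * M.
  move=> u0 ulk' ul.
  have BlM : C1 * (B * l) <= C1 * M by rewrite ler_wpM2l// /C1 addr_ge0// ltW.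
  have [uk|ku] := leP u kap.
    rewrite (le_trans (incr _ _ u0 uk klk))// (le_trans _ BlM)//.
    have : B * (ln kap - ln u) <= B * (2 * l) by rewrite ler_wpM2l//; lra.
    have : 0 <= B * l * ln lam by rewrite !mulr_ge0// ltW//; lra.
    by rewrite /C1; lra.
  rewrite distrC (le_trans (incr _ _ kap0 (ltW ku) ulk'))// (le_trans _ BlM)//.
  have : ln u <= ln lam + ln kap by rewrite -lnM ?posrE// ler_ln ?posrE// mulr_gt0.
  move=> lu; have : B * (ln u - ln kap) <= B * (C1 * l); last by rewrite /C1; lra.
  rewrite ler_wpM2l// /C1.
  have : ln lam * 1 <= ln lam * l by rewrite ler_wpM2l// ltW.
  by lra.
have pk := (pb kap); rewrite kap0 klk in pk; have {pk}[pk bk] := pk isT.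
have P0 : 0 <= P by exact: le_trans pk.
have pk1 : 3 / 4 <= 1 + p kap by move: pk; rewrite ler_norml => /andP[? ?]; lra.
have pk0 : 0 < 1 + p kap by apply: lt_le_trans pk1; rewrite divr_gt0.
set A0 := dehaan_aux c p b kap.
have A00 : 0 < A0.
  by rewrite /A0 /dehaan_aux mulr_gt0 ?expR_gt0// mulr_gt0.
have fld (x y q f1 f2 : R) : y != 0 -> f2 != 0 ->
    x * q * f1 = x * y * f2 * (q / y * (f1 / f2)).
  by move=> y0 f20; field; rewrite y0 f20.
pose rho u := (1 + p u) / (1 + p kap).
pose e u := expR (I u - I kap).
have aE u : dehaan_aux c p b u = A0 * (rho u * e u).
  rewrite /A0 /dehaan_aux /rho /e -/(I u) -/(I kap).
  rewrite expRB; apply: fld; rewrite gt_eqF ?expR_gt0//.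
have rho_sub u v : 0 < u -> u <= lam * kap -> 0 < v -> v <= lam * kap ->
    `|rho u - rho v| <= 4 * P.
  move=> u0 ul v0 vl.
  have := pb u; rewrite u0 ul => /(_ isT)[pu _].
  have := pb v; rewrite v0 vl => /(_ isT)[pv _].
  have -> : rho u - rho v = (p u - p v) / (1 + p kap) by rewrite /rho -mulrBl; congr (_ / _); ring.
  rewrite normrM normfV [X in _ / X]gtr0_norm//.
  rewrite ler_pdivrMr//.
  rewrite (le_trans (ler_normB _ _))//.
  have : 4 * P * (3 / 4) <= 4 * P * (1 + p kap) by rewrite ler_wpM2l// mulr_ge0.
  lra.
have rho_kap : rho kap = 1 by rewrite /rho divff// gt_eqF.
have eE u : e u = expR (I u - I kap) by [].
have C10 : 0 <= C1 by rewrite /C1 addr_ge0// ltW.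
clearbody A0 rho e I C1.
have rho1 u : 0 < u -> u <= lam * kap -> `|rho u - 1| <= 4 * P.
  by move=> u0 ul; have := rho_sub _ _ u0 ul kap0 klk; rewrite rho_kap.
have x1 u : 0 < u -> u <= lam * kap -> ln kap - 2 * l <= ln u -> I u - I kap <= 1.
  by move=> u0 ul lu; rewrite (le_trans (ler_norm _))// (le_trans (IB _ u0 ul lu)).
have e1 u : 0 < u -> u <= lam * kap -> ln kap - 2 * l <= ln u ->
    `|e u - 1| <= 4 * (C1 * M).
  move=> u0 ul lu; have := expR_sub_le (x1 _ u0 ul lu) ler01.
  by rewrite -eE expR0 subr0 => h; rewrite (le_trans h)// ler_wpM2l// IB.
have rho2 u : 0 < u -> u <= lam * kap -> `|rho u| <= 2.
  move=> u0 ul; have := rho1 u u0 ul; rewrite !ler_norml => /andP[? ?].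
  by apply/andP; split; lra.
have r1 u : 0 < u -> u <= lam * kap -> ln kap - 2 * l <= ln u ->
    `|rho u * e u - 1| <= (8 * C1 + 4) * M.
  move=> u0 ul lu.
  have -> : rho u * e u - 1 = rho u * (e u - 1) + (rho u - 1) by ring.
  rewrite (le_trans (ler_normD _ _))// normrM.
  have := rho1 u u0 ul.
  have : `|rho u| * `|e u - 1| <= 2 * (4 * (C1 * M)).
    by apply: ler_pM => //; [exact: rho2|exact: e1].
  lra.
split => //.
have lnu z : ln (expR (- z)) = - z by rewrite expRK.
have ul1 : expR (- z1) <= lam * kap by exact: le_trans ulk.
have zz2 : ln kap - 2 * l <= - z2 by rewrite (le_trans zl)// lerN2.
(* A bound of order M on a(t) / a(kap) - 1 suffices here, because the integral multiplies it by z1 -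
   z2. *)
have incra : `|\int[leb]_(t in `]expR (- z1), 1[) (dehaan_aux c p b t / t)
    - \int[leb]_(t in `]expR (- z2), 1[) (dehaan_aux c p b t / t)
    - A0 * (z1 - z2)| <= A0 * ((8 * C1 + 4) * M) * (z1 - z2).
  have := @Rintegral_increment R (dehaan_aux c p b) A0 (A0 * ((8 * C1 + 4) * M)) _ _ u10 u12 u21.
  rewrite !lnu.
  have -> : - z2 - - z1 = z1 - z2 by ring.
  apply=> //; first by rewrite !mulr_ge0 ?(ltW A00)// addr_ge0// mulr_ge0.
  move=> t /andP[ut tu]; rewrite aE -{2}[A0]mulr1 -mulrBr normrM gtr0_norm//.
  rewrite ler_wpM2l ?(ltW A00)//; apply: r1.
  - exact: lt_trans ut.
  - exact: le_trans ulk.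
  - by rewrite (le_trans zl)// -lnu ler_ln ?posrE ?expR_gt0// ?(lt_trans u10)// ltW.
(* The bound [r1] on each value would not do: M is allowed only together with z1 - z2. The
   increments of rho and e are bounded separately; 20 is 4 times 5, from |e| <= 5, and 8 is 2 times
   4, from |rho| <= 2. *)
have incrr : `|rho (expR (- z2)) * e (expR (- z2)) - rho (expR (- z1)) * e (expR (- z1))|
    <= 20 * P + 8 * (B * (z1 - z2)).
  set v2 := expR (- z2); set v1 := expR (- z1).
  have -> : rho v2 * e v2 - rho v1 * e v1 =
     (rho v2 - rho v1) * e v2 + rho v1 * (e v2 - e v1) by ring.
  have le2 : ln kap - 2 * l <= ln v2 by rewrite lnu.
  have le1 : ln kap - 2 * l <= ln v1 by rewrite lnu.
  rewrite (le_trans (ler_normD _ _))// !normrM lerD//.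
    have ev : `|e v2| <= 5.
      have := e1 v2 u20 ulk le2; rewrite !ler_norml => /andP[? ?].
      by apply/andP; split; lra.
    have : `|rho v2 - rho v1| * `|e v2| <= 4 * P * 5 by apply: ler_pM => //; exact: rho_sub.
    lra.
  have : `|rho v1| * `|e v2 - e v1| <= 2 * (4 * (B * (z1 - z2))); last by lra.
  apply: ler_pM => //; first exact: rho2.
  rewrite !eE (le_trans (expR_sub_le (x1 _ u20 ulk le2) (x1 _ u10 ul1 le1)))//.
  rewrite ler_wpM2l// opprB addrA subrK distrC.
  by rewrite (le_trans (incr _ _ u10 u12 ulk))// !lnu ler_wpM2l//; lra.
set J1 := \int[leb]_(t in _) _ in incra *; set J2 := \int[leb]_(t in _) _ in incra *.
have -> : (d - dehaan_aux c p b (expR (- z1)) + J1 -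
    (d - dehaan_aux c p b (expR (- z2)) + J2)) / A0 - (z1 - z2) =
  (rho (expR (- z2)) * e (expR (- z2)) - rho (expR (- z1)) * e (expR (- z1))) +
  (J1 - J2 - A0 * (z1 - z2)) / A0.
  by rewrite !aE; field; exact: lt0r_neq0.
have incra' : `|(J1 - J2 - A0 * (z1 - z2)) / A0| <= (8 * C1 + 4) * M * (z1 - z2).
  rewrite normrM normfV [X in _ / X]gtr0_norm// ler_pdivrMr//.
  by rewrite (le_trans incra)// le_eqVlt; apply/orP; left; apply/eqP; ring.
rewrite (le_trans (ler_normD _ _))//.
have zz : 0 <= z1 - z2 by rewrite subr_ge0.
have h1 : B * (z1 - z2) <= M * (z1 - z2) by rewrite ler_wpM2r.
have h2 : 0 <= C1 * P by rewrite mulr_ge0.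
have h3 : 0 <= M * (z1 - z2) by rewrite mulr_ge0.
(* Since B <= M, the total is at most 20 P + (8 C1 + 12) M (z1 - z2). *)
have h4 := lerD incrr incra'; apply: (le_trans h4); lra.
Qed.

End spacings.

(** * Convergence in probability *)

Section local_sup.
Context {R : realType}.
Variables (k : nat -> nat).
Hypothesis k_bounds : forall n, (2 <= n)%N -> (1 <= k n < n)%N.
Hypothesis k_small : (k n)%:R / n%:R @[n --> \oo] --> (0 : R).

Lemma local_sup_near (g : R -> R) (lam e : R) : 0 < lam -> 0 < e ->
  g u @[u --> 0^'+] --> (0 : R) ->
  \forall n \near \oo, [/\ 0 <= local_sup g lam (k n) n,
    local_sup g lam (k n) n <= e &
    forall t, 0 < t <= lam * ((k n)%:R / n%:R) -> `|g t| <= local_sup g lam (k n) n].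
Proof.
move=> lam0 e0 /cvgrPdist_lt/(_ e e0)[d /= d0 hd].
have /cvgrPdist_lt/(_ (d / lam)) := k_small; rewrite divr_gt0// => /(_ isT) hk.
near=> n.
have n2 : (2 <= n)%N by near: n; exact: nbhs_infty_ge.
have /andP[k1 kn] := k_bounds n2.
have q0 : 0 < (k n)%:R / n%:R :> R by rewrite divr_gt0// ltr0n// (leq_trans _ n2).
have ld : lam * ((k n)%:R / n%:R) < d.
  rewrite mulrC -ltr_pdivlMr//.
  have : `|0 - (k n)%:R / n%:R| < d / lam by near: n.
  by rewrite sub0r normrN gtr0_norm.
have bnd t : 0 < t <= lam * ((k n)%:R / n%:R) -> `|g t| <= e.
  move=> /andP[t0 tl]; apply/ltW.
  have bt : ball_ [eta Num.Def.normr] 0 d t.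
    by rewrite /ball_/= sub0r normrN gtr0_norm// (le_lt_trans tl).
  by have := hd t bt t0; rewrite sub0r normrN.
set S := [set `|g t| | t in [set t | 0 < t <= lam * (k n)%:R / n%:R]].
have S0 : S !=set0.
  by exists `|g (lam * (k n)%:R / n%:R)|; exists (lam * (k n)%:R / n%:R) => //=;
    rewrite lexx -mulrA mulr_gt0.
have Sub : ubound S e by move=> _ [t /= tl <-]; apply: bnd; rewrite mulrA.
have hS : has_sup S by split => //; exists e.
have ubS t : 0 < t <= lam * ((k n)%:R / n%:R) -> `|g t| <= local_sup g lam (k n) n.
  by move=> tl; apply: (ub_le_sup (proj2 hS)); exists t => //=; rewrite -mulrA.
split => //; last exact: ge_sup.
by rewrite (le_trans (normr_ge0 (g (lam * ((k n)%:R / n%:R)))))// ubS// lexx mulr_gt0.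
Unshelve. all: by end_near. Qed.

End local_sup.

Section vanishing.
Context {R : realType} d (T : measurableType d) (Q : probability T R).
Implicit Types (A B : nat -> set T).

(* Convergence to 0 of the outer probability: the exceptional events are not
   shown to be measurable. *)
Definition vanishing A := forall e : R, 0 < e ->
  \forall n \near \oo, exists B : set T,
    [/\ measurable B, A n `<=` B & (Q B <= e%:E)%E].

Lemma vanishing_sub A B : (\forall n \near \oo, A n `<=` B n) ->
  vanishing B -> vanishing A.
Proof.
move=> AB hB e e0; near=> n.
have [C [mC BC QC]] : exists C : set T, [/\ measurable C, B n `<=` C & (Q C <= e%:E)%E].
  by near: n; exact: hB.
by exists C; split => //; apply: subset_trans BC; near: n.
Unshelve. all: by end_near. Qed.

Lemma vanishingU A B : vanishing A -> vanishing B ->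
  vanishing (fun n => A n `|` B n).
Proof.
move=> hA hB e e0; have e20 : 0 < e / 2 by rewrite divr_gt0.
near=> n.
have [C [mC AC QC]] : exists C : set T, [/\ measurable C, A n `<=` C & (Q C <= (e / 2)%:E)%E].
  by near: n; exact: hA.
have [D [mD BD QD]] : exists D : set T, [/\ measurable D, B n `<=` D & (Q D <= (e / 2)%:E)%E].
  by near: n; exact: hB.
exists (C `|` D); split; [exact: measurableU|exact: setUSS|].
rewrite (le_trans (measureU2 _ mC mD))// (splitr e) EFinD.
exact: leeD.
Unshelve. all: by end_near. Qed.

Lemma vanishing_le A (r : nat -> R) : (forall n, measurable (A n)) ->
  (\forall n \near \oo, (Q (A n) <= (r n)%:E)%E) ->
  r n @[n --> \oo] --> (0 : R) -> vanishing A.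
Proof.
move=> mA Ar /cvgrPdist_lt r0 e e0; near=> n; exists (A n); split => //.
apply: (@le_trans _ _ (r n)%:E); first by near: n.
rewrite lee_fin (le_trans (ler_norm _))// ltW// -normrN -sub0r.
by near: n; exact: r0.
Unshelve. all: by end_near. Qed.

Lemma vanishing_cvg A : (forall n, measurable (A n)) ->
  vanishing A <-> (Q (A n) @[n --> \oo] --> 0%E).
Proof.
move=> mA; split=> [hA|/fine_cvgP[_ /cvgrPdist_lt hA] e e0].
  apply/fine_cvgP; split; first by near=> n; rewrite fin_num_measure.
  apply/cvgrPdist_le => e e0; near=> n.
  have [C [mC AC QC]] : exists C : set T, [/\ measurable C, A n `<=` C & (Q C <= e%:E)%E].
    by near: n; exact: hA.
  rewrite sub0r normrN ger0_norm ?fine_ge0// -lee_fin fineK ?fin_num_measure//.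
  by apply: le_trans QC; apply: le_measure; rewrite ?inE.
near=> n; exists (A n); split => //.
rewrite -(fineK (fin_num_measure Q _ (mA n))) lee_fin ltW//.
rewrite (le_lt_trans (ler_norm _))// -normrN -sub0r.
by near: n; exact: hA.
Unshelve. all: by end_near. Qed.

Lemma vanishing0 (N : set T) : measurable N -> Q N = 0%E -> vanishing (fun=> N).
Proof.
move=> mN N0 e e0; near=> n; exists N; split => //.
by rewrite N0 lee_fin ltW.
Unshelve. all: by end_near. Qed.

Lemma powR_root_close (gam s e : R) : 0 < gam -> 0 < s -> 0 < e ->
  exists2 del, 0 < del & forall x, 0 <= x ->
    `|x - gam `^ s| <= del -> `|x `^ s^-1 - gam| <= e.
Proof.
move=> g0 s0 e0.
have s1 : 0 < s^-1 by rewrite invr_gt0.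
have sV x : 0 <= x -> (x `^ s) `^ s^-1 = x.
  by move=> x0; rewrite -powRrM divff ?gt_eqF// powRr1.
have ltp r x y : 0 < r -> 0 <= x -> x < y -> x `^ r < y `^ r.
  move=> r0 x0 xy; rewrite gt0_ltr_powR ?nnegrE//.
  by rewrite (le_trans x0)// ltW.
(* Truncated at 0 because gam - e may be negative, where [powR] is not monotone. *)
pose m := Num.max (gam - e) 0.
have m0 : 0 <= m by rewrite le_max lexx orbT.
have mg : m < gam by rewrite gt_max g0 andbT ltrBlDr ltrDl.
pose d1 := (gam + e) `^ s - gam `^ s; pose d2 := gam `^ s - m `^ s.
have d10 : 0 < d1 by rewrite subr_gt0 ltp ?(ltW g0)// ltrDl.
have d20 : 0 < d2 by rewrite subr_gt0 ltp.
exists (Num.min d1 d2); first by rewrite lt_min d10.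
move=> x x0; rewrite ler_norml ler_distl.
move=> /andP[xl xu].
have min1 : Num.min d1 d2 <= d1 by rewrite ge_min lexx.
have min2 : Num.min d1 d2 <= d2 by rewrite ge_min lexx orbT.
have xu' : x <= (gam + e) `^ s by rewrite /d1 in min1; lra.
have xl' : m `^ s <= x by rewrite /d2 in min2; lra.
apply/andP; split.
  apply: (@le_trans _ _ m); first by rewrite le_max lexx.
  by rewrite -[leLHS]sV// ge0_ler_powR ?nnegrE ?powR_ge0// ltW.
have ge0 : 0 <= gam + e by rewrite addr_ge0 ?ltW.
by rewrite -[leRHS]sV// ge0_ler_powR ?nnegrE ?powR_ge0// ltW.
Qed.

(** [S] stands for the sum over the actual spacings, [W] for that over E_j / j, [Rm] for the
    remainder. The deviation of S / a from gam^s splits into the perturbation error and gam^s (W / a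
    - 1), each given half of the tolerance. *)
Lemma vanishing_power_mean (a : nat -> R) (W S Rm : nat -> T -> R)
    (gam s K : R) (Bad : nat -> set T) :
  0 < gam -> 0 < s -> 0 <= K ->
  (\forall n \near \oo, 0 < a n) -> vanishing Bad ->
  (\forall n \near \oo, forall w, ~ Bad n w ->
     0 <= S n w /\ `|S n w - gam `^ s * W n w| <= K * Rm n w) ->
  (forall e, 0 < e -> vanishing (fun n => [set w | e < `|W n w / a n - 1|])) ->
  (forall e, 0 < e -> vanishing (fun n => [set w | e < `|(a n)^-1 * Rm n w|])) ->
  forall e, 0 < e ->
  vanishing (fun n => [set w | e < `|(S n w / a n) `^ s^-1 - gam|]).
Proof.
move=> g0 s0 K0 a0 hBad hS hW hR e e0.
have [del del0 hdel] := powR_root_close g0 s0 e0.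
have gs0 : 0 < gam `^ s by rewrite powR_gt0.
have c1 : 0 < del / 2 / gam `^ s by rewrite !divr_gt0.
(* K may be 0, hence the divisor K + 1. *)
have c2 : 0 < del / 2 / (K + 1) by rewrite !divr_gt0 ?ltr_wpDl.
apply: (vanishing_sub _ (vanishingU hBad (vanishingU (hW _ c1) (hR _ c2)))).
near=> n => w /= ew; apply: contrapT => /not_orP[nB /not_orP[]].
move=> /negP; rewrite -leNgt => h1 /negP; rewrite -leNgt => h2.
have an0 : 0 < a n by near: n.
have [S0 SW] : 0 <= S n w /\ `|S n w - gam `^ s * W n w| <= K * Rm n w.
  by move: w nB {ew h1 h2}; near: n.
move: ew; apply/negP; rewrite -leNgt; apply: hdel; first by rewrite divr_ge0// ltW.
have -> : S n w / a n - gam `^ s =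
    (S n w - gam `^ s * W n w) / a n + gam `^ s * (W n w / a n - 1) by ring.
rewrite (le_trans (ler_normD _ _))// (splitr del) lerD//; last first.
  by rewrite normrM gtr0_norm// mulrC -ler_pdivlMr.
rewrite normrM normfV [X in _ / X]gtr0_norm// (@le_trans _ _ (K * ((a n)^-1 * Rm n w)))//.
  by rewrite mulrCA mulrC ler_wpM2l// invr_ge0 ltW.
rewrite (@le_trans _ _ ((K + 1) * `|(a n)^-1 * Rm n w|))//.
  have := ler_norm ((a n)^-1 * Rm n w); have := normr_ge0 ((a n)^-1 * Rm n w); nra.
by rewrite mulrC -ler_pdivlMr// ltr_wpDl.
Unshelve. all: by end_near. Qed.

End vanishing.

(** * Harmonic sums and exponential order statistics *)

Section harmonic_sums.
Context {R : realType}.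

Lemma harmonic_ge (k n : nat) : (k <= n)%N ->
  ln n.+1%:R - ln k.+1%:R <= \sum_(k <= i < n) i.+1%:R^-1 :> R.
Proof.
move=> kn; rewrite -(telescope_sumr (fun i => ln i.+1%:R))//.
apply: ler_sum_nat => i _.
rewrite -ln_div ?posrE ?ltr0n// (_ : _ / _ = 1 + i.+1%:R^-1 :> R).
  by apply: le_ln1Dx; rewrite (lt_le_trans (ltrN10 _))// invr_ge0.
have i1 : i.+1%:R != 0 :> R by rewrite pnatr_eq0.
by apply: (mulIf i1); rewrite divfK// mulrDl mul1r mulVf// natr1.
Qed.

Lemma harmonic_le (n : nat) : (0 < n)%N ->
  \sum_(0 <= i < n) i.+1%:R^-1 <= 1 + ln n%:R :> R.
Proof.
case: n => // n _; rewrite big_nat_recl// invr1 lerD2l.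
have := telescope_sumr (fun i => ln i.+1%:R : R) (leq0n n).
rewrite /= ln1 subr0 => <-.
apply: ler_sum_nat => i _.
rewrite -lerN2 opprB -ln_div ?posrE ?ltr0n//.
rewrite (_ : _ / _ = 1 + - i.+2%:R^-1 :> R).
  by apply: le_ln1Dx; rewrite ltrN2 invf_lt1 ?ltr0n// ltr1n.
have i2 : i.+2%:R != 0 :> R by rewrite pnatr_eq0.
by apply: (mulIf i2); rewrite divfK// mulrBl mul1r mulVf// -[i.+2%:R]natr1 addrK.
Qed.

Lemma sum_inv_sqr_le (k n : nat) : (0 < k <= n)%N ->
  \sum_(k <= i < n) (i.+1%:R^-1) ^+ 2 <= k%:R^-1 :> R.
Proof.
move=> /andP[k0 kn].
apply: (@le_trans _ _ (k%:R^-1 - n%:R^-1)); last by rewrite gerBl invr_ge0.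
rewrite -opprB -(telescope_sumr (fun i => i%:R^-1))// -sumrN.
apply: ler_sum_nat => i /andP[ki _]; rewrite opprB.
have i0 : 0 < i%:R :> R by rewrite ltr0n (leq_trans k0).
have i1 : 0 < i.+1%:R :> R by rewrite ltr0n.
have -> : i%:R^-1 - i.+1%:R^-1 = i%:R^-1 * i.+1%:R^-1 :> R.
  by rewrite -natr1; field; rewrite natr1 !gt_eqF.
rewrite expr2; apply: ler_wpM2r; first by rewrite invr_ge0 ltW.
by rewrite lef_pV2// ler_nat.
Qed.

Lemma sum0_inv_sqr_le (n : nat) :
  \sum_(0 <= i < n) (i.+1%:R^-1) ^+ 2 <= 2 :> R.
Proof.
case: n => [|n]; first by rewrite big_geq.
rewrite big_ltn// invr1 expr1n (_ : 2 = 1 + 1)// lerD2l.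
by rewrite (le_trans (sum_inv_sqr_le _))// invr1.
Qed.

End harmonic_sums.

Section exponential_spacings.
Context {R : realType} d (T : measurableType d) (Q : probability T R).
Variable E : nat -> {RV Q >-> R}.
Hypothesis E_indep : mutually_independent E.
Local Notation std := (@exponential_measure R 1 ltr01).
Hypothesis E_law : forall i A, measurable A -> Q (E i @^-1` A) = std A.

Definition exp_order_stat (n j : nat) (w : T) : R :=
  \sum_(j <= r < n.+1) E r.-1 w / r%:R.

Local Notation Z := exp_order_stat.

(** The cumulated list starts with the gap E_n / n and runs upwards, so for a = 0 its entry [i] is
    Z_(n-i). *)
Lemma nth_cumul_scaled_gaps (a : R) n w i : (i < n)%N ->
  nth 0 (cumul a (scaled_gaps (sample E n w))) i = a + Z n (n - i) w.
Proof.
rewrite /Z; elim: n a i => // n IH a [|i] ni /=; rewrite size_sample.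
  by rewrite subn0 big_nat1.
rewrite IH// subSS [in RHS]big_nat_recr ?leqW ?leq_subr//=.
by rewrite -addrA; congr (_ + _); rewrite addrC.
Qed.

Lemma exp_order_stat_recl n j w : (j <= n)%N ->
  Z n j w = E j.-1 w / j%:R + Z n j.+1 w.
Proof. by move=> jn; rewrite /Z big_ltn. Qed.

(** A null set removed once for all indices: off it Z_j is nonincreasing in j, and powers of the E_j
    have positive arguments. *)
Let nonpos := [set w | exists i, E i w <= 0].

Let nonpos_null : exists B : set T, [/\ measurable B, nonpos `<=` B & Q B = 0%E].
Proof.
have : Q.-negligible (\bigcup_i (E i @^-1` `]-oo, 0]%classic)).
  apply: negligible_bigcup => i; apply/negligibleP.
    by rewrite -[X in measurable X]setTI; exact: measurable_funPT.
  apply: etrans (E_law i (measurable_itv `]-oo, 0])) _.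
  have /= := @probability_setC _ _ _ std `]0, +oo[%classic.
  rewrite exponential_law_ray// mulr0 expR0 subee// => h.
  by rewrite -h// setCitvr.
move=> [B [mB B0 sB]]; exists B; split => // w [i Ei]; apply: sB.
by exists i => //=; rewrite in_itv.
Qed.

Lemma exponential_nonpos_vanishing : vanishing Q (fun=> nonpos).
Proof.
have [B [mB sB B0]] := nonpos_null.
by apply: (vanishing_sub _ (vanishing0 mB B0)); near=> n.
Unshelve. all: by end_near. Qed.

Lemma exp_order_stat_gt0 n j w : ~ nonpos w -> (0 < j <= n)%N -> 0 < Z n j w.
Proof.
move=> np /andP[j0 jn]; have E0 i : 0 < E i w.
  by rewrite ltNge; apply/negP => Ei; apply: np; exists i.
rewrite exp_order_stat_recl// ltr_pwDl ?divr_gt0 ?ltr0n//.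
by rewrite /Z big_nat; apply: sumr_ge0 => i /andP[ji _]; rewrite divr_ge0// ltW.
Qed.

Lemma exp_order_stat_le n i j w : ~ nonpos w -> (0 < i <= j)%N -> (j <= n.+1)%N ->
  Z n j w <= Z n i w.
Proof.
move=> np /andP[i0 ij] jn; rewrite /Z [leRHS](big_cat_nat ij jn)/= lerDr.
apply: sumr_ge0 => r _; rewrite divr_ge0// leNgt; apply/negP => Er.
by apply: np; exists r.-1; exact: ltW.
Qed.

(** Up to a null set this is Z_(k+1) minus its mean; the power 1 and the constant Gamma(2) = 1 let
    the moment lemma for x^r apply as it stands. *)
Let centered_sum (k n : nat) (w : T) : R :=
  \sum_(i <- index_iota k n) i.+1%:R^-1 * (E i w `^ 1 - Gamma_fun (1 + 1)).

Let Gamma2 : Gamma_fun (1 + 1) = 1 :> R.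
Proof.
have := std_moment (@ltr01 R); rewrite std_mean => /eqP.
by rewrite eqe => /eqP.
Qed.

Let centered_sumE k n w : ~ nonpos w ->
  centered_sum k n w = Z n k.+1 w - \sum_(k <= i < n) i.+1%:R^-1.
Proof.
move=> np; rewrite /centered_sum Gamma2 /Z big_add1/= -sumrB.
apply: eq_bigr => i _; rewrite powRr1.
  by rewrite mulrBr mulr1 mulrC.
by rewrite leNgt; apply/negP => Ei; apply: np; exists i; rewrite ltW.
Qed.

Let centered_sum_dev : exists2 v : R, 0 <= v & forall k n e, 0 < e ->
  (Q [set w | (e < `|centered_sum k n w|)%R] <=
   (v * (\sum_(k <= i < n) (i.+1%:R^-1) ^+ 2) / e ^+ 2)%:E)%E.
Proof.
have [v [g_int g_mean g_var]] := centered_power_variance (@ltr01 R).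
exists v.
  by rewrite -lee_fin -g_var; apply: integral_ge0 => x _; rewrite lee_fin sqr_ge0.
move=> k n e e0.
apply: (chebyshev_sum E_indep E_law _ g_int g_mean g_var (fun i => i.+1%:R^-1) _ e0).
  by apply: measurable_funB => //; exact: measurable_powR.
exact: iota_uniq.
Qed.

Let mcentered k n e : measurable [set w | e < `|centered_sum k n w|].
Proof.
apply: measurable_set_gt; apply: measurableT_comp => //.
apply: measurable_sum => i; apply: measurable_funM => //.
apply: measurable_funB => //.
apply: (@measurableT_comp _ _ _ _ _ _ (fun x : R => x `^ 1)) => //.
Qed.

Variable k : nat -> nat.
Hypothesis k_bounds : forall n, (2 <= n)%N -> (1 <= k n < n)%N.
Hypothesis k_infty : k n @[n --> \oo] --> \oo.

Let kR : (k n)%:R @[n --> \oo] --> (+oo : set_system R).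
Proof. by apply: cvg_comp k_infty _; exact: cvgr_idn. Qed.

Let k_ge (M : R) : \forall n \near \oo, M <= (k n)%:R.
Proof. by move/cvgryPge : kR; exact. Qed.

Let lnk_ge (M : R) : \forall n \near \oo, M <= ln (k n)%:R.
Proof.
near=> n; rewrite -[leLHS]expRK ler_ln ?posrE ?expR_gt0//; near: n; first exact: k_ge.
near=> n; rewrite (lt_le_trans ltr01)//; near: n; exact: k_ge.
Unshelve. all: by end_near. Qed.

Let kinv0 (v : R) : v * (k n)%:R^-1 @[n --> \oo] --> (0 : R).
Proof.
rewrite -(mulr0 v); apply: cvgMr.
by apply/gtr0_cvgV0 => //; near=> n; rewrite (lt_le_trans ltr01)//; near: n; exact: k_ge.
Unshelve. all: by end_near. Qed.

(** The mean of Z_(k+1) is at least ln ((n+1) / (k+1)) and its variance at most a constant over k. A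
    quarter of the margin ln lam absorbs the deviation, a half the passage from ln (k+1) to ln k. *)
Lemma exp_order_stat_lower (lam : R) : 1 < lam ->
  vanishing Q (fun n => [set w | Z n (k n).+1 w < ln n%:R - ln (k n)%:R - ln lam]).
Proof.
move=> lam1; have [v v0 hv] := centered_sum_dev.
have ll : 0 < ln lam by rewrite ln_gt0.
pose e := ln lam / 4; have e0 : 0 < e by rewrite divr_gt0.
have hvan : vanishing Q (fun n => [set w | e < `|centered_sum (k n) n w|]).
  apply: (@vanishing_le _ _ _ _ _ (fun n => v / e ^+ 2 * (k n)%:R^-1)) => //.
  near=> n; rewrite (le_trans (hv _ _ _ e0))// lee_fin mulrAC ler_wpM2l//.
    by rewrite divr_ge0// sqr_ge0.
  have n2 : (2 <= n)%N by near: n; exact: nbhs_infty_ge.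
  by apply: sum_inv_sqr_le; have /andP[-> /ltnW ->] := k_bounds n2.
apply: (vanishing_sub _ (vanishingU exponential_nonpos_vanishing hvan)).
near=> n => w /= Zw; apply: contrapT => /not_orP[np /negP].
rewrite -leNgt centered_sumE// => h.
have n2 : (2 <= n)%N by near: n; exact: nbhs_infty_ge.
have /andP[k1 /ltnW kn] := k_bounds n2.
have H := @harmonic_ge R _ _ kn.
have k0 : 0 < (k n)%:R :> R by rewrite ltr0n.
have lnk : ln (k n).+1%:R - ln (k n)%:R <= (k n)%:R^-1 :> R.
  rewrite -ln_div ?posrE// (_ : _ / _ = 1 + (k n)%:R^-1 :> R).
    by apply: le_ln1Dx; rewrite (lt_le_trans (ltrN10 _))// invr_ge0 ltW.
  by rewrite -natr1; field; rewrite gt_eqF.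
have lnn : ln n%:R <= ln n.+1%:R :> R.
  by rewrite ler_ln ?posrE ?ltr0n ?ler_nat// (leq_trans _ n2).
have ki : (k n)%:R^-1 <= ln lam / 2.
  rewrite -[leRHS]invrK lef_pV2 ?posrE ?invr_gt0 ?divr_gt0//.
  by near: n; exact: k_ge.
move: h; rewrite ler_norml => /andP[h _].
rewrite /e in h; lra.
Unshelve. all: by end_near. Qed.

(** The mean of Z_1 is at most 1 + ln n. Its variance does not tend to 0 but is bounded, so a
    deviation [M] depending only on [eps] is eventually absorbed by ln k. *)
Lemma exp_order_stat_upper :
  vanishing Q (fun n => [set w | ln n%:R + ln (k n)%:R < Z n 1 w]).
Proof.
have [v v0 hv] := centered_sum_dev.
move=> eps eps0.
(* Makes the Chebyshev bound 2 v / M^2 at most [eps]; the 1 keeps [M] positive if v = 0. *)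
pose M := Num.sqrt (2 * v / eps) + 1.
have M0 : 0 < M by rewrite ltr_wpDl ?sqrtr_ge0.
have hM : 2 * v / M ^+ 2 <= eps.
  rewrite ler_pdivrMr ?exprn_gt0// -ler_pdivrMl// [leLHS]mulrC.
  have q0 : 0 <= 2 * v / eps by rewrite divr_ge0 ?mulr_ge0// ltW.
  have := sqr_sqrtr q0; have := sqrtr_ge0 (2 * v / eps); rewrite /M.
  move: (Num.sqrt _) => q q1 <-; rewrite ler_sqr ?nnegrE ?addr_ge0//.
  by rewrite lerDl.
have [B [mB nB QB]] := nonpos_null.
near=> n.
exists (B `|` [set w | M < `|centered_sum 0 n w|]); split.
- exact: measurableU.
- move=> w /= Zw; have [np|np] := pselect (nonpos w); first by left; exact: nB.
  right => /=; rewrite centered_sumE//.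
  have n0 : (0 < n)%N by near: n; exact: nbhs_infty_gt.
  have H := @harmonic_le R _ n0.
  have lk : M + 2 <= ln (k n)%:R by near: n; exact: lnk_ge.
  by rewrite (lt_le_trans _ (ler_norm _))//; lra.
have QU : (Q (B `|` [set w | (M < `|centered_sum 0 n w|)%R]) <=
    Q B + Q [set w | (M < `|centered_sum 0 n w|)%R])%E by exact: measureU2.
rewrite (le_trans QU)// QB add0e.
rewrite (le_trans (hv _ _ _ M0))// lee_fin (le_trans _ hM)//.
rewrite ler_wpM2r ?invr_ge0 ?sqr_ge0// [leRHS]mulrC ler_wpM2l//.
exact: sum0_inv_sqr_le.
Unshelve. all: by end_near. Qed.

(** The sum has mean a_n and variance v sigma_n^2, with v the variance of E^s; at level e a_n
    Chebyshev's bound is (v / e^2) (sigma_n / a_n)^2. *)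
Lemma weighted_power_law_of_large_numbers (f : nat -> R) (s : R) : 0 < s ->
  (forall j, (1 <= j)%N -> 0 <= f j) ->
  (\forall n \near \oo, 0 < a_norm f s (k n)) ->
  sigma f s (k n) / a_norm f s (k n) @[n --> \oo] --> (0 : R) ->
  forall e, 0 < e -> vanishing Q (fun n => [set w |
    e < `|\sum_(1 <= j < (k n).+1) f j * (E j.-1 w / j%:R) `^ s / a_norm f s (k n) - 1|]).
Proof.
move=> s0 f0 a0 sa e e0.
have [v [g_int g_mean g_var]] := centered_power_variance s0.
pose c (i : nat) := f i.+1 * i.+1%:R `^ (- s).
pose Y k w := \sum_(i <- index_iota 0 k) c i * (E i w `^ s - Gamma_fun (s + 1)).
have c2 m : \sum_(i <- index_iota 0 m) c i ^+ 2 = sigma f s m ^+ 2.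
  rewrite /sigma sqr_sqrtr; last first.
    by rewrite big_nat; apply: sumr_ge0 => i _; rewrite mulr_ge0 ?sqr_ge0 ?powR_ge0.
  rewrite big_add1 /=; apply: eq_bigr => i _; rewrite /c exprMn; congr (_ * _).
  by rewrite -powR_mulrn ?powR_ge0// -powRrM; congr (_ `^ _); ring.
have mY m x : measurable [set w | x < `|Y m w|].
  apply: measurable_set_gt; apply: measurableT_comp => //.
  apply: measurable_sum => i; apply: measurable_funM => //.
  apply: measurable_funB => //.
  apply: (@measurableT_comp _ _ _ _ _ _ (fun x : R => x `^ s)) => //.
have hY : vanishing Q (fun n => [set w | e * a_norm f s (k n) < `|Y (k n) w|]).
  apply: (@vanishing_le _ _ _ _ _ (fun n => v / e ^+ 2 * (sigma f s (k n) / a_norm f s (k n)) ^+ 2)) => //.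
    near=> n; have an : 0 < a_norm f s (k n) by near: n.
    have := @chebyshev_sum _ _ _ _ E std E_indep E_law _ v _ g_int g_mean g_var
      (index_iota 0 (k n)) c (e * a_norm f s (k n)).
    move=> /(_ _ (iota_uniq _ _) (mulr_gt0 e0 an)) h; apply: (le_trans (h _)).
      by apply: measurable_funB => //; exact: measurable_powR.
    rewrite lee_fin c2 le_eqVlt; apply/orP; left; apply/eqP.
    by field; rewrite !gt_eqF.
  rewrite -(mulr0 (v / e ^+ 2)); apply: cvgMr.
  by have := cvgM sa sa; rewrite mulr0; exact.
apply: (vanishing_sub _ (vanishingU exponential_nonpos_vanishing hY)).
near=> n => w /= hw; apply: contrapT => /not_orP[np /negP].
have an : 0 < a_norm f s (k n) by near: n.
rewrite -leNgt => h; move: hw; apply/negP; rewrite -leNgt.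
have YE : Y (k n) w = \sum_(1 <= j < (k n).+1) f j * (E j.-1 w / j%:R) `^ s - a_norm f s (k n).
  rewrite /a_norm mulr_sumr -sumrB big_add1 /=; apply: eq_bigr => i _ /=.
  have Ei : 0 <= E i w by rewrite leNgt; apply/negP => Ei; apply: np; exists i; rewrite ltW.
  rewrite powRM ?invr_ge0// /c.
  have -> : (i.+1%:R^-1 : R) `^ s = i.+1%:R `^ (- s).
    by rewrite -powR_inv1// -powRrM mulN1r.
  by ring.
rewrite -mulr_suml -[X in _ - X](divff (lt0r_neq0 an)) -mulrBl -YE.
by rewrite normrM normfV [X in _ / X]gtr0_norm// ler_pdivrMr.
Unshelve. all: by end_near. Qed.

End exponential_spacings.

(** * Normalization by a_n and by sigma_n *)

Section normalizations.
Context {R : realType}.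
Variables (f : nat -> R) (s : R) (k : nat -> nat).
Hypotheses (f0 : forall j, (1 <= j)%N -> 0 <= f j) (s0 : 0 < s).
Hypothesis k_infty : k n @[n --> \oo] --> \oo.
Context d (T : measurableType d) (Q : probability T R).
Variable Rm : nat -> T -> R.
Hypothesis mRm : forall n, measurable_fun setT (Rm n).

Let term j := f j ^+ 2 * j%:R `^ (- (2 * s)).
Let term0 j : 0 <= term j. Proof. by rewrite mulr_ge0 ?sqr_ge0 ?powR_ge0. Qed.

Let norm_vanishing (c : nat -> R) :
  cvg_in_probability Q (fun n w => c n * Rm n w) 0 ->
  forall e, 0 < e -> vanishing Q (fun n => [set w | e < `|c n * Rm n w|]).
Proof.
move=> h e e0; apply/vanishing_cvg.
  move=> n; apply: measurable_set_gt; apply: measurableT_comp => //.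
  exact: measurable_funM.
by have := h e e0; under eq_fun do under eq_set do rewrite subr0.
Qed.

(** sigma_n stays below the square root of the series while a_n diverges. *)
Lemma normalization_convergent :
  (\sum_(1 <= j <oo) (term j)%:E < +oo)%E ->
  a_norm f s (k n) @[n --> \oo] --> +oo ->
  cvg_in_probability Q (fun n w => (a_norm f s (k n))^-1 * Rm n w) 0 ->
  [/\ (\forall n \near \oo, 0 < a_norm f s (k n)),
      sigma f s (k n) / a_norm f s (k n) @[n --> \oo] --> (0 : R) &
      forall e, 0 < e -> vanishing Q (fun n =>
        [set w | e < `|(a_norm f s (k n))^-1 * Rm n w|])].
Proof.
move=> Sfin aoo hR.
have a0 : \forall n \near \oo, 0 < a_norm f s (k n).
  near=> n; rewrite (lt_le_trans ltr01)//; near: n; by move/cvgryPge : aoo; exact.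
split => //; last exact: norm_vanishing.
set S := (\sum_(1 <= j <oo) (term j)%:E)%E in Sfin.
have sS m : sigma f s m <= Num.sqrt (fine S).
  rewrite /sigma ler_wsqrtr// -lee_fin fineK; last first.
    by rewrite ge0_fin_numE// nneseries_ge0// => j _ _; rewrite lee_fin.
  rewrite -sumEFin; by apply: nneseries_lim_ge => *; rewrite lee_fin; exact: term0.
apply/cvgrPdist_le => e e0; near=> n.
have an : 0 < a_norm f s (k n) by near: n.
rewrite sub0r normrN ger0_norm; last by rewrite divr_ge0 ?sqrtr_ge0// ltW.
rewrite ler_pdivrMr// (le_trans (sS _))// -ler_pdivrMl//.
by near: n; move/cvgryPge : aoo; exact.
Unshelve. all: by end_near. Qed.

(** R_n / a_n is the product of sigma_n / a_n and R_n / sigma_n, which both tend to 0. *)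
Lemma normalization_divergent :
  (\sum_(1 <= j <oo) (term j)%:E = +oo)%E ->
  (a_norm f s (k n))^-1 * sigma f s (k n) @[n --> \oo] --> (0 : R) ->
  cvg_in_probability Q (fun n w => (sigma f s (k n))^-1 * Rm n w) 0 ->
  [/\ (\forall n \near \oo, 0 < a_norm f s (k n)),
      sigma f s (k n) / a_norm f s (k n) @[n --> \oo] --> (0 : R) &
      forall e, 0 < e -> vanishing Q (fun n =>
        [set w | e < `|(a_norm f s (k n))^-1 * Rm n w|])].
Proof.
move=> Soo as0 hR.
(* As the inverse of 0 is 0, limits of quotients do not exclude a_n = 0 or sigma_n = 0; a positive
   term of the series does, as soon as k >= j0. *)
have [j0 j01 tj0] : exists2 j0, (1 <= j0)%N & 0 < term j0.
  apply: contrapT => h; move: Soo; rewrite eseries0// => j j1 _.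
  congr EFin; apply/eqP; rewrite eq_le term0 andbT leNgt; apply/negP => tj.
  by apply: h; exists j.
have fj0 : 0 < f j0.
  rewrite lt_def f0// andbT; apply: contraTneq tj0 => fj.
  by rewrite /term fj expr0n mul0r ltxx.
have j0R : 0 < j0%:R :> R by rewrite ltr0n.
have split_sum (F : nat -> R) m : (j0 <= m)%N -> (forall j, (1 <= j)%N -> 0 <= F j) ->
    F j0 <= \sum_(1 <= j < m.+1) F j.
  move=> jm F0; rewrite (@big_cat_nat _ _ _ j0)//= ?leqW//.
  rewrite [X in _ + X]big_ltn// addrCA lerDl addr_ge0//.
    by rewrite big_nat; apply: sumr_ge0 => i /andP[i1 _]; exact: F0.
  rewrite big_nat; apply: sumr_ge0 => i /andP[i1 _].
  by apply: F0; rewrite (leq_trans _ i1).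
have kj : \forall n \near \oo, (j0 <= k n)%N by move/cvgnyPge : k_infty; exact.
have a0 : \forall n \near \oo, 0 < a_norm f s (k n).
  near=> n; rewrite /a_norm mulr_gt0 ?Gamma_fun_gt0//.
  apply: (@lt_le_trans _ _ (f j0 * j0%:R `^ (- s))); first by rewrite mulr_gt0 ?powR_gt0.
  apply: (split_sum (fun j => f j * j%:R `^ (- s))); first by near: n.
  by move=> j j1; rewrite mulr_ge0 ?powR_ge0 ?f0.
have sig0 : \forall n \near \oo, 0 < sigma f s (k n).
  near=> n; rewrite /sigma sqrtr_gt0 (lt_le_trans tj0)//.
  by apply: split_sum => //; near: n.
have sa : sigma f s (k n) / a_norm f s (k n) @[n --> \oo] --> (0 : R).
  by under eq_fun do rewrite mulrC.
split => // e e0.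
apply: (vanishing_sub _ (norm_vanishing hR ltr01)).
near=> n => w /= h; rewrite ltNge; apply/negP => h1.
have an : 0 < a_norm f s (k n) by near: n.
have sn : 0 < sigma f s (k n) by near: n.
have se : sigma f s (k n) / a_norm f s (k n) <= e.
  rewrite (le_trans (ler_norm _))// -normrN -sub0r.
  by near: n; move/cvgrPdist_le : sa; exact.
move: h; apply/negP; rewrite -leNgt.
have -> : (a_norm f s (k n))^-1 * Rm n w =
    (sigma f s (k n) / a_norm f s (k n)) * ((sigma f s (k n))^-1 * Rm n w).
  by field; rewrite !gt_eqF.
rewrite normrM gtr0_norm ?divr_gt0//.
rewrite (le_trans _ se)// -[leRHS]mulr1 ler_wpM2l// ltW// divr_gt0//.
Unshelve. all: by end_near. Qed.

End normalizations.

(** * Reduction to the exponential variables *)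

Section reduction.
Context {R : realType} d (T : measurableType d) (P : probability T R)
  d' (T' : measurableType d') (Q : probability T' R).
Variables (X : nat -> {RV P >-> R}) (E : nat -> {RV Q >-> R}) (F : R -> R).
Local Notation std := (@exponential_measure R 1 ltr01).
Hypothesis X_indep : mutually_independent X.
Hypothesis X_cdf : forall i x, cdf (X i) x = (F x)%:E.
Hypothesis X_gt1 : forall i, {ae P, forall w, 1 < X i w}.
Hypothesis E_indep : mutually_independent E.
Hypothesis E_law : forall i A, measurable A -> Q (E i @^-1` A) = std A.
Variables (f : nat -> R) (s : R) (k : nat -> nat).
Hypotheses (f0 : forall j, (1 <= j)%N -> 0 <= f j) (s0 : 0 < s).
Hypothesis k_bounds : forall n, (2 <= n)%N -> (1 <= k n < n)%N.

Local Notation L z := (gen_inverse (fun x => F (expR x)) (1 - expR (- z))).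
Local Notation Z := (exp_order_stat E).

Let TQ n w := \sum_(1 <= j < (k n).+1) f j * (L (Z n j w) - L (Z n j.+1 w)) `^ s.

(** For fixed n the event depends on the sorted sample alone, so its probability can be computed on
    the other space, with [TQ] in place of T_n. *)
Let T_stat_law n (A0 a l e : R) : (2 <= n)%N ->
  let A := [set w | e < `|A0 * (TQ n w / a) `^ s^-1 - l|] in
  measurable A /\ P [set w | e < `|A0 * (T_stat X f s (k n) n w / a) `^ s^-1 - l|] = Q A.
Proof.
move=> n2 A; have /andP[k1 kn] := k_bounds n2.
pose Sm (t : seq R) := \sum_(1 <= j < (k n).+1)
  f j * (ln (nth 0 t (n - j)) - ln (nth 0 t (n - j).-1)) `^ s.
pose psi (t : seq R) := `|A0 * (Sm t / a) `^ s^-1 - l|.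
have mpsi : measurable_functional (EFin \o psi).
  move=> m; apply/measurable_EFinP.
  have mt i : measurable_fun setT (fun t : m.-tuple R => ln (nth 0 t i)).
    by apply: measurableT_comp => //; have [_] := @measurable_list_tuple R m; exact.
  apply: measurableT_comp => //; apply: measurable_funB => //.
  apply: measurable_funM => //.
  apply: (@measurableT_comp _ _ _ _ _ _ (fun x : R => x `^ s^-1)) => //.
  apply: measurable_funM => //; apply: measurable_sum => j.
  apply: measurable_funM => //.
  apply: (@measurableT_comp _ _ _ _ _ _ (fun x : R => x `^ s)) => //.
  exact: measurable_funB.
have TE w : TQ n w = Sm (map (quantile_map F) (cumul 0 (scaled_gaps (sample E n w)))).
  rewrite /TQ /Sm !big_nat; apply: eq_bigr => j /andP[j1 jk].
  have jn : (j < n)%N by exact: leq_ltn_trans kn.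
  have sz : size (cumul 0 (scaled_gaps (sample E n w))) = n.
    by rewrite size_cumul size_scaled_gaps size_sample.
  have n1 : (n - j < n)%N by rewrite ltn_subrL j1 (leq_trans _ n2).
  have n2' : ((n - j).-1 < n)%N by rewrite (leq_ltn_trans (leq_pred _)).
  have lnq i : (i < n)%N -> ln (nth 0 (map (quantile_map F)
      (cumul 0 (scaled_gaps (sample E n w)))) i) = L (Z n (n - i) w).
    move=> ni; rewrite (nth_map 0); last by rewrite sz.
    by rewrite nth_cumul_scaled_gaps// add0r /quantile_map expRK.
  rewrite (lnq _ n1) (lnq _ n2') (subKn (ltnW jn)).
  (* Position n - j - 1 carries Z_(j+1); the predecessor is a true one because j <= k < n. *)
  suff -> : (n - (n - j).-1 = j.+1)%N by [].
  by rewrite -subn1 subnBA ?subn_gt0// addn1 subSn ?leq_subr// subKn// ltnW.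
have AE : A = [set w | e < psi (map (quantile_map F) (cumul 0 (scaled_gaps (sample E n w))))].
  by apply: eq_set => w; rewrite TE.
have TS w : T_stat X f s (k n) n w = Sm (sort <=%O (sample X n w)).
  by apply: eq_bigr => j _; rewrite !order_stat_sample.
split.
  rewrite AE; apply: measurable_set_gt; apply/measurable_EFinP.
  apply: (measurable_functional_comp mpsi).
  apply: measurable_list_map; last first.
    apply: measurable_list_cumul; first exact: measurable_cst.
    by apply: measurable_list_scaled_gaps; apply: measurable_sample.
  apply: measurable_realfun.nondecreasing_measurable measurableT _ => x y xy.
  by rewrite ler_expR (log_quantile_mono X_cdf X_gt1).
rewrite AE -(probability_order_statistics X_indep X_cdf X_gt1 E_indep E_law _ _ mpsi).
have BE : [set w | e < `|A0 * (T_stat X f s (k n) n w / a) `^ s^-1 - l|] =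
    [set w | e < psi (sort <=%O (sample X n w))].
  by apply: eq_set => w; rewrite TS.
exact: (congr1 (fun B : set T => P B) BE).
Qed.

(** The remainder carries a factor s that the power inequality lacks, whence K / s. *)
Lemma perturbed_power_sum (K C : R) (m : nat) (x y D : nat -> R) : 0 <= K ->
  (forall x y D, 0 <= x -> 0 <= y -> 0 <= D -> `|y - x| <= C * D ->
    `|y `^ s - x `^ s| <= K * ((x + D) `^ (s - 1) * D)) ->
  (forall j, (1 <= j <= m)%N ->
    [/\ 0 <= x j, 0 <= y j, 0 <= D j & `|y j - x j| <= C * D j]) ->
  `|\sum_(1 <= j < m.+1) f j * y j `^ s - \sum_(1 <= j < m.+1) f j * x j `^ s| <=
  K / s * \sum_(1 <= j < m.+1) f j * s * (x j + D j) `^ (s - 1) * D j.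
Proof.
move=> K0 hK h; rewrite -sumrB (le_trans (ler_norm_sum _ _ _))// mulr_sumr !big_nat.
apply: ler_sum => j jm; have [x0 y0 D0 yx] := h j jm; have /andP[j1 _] := jm.
rewrite -mulrBr normrM ger0_norm ?f0//.
apply: (@le_trans _ _ (f j * (K * ((x j + D j) `^ (s - 1) * D j)))).
  by rewrite ler_wpM2l ?f0//; exact: hK.
by rewrite le_eqVlt; apply/orP; left; apply/eqP; field; rewrite gt_eqF.
Qed.

(** Common end of both cases, with scale [A0] equal to 1 for Karamata and to a(k/n) for de Haan.
    Being positive, [A0] comes out of the power s and cancels after the root, so it is the spacings
    divided by [A0] that are compared with gam E_j / j. *)
Lemma cvg_in_probability_reduction (gam C : R) (A0 : nat -> R)
    (D : nat -> nat -> T' -> R) (Bad : nat -> set T') (Rm : nat -> T' -> R) :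
  0 < gam -> 0 <= C -> k n @[n --> \oo] --> \oo ->
  (forall n w, Rm n w = \sum_(1 <= j < (k n).+1)
     f j * s * (gam * (E j.-1 w / j%:R) + D n j w) `^ (s - 1) * D n j w) ->
  vanishing Q Bad ->
  (\forall n \near \oo, 0 < A0 n) ->
  (\forall n \near \oo, forall w j, ~ Bad n w -> (forall i, 0 < E i w) ->
     (1 <= j <= k n)%N -> 0 <= D n j w /\
     `|(L (Z n j w) - L (Z n j.+1 w)) / A0 n - gam * (E j.-1 w / j%:R)| <= C * D n j w) ->
  [/\ (\forall n \near \oo, 0 < a_norm f s (k n)),
      sigma f s (k n) / a_norm f s (k n) @[n --> \oo] --> (0 : R) &
      forall e, 0 < e -> vanishing Q (fun n =>
        [set w | e < `|(a_norm f s (k n))^-1 * Rm n w|])] ->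
  cvg_in_probability P (fun n w =>
    (A0 n)^-1 * (T_stat X f s (k n) n w / a_norm f s (k n)) `^ s^-1) gam.
Proof.
move=> gam0 C0 k_infty RmE hBad hA0 hsp [ha hsa hR] e e0.
have [K K0 hK] := powR_perturbation s0 C0.
pose np (_ : nat) := [set w | exists i, E i w <= 0].
have hnp : vanishing Q np by exact: exponential_nonpos_vanishing.
pose y n j w := (L (Z n j w) - L (Z n j.+1 w)) / A0 n.
pose S n w := \sum_(1 <= j < (k n).+1) f j * y n j w `^ s.
pose W n w := \sum_(1 <= j < (k n).+1) f j * (E j.-1 w / j%:R) `^ s.
have npE w n : ~ np n w -> forall i, 0 < E i w.
  by move=> h i; rewrite ltNge; apply/negP => Ei; apply: h; exists i.
have Ldiff n j w : (1 <= j <= k n)%N -> (2 <= n)%N -> ~ np n w ->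
    0 <= L (Z n j w) - L (Z n j.+1 w).
  move=> /andP[j1 jk] n2 h; have /andP[k1 kn] := k_bounds n2.
  rewrite subr_ge0; apply: (log_quantile_mono X_cdf X_gt1).
  apply: (exp_order_stat_le h); first by rewrite j1 leqnSn.
  by rewrite ltnS ltnW// (leq_ltn_trans jk).
have hS : vanishing Q (fun n => [set w | e < `|(S n w / a_norm f s (k n)) `^ s^-1 - gam|]).
  apply: (@vanishing_power_mean _ _ _ _ _ W S Rm gam s (K / s) (fun n => Bad n `|` np n)) => //.
  - by rewrite divr_ge0// ltW.
  - exact: vanishingU.
  - near=> n => w /not_orP[nB nN].
    have n2 : (2 <= n)%N by near: n; exact: nbhs_infty_ge.
    have An : 0 < A0 n by near: n.
    have E0 := npE _ _ nN.
    have hn : forall w j, ~ Bad n w -> (forall i, 0 < E i w) ->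
       (1 <= j <= k n)%N -> 0 <= D n j w /\ `|y n j w - gam * (E j.-1 w / j%:R)| <= C * D n j w.
      by near: n.
    have y0 j : (1 <= j <= k n)%N -> 0 <= y n j w.
      by move=> jk; rewrite /y divr_ge0 ?Ldiff// ltW.
    split.
      rewrite /S big_nat; apply: sumr_ge0 => j /andP[j1 _].
      by rewrite mulr_ge0 ?f0 ?powR_ge0.
    have -> : gam `^ s * W n w =
        \sum_(1 <= j < (k n).+1) f j * (gam * (E j.-1 w / j%:R)) `^ s.
      rewrite /W mulr_sumr; apply: eq_bigr => j _.
      by rewrite (powRM _ (ltW gam0)) ?divr_ge0 ?(ltW (E0 _))// mulrCA.
    rewrite RmE; apply: (perturbed_power_sum K0 hK) => j jk.
    have [D0 hy] := hn w j nB E0 jk; split => //; last exact: y0.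
    by rewrite mulr_ge0 ?(ltW gam0)// divr_ge0// (ltW (E0 _)).
  - move=> e' e'0; have := weighted_power_law_of_large_numbers E_indep E_law s0 f0 ha hsa e'0.
    by apply: vanishing_sub; near=> n => w /=; rewrite /W mulr_suml.
pose A n := [set w | e < `|(A0 n)^-1 * (TQ n w / a_norm f s (k n)) `^ s^-1 - gam|].
(* For n < 2 nothing bounds k, whereas [vanishing_cvg] asks for measurability at every n. *)
pose A' n := if (2 <= n)%N then A n else set0.
have mA' n : measurable (A' n).
  rewrite /A'; case: ifPn => // n2.
  by have [] := T_stat_law (A0 n)^-1 (a_norm f s (k n)) gam e n2.
have hA' : vanishing Q A'.
  apply: (vanishing_sub _ (vanishingU hnp hS)).
  near=> n => w; have n2 : (2 <= n)%N by near: n; exact: nbhs_infty_ge.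
  rewrite /A' n2 /A /= => h; have [nN|nN] := pselect (np n w); [by left|right].
  have An : 0 < A0 n by near: n.
  have an : 0 < a_norm f s (k n) by near: n.
  have TS : TQ n w = A0 n `^ s * S n w.
    rewrite /TQ /S mulr_sumr !big_nat; apply: eq_bigr => j jk.
    rewrite mulrCA -powRM ?(ltW An)//; last by rewrite /y divr_ge0 ?Ldiff// ltW.
    by congr (_ * _ `^ _); rewrite /y mulrC divfK// gt_eqF.
  move: h; rewrite TS -mulrA powRM ?powR_ge0//; last first.
    rewrite divr_ge0 ?(ltW an)// /S big_nat; apply: sumr_ge0 => j /andP[j1 _].
    by rewrite mulr_ge0 ?f0 ?powR_ge0.
  by rewrite -powRrM divff ?gt_eqF// powRr1 ?(ltW An)// mulKf// gt_eqF.
have := (vanishing_cvg Q mA').1 hA'.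
apply: cvg_trans; apply: near_eq_cvg; near=> n.
have n2 : (2 <= n)%N by near: n; exact: nbhs_infty_ge.
rewrite /A' n2.
by have [_ ->] := T_stat_law (A0 n)^-1 (a_norm f s (k n)) gam e n2.
Unshelve. all: by end_near. Qed.

End reduction.

(** * The Karamata and de Haan cases *)

Section convergence.
Context {R : realType} d (T : measurableType d) (P : probability T R)
  d' (T' : measurableType d') (Q : probability T' R).
Variables (X : nat -> {RV P >-> R}) (E : nat -> {RV Q >-> R}) (F : R -> R).
Local Notation std := (@exponential_measure R 1 ltr01).
Hypothesis X_indep : mutually_independent X.
Hypothesis X_cdf : forall i x, cdf (X i) x = (F x)%:E.
Hypothesis X_gt1 : forall i, {ae P, forall w, 1 < X i w}.
Hypothesis E_indep : mutually_independent E.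
Hypothesis E_law : forall i A, measurable A -> Q (E i @^-1` A) = std A.
Variables (f : nat -> R) (s c : R) (p b : R -> R) (k : nat -> nat).
Hypotheses (f0 : forall j, (1 <= j)%N -> 0 <= f j) (s0 : 0 < s).
Hypothesis k_bounds : forall n, (2 <= n)%N -> (1 <= k n < n)%N.
Hypothesis k_infty : k n @[n --> \oo] --> \oo.
Hypothesis k_small : (k n)%:R / n%:R @[n --> \oo] --> (0 : R).
Hypothesis p_cvg0 : p u @[u --> 0^'+] --> (0 : R).
Hypothesis b_cvg0 : b u @[u --> 0^'+] --> (0 : R).

Local Notation Z := (exp_order_stat E).

(** Off this event, and for positive E_i, the points e^(-Z_j) with j <= k + 1 lie in ]0, lam k / n],
    the range of the suprema p_n(lam) and b_n(lam). *)
Let early (lam : R) n :=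
  [set w | Z n (k n).+1 w < ln n%:R - ln (k n)%:R - ln lam].

Let expR_exp_order_stat_le lam n w j : 1 < lam -> (2 <= n)%N ->
  ~ early lam n w -> (forall i, 0 < E i w) -> (1 <= j <= k n)%N ->
  [/\ 0 < Z n j.+1 w, Z n j.+1 w <= Z n j w, Z n j w <= Z n 1 w &
      expR (- Z n j.+1 w) <= lam * ((k n)%:R / n%:R)].
Proof.
move=> lam1 n2 nB E0 /andP[j1 jk]; have /andP[k1 kn] := k_bounds n2.
have nN : ~ [set w | exists i, E i w <= 0] w.
  by move=> [i]; rewrite leNgt E0.
have jn : (j < n)%N by rewrite (leq_ltn_trans jk).
split.
- exact: exp_order_stat_gt0.
- by apply: exp_order_stat_le => //; rewrite ?j1 ?leqnSn// ltnS ltnW.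
- by apply: exp_order_stat_le => //; rewrite ?j1// ltnW// ltnS ltnW.
have n0 : 0 < n%:R :> R by rewrite ltr0n ltnW.
have k0 : 0 < (k n)%:R :> R by rewrite ltr0n.
have lam0 : 0 < lam := lt_trans ltr01 lam1.
have <- : expR (- (ln n%:R - ln (k n)%:R - ln lam)) = lam * ((k n)%:R / n%:R).
  rewrite opprB opprB addrA expRD expRN expRD !lnK ?posrE// mulrA.
  by [].
rewrite ler_expR lerN2; move/negP: nB; rewrite -leNgt => /le_trans; apply.
by apply: exp_order_stat_le => //; rewrite ltnS// ltnW.
Qed.

Let measurable_powR_comp r (g : T' -> R) : measurable_fun setT g ->
  measurable_fun setT (fun w => g w `^ r).
Proof.
move=> mg; have h := @measurableT_comp _ _ _ _ _ _ (fun x : R => x `^ r) _ g.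
by apply: h => //; exact: measurable_powR.
Qed.

Lemma measurable_Rem gamma lam n :
  measurable_fun setT (Rem E f s gamma p b lam (k n) n).
Proof.
apply: measurable_sum => j; rewrite /Delta.
have mE : measurable_fun setT (E j.-1) by [].
have mD : measurable_fun setT (fun w => local_sup p lam (k n) n +
    E j.-1 w / j%:R * local_sup b lam (k n) n).
  apply: measurable_funD => //; apply: measurable_funM => //.
  exact: measurable_funM.
apply: measurable_funM => //; apply: measurable_funM => //.
apply: measurable_powR_comp.
by apply: measurable_funD => //; apply: measurable_funM.
Qed.

Lemma measurable_Rem0 lam n :
  measurable_fun setT (Rem0 E f s p b lam (k n) n).
Proof.
apply: measurable_sum => j; rewrite /Delta0.
have mE : measurable_fun setT (E j.-1) by [].
have mEj : measurable_fun setT (fun w => E j.-1 w / j%:R) by apply: measurable_funM.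
set M := Order.max _ _.
have mD : measurable_fun setT (fun w => local_sup p lam (k n) n +
    E j.-1 w / j%:R * M).
  by apply: measurable_funD => //; apply: measurable_funM.
apply: measurable_funM => //; apply: measurable_funM => //.
apply: measurable_powR_comp.
exact: measurable_funD.
Qed.

Lemma karamata_cvg gamma lam : 0 < gamma -> 1 < lam ->
  karamata_representation F gamma c p b ->
  [/\ (\forall n \near \oo, 0 < a_norm f s (k n)),
      sigma f s (k n) / a_norm f s (k n) @[n --> \oo] --> (0 : R) &
      forall e, 0 < e -> vanishing Q (fun n =>
        [set w | e < `|(a_norm f s (k n))^-1 * Rem E f s gamma p b lam (k n) n w|])] ->
  cvg_in_probability P
    (fun n w => (T_stat X f s (k n) n w / a_norm f s (k n)) `^ s^-1) gamma.
Proof.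
move=> g0 lam1 KF ha.
have lam0 : 0 < lam := lt_trans ltr01 lam1.
suff h : cvg_in_probability P (fun n w => (1 : R)^-1 *
    (T_stat X f s (k n) n w / a_norm f s (k n)) `^ s^-1) gamma.
  by move=> e e0; have := h e e0; under eq_fun do under eq_set do rewrite invr1 mul1r.
apply: (@cvg_in_probability_reduction _ _ _ _ _ _ _ _ _ _ X_indep X_cdf X_gt1
   E_indep E_law f s k f0 s0 k_bounds gamma 4 (fun=> 1)
   (fun n j w => Delta p b lam (k n) n j (E j.-1 w)) (early lam)
   (fun n => Rem E f s gamma p b lam (k n) n) g0 (ler0n _ 4) k_infty) ha.
- by move=> n w; apply: eq_bigr => j _; rewrite mulrAC -mulrA.
- exact: (exp_order_stat_lower E_indep E_law k_bounds k_infty lam1).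
- by near=> n.
have half : 0 < 1 / 2 :> R by rewrite divr_gt0.
near=> n => w j nB E0 jk.
have n2 : (2 <= n)%N by near: n; exact: nbhs_infty_ge.
have [P0 P2 hP] : [/\ 0 <= local_sup p lam (k n) n, local_sup p lam (k n) n <= 1 / 2
    & forall t : R, 0 < t <= lam * ((k n)%:R / n%:R) -> `|p t| <= local_sup p lam (k n) n].
  by near: n; exact: local_sup_near.
have [B0 _ hB] : [/\ 0 <= local_sup b lam (k n) n, local_sup b lam (k n) n <= 1 / 2
    & forall t : R, 0 < t <= lam * ((k n)%:R / n%:R) -> `|b t| <= local_sup b lam (k n) n].
  by near: n; exact: local_sup_near.
have [z0 z12 _ zk] := expR_exp_order_stat_le lam1 n2 nB E0 jk.
have /andP[j1 jk'] := jk; have /andP[k1 kn] := k_bounds n2.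
have jn : (j < n.+1)%N by rewrite ltnS (leq_trans jk')// ltnW.
have zE : Z n j w - Z n j.+1 w = E j.-1 w / j%:R by rewrite exp_order_stat_recl ?j1// addrK.
split.
  by rewrite /Delta addr_ge0// mulr_ge0// divr_ge0// ltW.
rewrite divr1 /Delta -zE.
apply: (karamata_spacing KF z0 z12 P2 B0) => t /andP[t0 tz].
have tk : 0 < t <= lam * ((k n)%:R / n%:R) by rewrite t0 (le_trans tz).
by split; [exact: hP|exact: hB].
Unshelve. all: by end_near. Qed.

Lemma dehaan_cvg dd lam : 0 < c -> 1 < lam ->
  dehaan_representation F c dd p b ->
  local_sup b lam (k n) n * ln (k n)%:R @[n --> \oo] --> (0 : R) ->
  [/\ (\forall n \near \oo, 0 < a_norm f s (k n)),
      sigma f s (k n) / a_norm f s (k n) @[n --> \oo] --> (0 : R) &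
      forall e, 0 < e -> vanishing Q (fun n =>
        [set w | e < `|(a_norm f s (k n))^-1 * Rem0 E f s p b lam (k n) n w|])] ->
  cvg_in_probability P
    (fun n w => (dehaan_aux c p b ((k n)%:R / n%:R))^-1 *
      (T_stat X f s (k n) n w / a_norm f s (k n)) `^ s^-1) 1.
Proof.
move=> c0 lam1 HF blk ha.
have lam0 : 0 < lam := lt_trans ltr01 lam1.
have llam0 : 0 < ln lam by rewrite ln_gt0.
pose M n := Order.max (local_sup p lam (k n) n) (local_sup b lam (k n) n * ln (k n)%:R).
(* Small enough for both (ln lam + 2) M <= 1 and 4 M <= 1, and below 1, so that 1 + p(k/n) is
   positive. *)
pose del := (ln lam + 6)^-1.
have del0 : 0 < del by rewrite invr_gt0 addr_gt0.
pose good n := [/\ (2 <= n)%N, 1 <= ln (k n)%:R :> R,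
    lam * ((k n)%:R / n%:R) < 1, M n <= del &
    [/\ 0 <= local_sup p lam (k n) n, 0 <= local_sup b lam (k n) n &
     forall t : R, 0 < t <= lam * ((k n)%:R / n%:R) ->
     `|p t| <= local_sup p lam (k n) n /\ `|b t| <= local_sup b lam (k n) n]].
have hgood : \forall n \near \oo, good n.
  near=> n.
  have [P0 P2 hP] : [/\ 0 <= local_sup p lam (k n) n, local_sup p lam (k n) n <= del
    & forall t : R, 0 < t <= lam * ((k n)%:R / n%:R) -> `|p t| <= local_sup p lam (k n) n].
    by near: n; exact: local_sup_near.
  have [B0 _ hB] : [/\ 0 <= local_sup b lam (k n) n, local_sup b lam (k n) n <= del
    & forall t : R, 0 < t <= lam * ((k n)%:R / n%:R) -> `|b t| <= local_sup b lam (k n) n].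
    by near: n; exact: local_sup_near.
  split => //.
  - by near: n; exact: nbhs_infty_ge.
  - have : (Num.bound (expR 1 : R) <= k n)%N by near: n; move/cvgnyPge : k_infty; exact.
    rewrite -(ler_nat R) => hk.
    have e1k : expR 1 <= (k n)%:R :> R.
      by rewrite (le_trans _ hk)// ltW// archi_boundP// expR_ge0.
    rewrite -[leLHS]expRK ler_ln ?posrE ?expR_gt0//.
    exact: lt_le_trans (expR_gt0 1) e1k.
  - rewrite -ltr_pdivlMl// mulr1 (le_lt_trans (ler_norm _))// -normrN -sub0r.
    by near: n; move/cvgrPdist_lt : k_small; apply; rewrite invr_gt0.
  - rewrite /M ge_max P2 (le_trans (ler_norm _))// -normrN -sub0r.
    by near: n; move/cvgrPdist_le : blk; apply.
  by split => // t tk; split; [exact: hP|exact: hB].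
have A00 : \forall n \near \oo, 0 < dehaan_aux c p b ((k n)%:R / n%:R).
  near=> n.
  have [n2 lk1 lk2 Mdel [P0 B0 hpb]] : good n by near: n.
  have /andP[k1 kn] := k_bounds n2.
  have kap0 : 0 < (k n)%:R / n%:R :> R by rewrite divr_gt0 ?ltr0n// ltnW.
  have [pk _] : `|p ((k n)%:R / n%:R)| <= local_sup p lam (k n) n /\
      `|b ((k n)%:R / n%:R)| <= local_sup b lam (k n) n.
    by apply: hpb; rewrite kap0 ler_peMl// ltW.
  rewrite /dehaan_aux mulr_gt0 ?expR_gt0// mulr_gt0//.
  have := le_trans pk (le_trans _ Mdel); rewrite /M le_max lexx => /(_ isT).
  rewrite ler_norml => /andP[+ _].
  have del1 : del < 1 by rewrite invf_lt1 ?addr_gt0//; lra.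
  lra.
apply: (@cvg_in_probability_reduction _ _ _ _ _ _ _ _ _ _ X_indep X_cdf X_gt1
   E_indep E_law f s k f0 s0 k_bounds 1 (8 * (ln lam + 2) + 24)
   (fun n => dehaan_aux c p b ((k n)%:R / n%:R))
   (fun n j w => Delta0 p b lam (k n) n j (E j.-1 w))
   (fun n => early lam n `|` [set w | ln n%:R + ln (k n)%:R < Z n 1 w])
   (fun n => Rem0 E f s p b lam (k n) n) ltr01 _ k_infty _ _ A00) ha.
- by lra.
- by move=> n w; apply: eq_bigr => j _; rewrite mul1r.
- apply: vanishingU; last exact: (exp_order_stat_upper E_indep E_law k_infty).
  exact: (exp_order_stat_lower E_indep E_law k_bounds k_infty lam1).
near=> n => w j /not_orP[nB nU] E0 jk.
have [n2 lk1 lk2 Mdel [P0 B0 hpb]] : good n by near: n.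
have [z0 z12 z1 zk] := expR_exp_order_stat_le lam1 n2 nB E0 jk.
have /andP[j1 jk'] := jk; have /andP[k1 kn] := k_bounds n2.
have n0 : 0 < n%:R :> R by rewrite ltr0n ltnW.
have k0 : 0 < (k n)%:R :> R by rewrite ltr0n.
have kap0 : 0 < (k n)%:R / n%:R :> R by rewrite divr_gt0.
have jn : (j < n.+1)%N by rewrite ltnS (leq_trans jk')// ltnW.
have zE : Z n j w - Z n j.+1 w = E j.-1 w / j%:R by rewrite exp_order_stat_recl ?j1// addrK.
have PM : local_sup p lam (k n) n <= M n by rewrite /M le_max lexx.
have BM : local_sup b lam (k n) n * ln (k n)%:R <= M n by rewrite /M le_max lexx orbT.
have M0 : 0 <= M n := le_trans P0 PM.
split.
  by rewrite /Delta0 addr_ge0// mulr_ge0// divr_ge0// ltW.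
rewrite mul1r /Delta0 -zE -/(M n).
have lM : (ln lam + 6) * M n <= 1.
  by rewrite mulrC -ler_pdivlMr ?addr_gt0// mul1r.
(* From Z_j <= Z_1 <= ln n + ln k, the last sum being 2 ln k - ln (k/n). *)
have lz : ln ((k n)%:R / n%:R) - 2 * ln (k n)%:R <= - Z n j w.
  rewrite ln_div ?posrE// lerNr (le_trans z1)//.
  move/negP: nU; rewrite -leNgt => /le_trans; apply.
  by rewrite mulr2n mulrDl mul1r; lra.
have lM2 : (ln lam + 2) * M n <= 1.
  by apply: le_trans lM; rewrite ler_wpM2r//; lra.
have lM4 : 4 * M n <= 1.
  by apply: le_trans lM; rewrite ler_wpM2r//; lra.
by have [_] := dehaan_spacing c0 HF lam1 kap0 lk2 lk1 z0 z12 zk lz B0 PM BM lM2 lM4 hpb.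
Unshelve. all: by end_near. Qed.

End convergence.

Theorem theorem2 (R : realType)
    (dX : measure_display) (TX : measurableType dX) (P : probability TX R)
    (X : nat -> {RV P >-> R}) (F : R -> R)
    (dE : measure_display) (TE : measurableType dE) (Q : probability TE R)
    (E : nat -> {RV Q >-> R})
    (gamma s c d : R) (p b : R -> R) (f : nat -> R) (k : nat -> nat)
    (X_indep : mutually_independent X)
    (X_cdf : forall i x, cdf (X i) x = (F x)%:E)
    (X_gt1 : forall i, {ae P, forall w, 1 < X i w})
    (E_indep : mutually_independent E)
    (E_exp : forall i A, measurable A ->
       distribution Q (E i) A = exponential_prob 1 A)
    (gamma_ge0 : 0 <= gamma)
    (F_attr : domain_of_attraction F gamma)
    (f_ge0 : forall j, (1 <= j)%N -> 0 <= f j)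
    (s_gt0 : 0 < s)
    (k_bounds : forall n, (2 <= n)%N -> (1 <= k n < n)%N)
    (k_infty : k n @[n --> \oo] --> \oo)
    (k_small : (k n)%:R / n%:R @[n --> \oo] --> (0 : R))
    (c_gt0 : 0 < c)
    (p_cvg0 : p u @[u --> 0^'+] --> (0 : R))
    (b_cvg0 : b u @[u --> 0^'+] --> (0 : R)) :
  (0 < gamma -> karamata_representation F gamma c p b ->
    ((\sum_(1 <= j <oo) (f j ^+ 2 * j%:R `^ (- (2 * s)))%:E < +oo)%E ->
      a_norm f s (k n) @[n --> \oo] --> +oo ->
      (forall lambda, 1 < lambda ->
        cvg_in_probability Q
          (fun n w => (a_norm f s (k n))^-1
                      * Rem E f s gamma p b lambda (k n) n w) 0) ->
      cvg_in_probability P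
        (fun n w => (T_stat X f s (k n) n w / a_norm f s (k n)) `^ s^-1) gamma)
    /\
    ((\sum_(1 <= j <oo) (f j ^+ 2 * j%:R `^ (- (2 * s)))%:E = +oo)%E ->
      B_max f s (k n) @[n --> \oo] --> 0 ->
      (a_norm f s (k n))^-1 * sigma f s (k n) @[n --> \oo] --> 0 ->
      (forall lambda, 1 < lambda ->
        cvg_in_probability Q
          (fun n w => (sigma f s (k n))^-1
                      * Rem E f s gamma p b lambda (k n) n w) 0) ->
      cvg_in_probability P
        (fun n w => (T_stat X f s (k n) n w / a_norm f s (k n)) `^ s^-1) gamma))
  /\
  (gamma = 0 -> dehaan_representation F c d p b ->
    (exists2 lambda, 1 < lambda &
      local_sup b lambda (k n) n * ln (k n)%:R @[n --> \oo] --> 0) ->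
    ((\sum_(1 <= j <oo) (f j ^+ 2 * j%:R `^ (- (2 * s)))%:E < +oo)%E ->
      a_norm f s (k n) @[n --> \oo] --> +oo ->
      (forall lambda, 1 < lambda ->
        cvg_in_probability Q
          (fun n w => (a_norm f s (k n))^-1
                      * Rem0 E f s p b lambda (k n) n w) 0) ->
      cvg_in_probability P
        (fun n w => (dehaan_aux c p b ((k n)%:R / n%:R))^-1
                    * (T_stat X f s (k n) n w / a_norm f s (k n)) `^ s^-1) 1)
    /\
    ((\sum_(1 <= j <oo) (f j ^+ 2 * j%:R `^ (- (2 * s)))%:E = +oo)%E ->
      B_max f s (k n) @[n --> \oo] --> 0 ->
      (a_norm f s (k n))^-1 * sigma f s (k n) @[n --> \oo] --> 0 ->
      (forall lambda, 1 < lambda ->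
        cvg_in_probability Q
          (fun n w => (sigma f s (k n))^-1
                      * Rem0 E f s p b lambda (k n) n w) 0) ->
      cvg_in_probability P
        (fun n w => (dehaan_aux c p b ((k n)%:R / n%:R))^-1
                    * (T_stat X f s (k n) n w / a_norm f s (k n)) `^ s^-1) 1)).
Proof.
have E_law i A : measurable A -> Q (E i @^-1` A) = exponential_measure (@ltr01 R) A.
  by move=> mA; rewrite exponential_measureE; exact: (E_exp i A mA).
have two : 1 < 2 :> R by rewrite ltr1n.
split.
  move=> g0 KF; split.
    move=> Sfin aoo hR.
    apply: (karamata_cvg X_indep X_cdf X_gt1 E_indep E_law f_ge0 s_gt0 k_bounds
      k_infty k_small p_cvg0 b_cvg0 g0 two KF).
    apply: (normalization_convergent _ Sfin aoo (hR _ two)) => n.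
    exact: measurable_Rem.
  move=> Soo _ as0 hR.
  apply: (karamata_cvg X_indep X_cdf X_gt1 E_indep E_law f_ge0 s_gt0 k_bounds
    k_infty k_small p_cvg0 b_cvg0 g0 two KF).
  apply: (normalization_divergent f_ge0 s_gt0 k_infty _ Soo as0 (hR _ two)) => n.
  exact: measurable_Rem.
(* The de Haan estimates run at the lambda for which b_n(lambda) log k tends to 0. *)
move=> _ HF [lam lam1 blk]; split.
  move=> Sfin aoo hR.
  apply: (dehaan_cvg X_indep X_cdf X_gt1 E_indep E_law f_ge0 s_gt0 k_bounds
    k_infty k_small p_cvg0 b_cvg0 c_gt0 lam1 HF blk).
  apply: (normalization_convergent _ Sfin aoo (hR _ lam1)) => n.
  exact: measurable_Rem0.
move=> Soo _ as0 hR.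
apply: (dehaan_cvg X_indep X_cdf X_gt1 E_indep E_law f_ge0 s_gt0 k_bounds
  k_infty k_small p_cvg0 b_cvg0 c_gt0 lam1 HF blk).
apply: (normalization_divergent f_ge0 s_gt0 k_infty _ Soo as0 (hR _ lam1)) => n.
exact: measurable_Rem0.
Qed.
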